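(* Let $m>0$, $\kappa>0$, $\lambda>0$, $U\in\mathcal{C}^\infty(\mathbb{R}^2,\mathbb{R})$, and for $\varepsilon\in\mathbb{R}$ consider $$m\ddot x=-\kappa\frac{x}{|x|^3}-2\lambda\frac{x}{|x|^4}+\varepsilon\,\nabla U(x),\qquad x\in\mathbb{R}^2\setminus\{0\}. \qquad (\ast)$$ Let $H^*<0$ and $N\in\mathbb{N}$. Then for every $\varsigma>0$ there exists $\varepsilon^*=\varepsilon^*(N,\varsigma)>0$ such that for every $\varepsilon\in\mathbb{R}$ with $|\varepsilon|\le\varepsilon^*$, equation $(\ast)$ has at least $2N$ periodic solutions $x^i_1,\dots,x^i_N$, $i=1,2$, of energy $H^*$. Moreover, for every $j=1,\dots,N$ and $i=1,2$, the solution $x^i_j$ has minimal period $T_{i,j}$ satisfying $$\left|T_{i,j}-\frac{\pi\kappa\sqrt{m}}{\sqrt2\,(-H^* )^{3/2}}\right|<\varsigma$$ and winding number around the origin in its minimal period equal to $$\left\lfloor\frac{\sqrt{-2H^*}}{\kappa}\sqrt{2\lambda+\frac{\kappa^2}{-2H^*}}\right\rfloor+j.$$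
   Context: The energy of a solution $x$ of $(\ast)$ is the constant value of $E_\varepsilon(x,\dot x)=\frac12 m|\dot x|^2-\frac{\kappa}{|x|}-\frac{\lambda}{|x|^2}-\varepsilon\,U(x)$ along it. $\lfloor\cdot\rfloor$ denotes the integer part. *)

(* Defs.v *)
From Stdlib Require Import Reals Lra ZArith.
From Coquelicot Require Import Coquelicot.
Open Scope R_scope.

Definition d1 (f : R -> R -> R) : R -> R -> R :=
  fun x y => Derive (fun t => f t y) x.
Definition d2 (f : R -> R -> R) : R -> R -> R :=
  fun x y => Derive (fun t => f x t) y.

Fixpoint Ck (k : nat) (f : R -> R -> R) : Prop :=
  (forall p : R * R, continuous (fun q : R * R => f (fst q) (snd q)) p) /\
  match k with
  | O => True
  | S k' => (forall x y, ex_derive (fun t => f t y) x /\ ex_derive (fun t => f x t) y)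
            /\ Ck k' (d1 f) /\ Ck k' (d2 f)
  end.

Definition smooth2 (f : R -> R -> R) : Prop := forall k, Ck k f.

Definition nrm (p : R * R) : R := sqrt (fst p ^ 2 + snd p ^ 2).

Definition vel1 (x : R -> R * R) (t : R) : R := Derive (fun s => fst (x s)) t.
Definition vel2 (x : R -> R * R) (t : R) : R := Derive (fun s => snd (x s)) t.

Definition is_solution (m kappa lambda eps : R) (U : R -> R -> R)
  (x : R -> R * R) : Prop :=
  forall t,
    x t <> (0, 0) /\
    is_derive (fun s => fst (x s)) t (vel1 x t) /\
    is_derive (fun s => snd (x s)) t (vel2 x t) /\
    exists a1 a2 : R,
      is_derive (vel1 x) t a1 /\ is_derive (vel2 x) t a2 /\
      m * a1 = - kappa * fst (x t) / nrm (x t) ^ 3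
               - 2 * lambda * fst (x t) / nrm (x t) ^ 4
               + eps * d1 U (fst (x t)) (snd (x t)) /\
      m * a2 = - kappa * snd (x t) / nrm (x t) ^ 3
               - 2 * lambda * snd (x t) / nrm (x t) ^ 4
               + eps * d2 U (fst (x t)) (snd (x t)).

Definition energy (m kappa lambda eps : R) (U : R -> R -> R)
  (x : R -> R * R) (t : R) : R :=
  1 / 2 * m * (vel1 x t ^ 2 + vel2 x t ^ 2)
  - kappa / nrm (x t) - lambda / nrm (x t) ^ 2
  - eps * U (fst (x t)) (snd (x t)).

Definition is_period (x : R -> R * R) (T : R) : Prop :=
  forall t, x (t + T) = x t.

Definition minimal_period (x : R -> R * R) (T : R) : Prop :=
  0 < T /\ is_period x T /\ (forall T', 0 < T' < T -> ~ is_period x T').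

(* Winding number of x around the origin over the time interval [0, T]:
   the increment of a continuous polar angle, divided by 2 pi
   (independent of the choice of continuous angle). *)
Definition winding_number (x : R -> R * R) (T : R) (w : Z) : Prop :=
  exists theta : R -> R,
    (forall t, continuous theta t) /\
    (forall t, fst (x t) = nrm (x t) * cos (theta t) /\
               snd (x t) = nrm (x t) * sin (theta t)) /\
    theta T - theta 0 = 2 * PI * IZR w.

Definition geom_distinct (x y : R -> R * R) : Prop :=
  ~ exists s, forall t, x t = y (t + s).

Definition floorR (r : R) : Z := Int_part r.

(* Main.v *)
(** With the polar angle as independent variable, the unperturbed orbits of angular momentum [L] are
    [r = ell2 / (kap + A cos (w s + gam))], [w = sqrt (L^2 - 2 lam) / L], so that along a solution the
    elements [A], [gam], [w] drift slowly, with speed [O(eps)]; Picard iteration then gives an orbit on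
    a whole number of turns that depends on its initial data in a Lipschitz way, with constants [O(eps)]
    away from the unperturbed ones.  On the energy level, for each angle [th] exactly one orbit starting
    at a pericentre at angle [th] reaches its next pericentre after [k] turns, because [w] is strictly
    monotone in the initial radius.  It closes up if and only if the angular momentum is the same at
    both ends.  The difference of the two is the derivative in [th] of the action
    [int (p dr + L dth)], a [2 PI]-periodic function of [th]: the first variation of the action has no
    other boundary term, since [p = 0] at a pericentre.  The maximum and the minimum of the action give
    the two orbits.  The phase [w s + gam] increases strictly from [0] to [2 PI], so the pericentre is
    met only once: this gives the minimal period and the distinctness of the two orbits. *)

From Stdlib Require Import Reals Lra Lia ZArith.
From Stdlib Require Import IndefiniteDescription.
From Coquelicot Require Import Coquelicot.
Require Import Defs.
Open Scope R_scope.

(** * Real analysis *)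

(** The potential [- lam / r^2] only shifts the centrifugal term: the radial motion is that of a
    Kepler problem with squared angular momentum [L^2 - 2 lam], while the angle advances by
    [2 PI / w] per radial oscillation. With [w = / k] the unperturbed orbit closes after [k] turns,
    and by Kepler's third law its period depends on the energy alone. A noncircular orbit of this
    kind exists on the energy level exactly when [k] exceeds the number inside the integer part; the
    winding numbers of the theorem are the first [N] such integers. By rotation invariance these
    orbits come in circles, so at [eps = 0] the closing condition is degenerate in the initial angle
    and cannot be solved by inversion; this is why a variational argument settles that last unknown.
    Only Lipschitz dependence on the initial data is established. Accordingly monotonicity replaces
    the implicit function theorem, and derivatives in the initial angle are replaced by first-order
    expansions with a quadratic error. Orbits with different [k] are told apart by their angular
    momenta. *)

Ltac abs_lra := repeat match goal with
  | |- context [Rabs ?u] => generalize (Rabs_pos u); generalize (Rabs u); intros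
  end; lra.

Ltac triangle := eapply Rle_trans; [apply Rabs_triang |].

Lemma Rmin_le (x a b : R) : x <= Rmin a b -> x <= a /\ x <= b.
Proof. intro H. split; (eapply Rle_trans; [exact H |]); [apply Rmin_l | apply Rmin_r]. Qed.

Lemma mean_value (f df : R -> R) (a b : R) :
  a <= b -> (forall t, a <= t <= b -> is_derive f t (df t)) ->
  exists c, a <= c <= b /\ f b - f a = df c * (b - a).
Proof.
  intros Hab Hd. assert (K := MVT_gen f a b df). cbv zeta in K.
  rewrite Rmin_left, Rmax_right in K by lra. apply K; intros x Hx.
  - apply Hd; lra.
  - apply continuity_pt_filterlim, (ex_derive_continuous f x). exists (df x); auto.
Qed.

Lemma derive_bound (f df : R -> R) (a b M : R) :
  a <= b -> (forall t, a <= t <= b -> is_derive f t (df t)) ->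
  (forall t, a <= t <= b -> Rabs (df t) <= M) ->
  Rabs (f b - f a) <= M * (b - a).
Proof.
  intros Hab Hd Hb. destruct (mean_value f df a b Hab Hd) as [c [Hc E]].
  rewrite E, Rabs_mult, (Rabs_right (b - a)) by lra.
  apply Rmult_le_compat_r; [lra | auto].
Qed.

Lemma derive_bound_gen (f df : R -> R) (a b M : R) :
  (forall t, Rmin a b <= t <= Rmax a b -> is_derive f t (df t)) ->
  (forall t, Rmin a b <= t <= Rmax a b -> Rabs (df t) <= M) ->
  Rabs (f b - f a) <= M * Rabs (b - a).
Proof.
  intros Hd Hb. destruct (Rle_dec a b) as [H | H].
  - rewrite Rmin_left, Rmax_right in Hd, Hb by lra.
    rewrite (Rabs_right (b - a)) by lra. now apply derive_bound with df.
  - rewrite Rmin_right, Rmax_left in Hd, Hb by lra.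
    rewrite (Rabs_minus_sym (f b)), (Rabs_minus_sym b), (Rabs_right (a - b)) by lra.
    apply derive_bound with df; auto; lra.
Qed.

Lemma derive_pos_lt (f df : R -> R) (a b : R) :
  a < b -> (forall t, a <= t <= b -> is_derive f t (df t)) ->
  (forall t, a <= t <= b -> 0 < df t) -> f a < f b.
Proof.
  intros Hab Hd Hp. destruct (mean_value f df a b (Rlt_le _ _ Hab) Hd) as [c [Hc E]].
  specialize (Hp c Hc). nra.
Qed.

Lemma derive_zero_const (f : R -> R) (a b : R) :
  a <= b -> (forall t, a <= t <= b -> is_derive f t 0) -> f b = f a.
Proof.
  intros Hab Hd.
  assert (H := derive_bound f (fun _ => 0) a b 0 Hab Hd).
  assert (Rabs (f b - f a) <= 0 * (b - a)).
  { apply H. intros; rewrite Rabs_R0; lra. }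
  rewrite Rmult_0_l in H0. generalize (Rabs_pos (f b - f a)); intro.
  destruct (Req_dec (f b - f a) 0) as [E | E]; [lra |].
  apply Rabs_pos_lt in E; lra.
Qed.

(** Serves at the junctions of a periodic extension, where the formula on the left differs from that
    on the right; since [h] has a sign, each difference quotient of [f] is one of [f1] or of
    [f2]. *)
Lemma is_derive_pasted (f f1 f2 : R -> R) (x l d : R) :
  0 < d ->
  (forall t, x - d < t < x -> f t = f1 t) ->
  (forall t, x <= t < x + d -> f t = f2 t) ->
  f1 x = f2 x ->
  is_derive f1 x l -> is_derive f2 x l -> is_derive f x l.
Proof.
  intros Hd H1 H2 E D1 D2.
  apply is_derive_Reals. apply is_derive_Reals in D1. apply is_derive_Reals in D2.
  intros e He.
  destruct (D1 e He) as [d1 K1]. destruct (D2 e He) as [d2 K2].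
  assert (Hm : 0 < Rmin d (Rmin d1 d2)).
  { apply Rmin_pos; [lra | apply Rmin_pos; [apply d1 | apply d2]]. }
  exists (mkposreal _ Hm). intros h Hh Hlt. simpl in Hlt.
  assert (A1 := Rmin_l d (Rmin d1 d2)). assert (A2 := Rmin_r d (Rmin d1 d2)).
  assert (A3 := Rmin_l d1 d2). assert (A4 := Rmin_r d1 d2).
  apply Rabs_def2 in Hlt as Hl.
  rewrite (H2 x) by lra.
  destruct (Rlt_dec h 0) as [N | N].
  - rewrite (H1 (x + h)), <- E by lra. apply K1; [auto | lra].
  - rewrite (H2 (x + h)) by lra. apply K2; [auto | lra].
Qed.

Definition periodized (P : R) (f : R -> R) (s : R) : R :=
  f (s - P * IZR (Int_part (s / P))).

Lemma Int_part_unique (x : R) (n : Z) : IZR n <= x < IZR n + 1 -> Int_part x = n.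
Proof.
  intros [H1 H2]. destruct (base_Int_part x) as [H3 H4].
  assert (Int_part x < n + 1)%Z by (apply lt_IZR; rewrite plus_IZR; lra).
  assert (n < Int_part x + 1)%Z by (apply lt_IZR; rewrite plus_IZR; lra).
  lia.
Qed.

Lemma Int_part_scaled (P s : R) :
  0 < P -> let n := IZR (Int_part (s / P)) in P * n <= s < P * n + P.
Proof.
  intros HP n. unfold n. destruct (base_Int_part (s / P)) as [H1 H2].
  assert (E : s = P * (s / P)) by (field; lra).
  split; [rewrite E at 2; nra |].
  assert (s / P < IZR (Int_part (s / P)) + 1) by lra. rewrite E at 1; nra.
Qed.

Lemma periodized_eq (P : R) (f : R -> R) (s : R) (n : Z) :
  0 < P -> P * IZR n <= s < P * IZR n + P -> periodized P f s = f (s - P * IZR n).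
Proof.
  intros HP H. unfold periodized. rewrite (Int_part_unique (s / P) n); auto.
  split.
  - apply Rmult_le_reg_l with P; auto. replace (P * (s / P)) with s by (field; lra). lra.
  - apply Rmult_lt_reg_l with P; auto. replace (P * (s / P)) with s by (field; lra). lra.
Qed.

Lemma periodized_period (P : R) (f : R -> R) (s : R) :
  0 < P -> periodized P f (s + P) = periodized P f s.
Proof.
  intro HP. assert (H := Int_part_scaled P s HP). simpl in H.
  rewrite (periodized_eq P f (s + P) (Int_part (s / P) + 1)) by (rewrite ?plus_IZR; lra).
  rewrite (periodized_eq P f s (Int_part (s / P))) by lra.
  f_equal. rewrite plus_IZR. ring.
Qed.

Lemma is_derive_shift (f : R -> R) (a s l : R) :
  is_derive f (s + a) l -> is_derive (fun t => f (t + a)) s l.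
Proof.
  intro H. replace l with (scal 1 l) by (unfold scal; simpl; unfold mult; simpl; ring).
  apply (is_derive_comp f (fun t => t + a)); auto.
  auto_derive; auto; ring.
Qed.

(** At a multiple of [P] the extension joins the end of one copy of [f] to the start of the next,
    and the two endpoint conditions are what pasting requires; elsewhere it is locally a translate
    of [f]. *)
Lemma is_derive_periodized (P : R) (f df : R -> R) (s : R) :
  0 < P -> (forall t, 0 <= t <= P -> is_derive f t (df t)) ->
  f P = f 0 -> df P = df 0 ->
  is_derive (periodized P f) s (periodized P df s).
Proof.
  intros HP Hd E E'.
  assert (H := Int_part_scaled P s HP). simpl in H.
  set (n := Int_part (s / P)) in *.
  rewrite (periodized_eq P df s n) by lra.
  destruct (Req_dec s (P * IZR n)) as [Es | Es].
  - apply is_derive_pasted with (fun t => f (t - P * IZR (n - 1))) (fun t => f (t - P * IZR n)) P; auto.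
    + intros t Ht. apply periodized_eq; auto. rewrite minus_IZR. lra.
    + intros t Ht. apply periodized_eq; auto. lra.
    + rewrite Es, minus_IZR.
      replace (P * IZR n - P * (IZR n - 1)) with P by ring.
      replace (P * IZR n - P * IZR n) with 0 by ring. auto.
    + replace (s - P * IZR n) with 0 by lra. rewrite <- E'.
      apply (is_derive_shift f (- (P * IZR (n - 1)))).
      rewrite minus_IZR. replace (s + - (P * (IZR n - 1))) with P by lra.
      apply Hd; lra.
    + apply (is_derive_shift f (- (P * IZR n))). apply Hd. lra.
  - apply is_derive_ext_loc with (fun t => f (t - P * IZR n)).
    + assert (0 < Rmin (s - P * IZR n) (P * IZR n + P - s)) as Hm by (apply Rmin_pos; lra).
      exists (mkposreal _ Hm). intros t Ht.
      change (Rabs (t - s) < Rmin (s - P * IZR n) (P * IZR n + P - s)) in Ht.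
      apply Rabs_def2 in Ht. destruct Ht as [Ht1 Ht2].
      assert (A1 := Rmin_l (s - P * IZR n) (P * IZR n + P - s)).
      assert (A2 := Rmin_r (s - P * IZR n) (P * IZR n + P - s)).
      symmetry. apply periodized_eq; auto. lra.
    + apply (is_derive_shift f (- (P * IZR n))). apply Hd. lra.
Qed.

(** The bound [c <= tau] gives [c * (b - a) <= t b - t a]: hence injectivity, surjectivity, and a
    Lipschitz inverse, which makes the increment of [sg] small with [h]. Later [t] will be time as a
    function of the angle. *)
Lemma inverse_of_expanding (t tau : R -> R) (c : R) :
  0 < c -> (forall s, is_derive t s (tau s)) -> (forall s, c <= tau s) ->
  exists sg : R -> R,
    (forall s, sg (t s) = s) /\ (forall u, t (sg u) = u) /\
    (forall u, is_derive sg u (/ tau (sg u))).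
Proof.
  intros Hc Hd Hl.
  assert (Hexp : forall a b, a <= b -> c * (b - a) <= t b - t a).
  { intros a b Hab.
    destruct (mean_value t tau a b Hab (fun s _ => Hd s)) as [x [_ E]].
    rewrite E. apply Rmult_le_compat_r; [lra | auto]. }
  assert (Hsur : forall u, exists s, t s = u).
  (* By expansion, [t] passes the value [u] between [- b] and [b]. *)
  { intro u. set (b := Rabs (u - t 0) / c).
    assert (Hb : 0 <= b) by (apply Rdiv_le_0_compat; [apply Rabs_pos | auto]).
    assert (Ecb : c * b = Rabs (u - t 0)) by (unfold b; field; lra).
    destruct (IVT_gen t (- b) b u) as [x [_ Hx]].
    - intro x. apply continuity_pt_filterlim, (ex_derive_continuous t x). eexists; apply Hd.
    - assert (K1 := Hexp (- b) 0). assert (K2 := Hexp 0 b).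
      assert (u - t 0 <= Rabs (u - t 0)) by apply Rle_abs.
      assert (- (u - t 0) <= Rabs (u - t 0)) by (rewrite <- Rabs_Ropp; apply Rle_abs).
      rewrite Rmin_left, Rmax_right by lra. lra.
    - exists x; auto. }
  destruct (functional_choice (fun u s => t s = u) Hsur) as [sg Hsg].
  assert (Hinj : forall a b, t a = t b -> a = b).
  { intros a b E. destruct (Rle_dec a b) as [L | L].
    - assert (K := Hexp a b L). nra.
    - assert (K := Hexp b a). nra. }
  assert (Hleft : forall s, sg (t s) = s) by (intro; apply Hinj; apply Hsg).
  exists sg. split; [auto | split; [auto |]].
  intro u. set (s0 := sg u). assert (Hs0 : t s0 = u) by apply Hsg.
  assert (HLip : forall v, c * Rabs (sg v - s0) <= Rabs (v - u)).
  { intro v. rewrite <- (Hsg v) at 2. rewrite <- Hs0.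
    destruct (Rle_dec s0 (sg v)) as [L | L].
    - assert (K := Hexp _ _ L). rewrite (Rabs_right (sg v - s0)) by lra.
      eapply Rle_trans; [apply K | apply Rle_abs].
    - assert (K := Hexp (sg v) s0). rewrite (Rabs_left (sg v - s0)) by lra.
      rewrite Rabs_minus_sym. eapply Rle_trans; [| apply Rle_abs]. lra. }
  assert (Ht0 : 0 < tau s0) by (specialize (Hl s0); lra).
  apply is_derive_Reals. intros e He.
  assert (D := Hd s0). apply is_derive_Reals in D.
  set (e' := e * c * tau s0).
  assert (He' : 0 < e') by (unfold e'; apply Rmult_lt_0_compat; auto; apply Rmult_lt_0_compat; auto).
  destruct (D e' He') as [d Kd].
  assert (Hm : 0 < c * d) by (apply Rmult_lt_0_compat; [auto | apply d]).
  exists (mkposreal _ Hm). intros h Hh Hlt. simpl in Hlt.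
  assert (HL := HLip (u + h)). replace (u + h - u) with h in HL by ring.
  set (k := sg (u + h) - s0) in *.
  assert (Ek : sg (u + h) = s0 + k) by (unfold k; ring).
  assert (Etk : t (s0 + k) = u + h) by (rewrite <- Ek; apply Hsg).
  assert (Hk0 : k <> 0).
  { intro Z. rewrite Z, Rplus_0_r in Etk. lra. }
  assert (Hkd : Rabs k < d) by nra.
  specialize (Kd k Hk0 Hkd). rewrite Etk, Hs0 in Kd.
  replace (u + h - u) with h in Kd by ring.
  fold s0. fold k.
  (* The quotient of the inverse is compared with the quotient [h / k] of [t] at [s0]; the factor
     [k / h] is at most [/ c] in absolute value, which dictated the choice of [e']. *)
  replace (k / h - / tau s0) with (- (k / h) * (/ tau s0) * (h / k - tau s0)).
  2: { field. repeat split; auto; lra. }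
  rewrite !Rabs_mult, Rabs_Ropp.
  assert (Hkh : Rabs (k / h) <= / c).
  { unfold Rdiv. rewrite Rabs_mult, Rabs_inv. assert (0 < Rabs h) by (apply Rabs_pos_lt; auto).
    apply Rmult_le_reg_l with (c * Rabs h); [nra |]. field_simplify; lra. }
  rewrite (Rabs_right (/ tau s0)) by (apply Rle_ge, Rlt_le, Rinv_0_lt_compat; auto).
  assert (0 < / tau s0) by (apply Rinv_0_lt_compat; auto).
  assert (0 < / c) by (apply Rinv_0_lt_compat; auto).
  assert (Ee : e = / c * / tau s0 * e') by (unfold e'; field; split; lra).
  rewrite Ee.
  apply Rle_lt_trans with (/ c * / tau s0 * Rabs (h / k - tau s0)).
  - apply Rmult_le_compat_r; [apply Rabs_pos |]. apply Rmult_le_compat_r; lra.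
  - apply Rmult_lt_compat_l; [| auto]. apply Rmult_lt_0_compat; auto.
Qed.

Lemma Ck_le (U : R -> R -> R) : Ck 2 U -> Ck 1 U.
Proof. intros [H0 [H1 [H2 H3]]]. split; auto. split; auto. split; split; try apply H2; try apply H3; auto. Qed.

Lemma is_derive_comp_2d (f : R -> R -> R) (x y : R -> R) (s dx dy : R) :
  (forall a b, ex_derive (fun t => f t b) a /\ ex_derive (fun t => f a t) b) ->
  (forall p : R * R, continuous (fun q : R * R => d1 f (fst q) (snd q)) p) ->
  is_derive x s dx -> is_derive y s dy ->
  is_derive (fun t => f (x t) (y t)) s (d1 f (x s) (y s) * dx + d2 f (x s) (y s) * dy).
Proof.
  intros Hex Hc Hx Hy.
  assert (F : filterdiff (fun u : R * R => f (fst u) (snd u)) (locally (x s, y s))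
     (fun u : R * R => plus (scal (fst u) (d1 f (x s) (y s))) (scal (snd u) (d2 f (x s) (y s))))).
  { apply is_derive_filterdiff.
    - apply filter_forall. intros [a b]. simpl. apply Derive_correct. exact (proj1 (Hex a b)).
    - apply Derive_correct. exact (proj2 (Hex (x s) (y s))).
    - apply Hc. }
  assert (K := filterdiff_comp'_2 x y f s _ _ (fun a b : R => plus (scal a (d1 f (x s) (y s))) (scal b (d2 f (x s) (y s)))) Hx Hy F).
  unfold is_derive. eapply filterdiff_ext_lin; [apply K |].
  intro u. simpl. unfold scal, plus; simpl. unfold mult, plus; simpl. ring.
Qed.

(** By compactness there is one [d] such that [f] changes by less than 2 whenever each coordinate
    moves by less than [d]. The segment from the origin to [(x, y)] is cut into [S n] such steps,
    with [n] fixed by [B / d]. *)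
Lemma bounded_on_square (f : R -> R -> R) (B : R) :
  (forall p : R * R, continuous (fun q : R * R => f (fst q) (snd q)) p) ->
  exists M, 0 <= M /\ forall x y, Rabs x <= B -> Rabs y <= B -> Rabs (f x y) <= M.
Proof.
  intro Hc.
  assert (Hloc : forall x y, exists d : posreal, forall u v,
    Rabs (u - x) < d -> Rabs (v - y) < d -> Rabs (f u v - f x y) < 1).
  { intros x y. specialize (Hc (x, y)). simpl in Hc.
    assert (K := proj1 (filterlim_locally _ _) Hc (mkposreal 1 Rlt_0_1)).
    destruct K as [d Kd]. exists d. intros u v Hu Hv.
    apply (Kd (u, v)). split; simpl; assumption. }
  (* Half the radius of continuity, so that a point within [delta] of the centre and the neighbours
     of that point all stay in the full neighbourhood. *)
  set (delta := fun x y => pos_div_2 (proj1_sig (constructive_indefinite_description _ (Hloc x y)))).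
  assert (Hdelta : forall x y u v, Rabs (u - x) < 2 * delta x y -> Rabs (v - y) < 2 * delta x y ->
     Rabs (f u v - f x y) < 1).
  { intros x y u v. unfold delta. simpl.
    destruct (constructive_indefinite_description _ (Hloc x y)) as [d Kd]; simpl.
    intros H1 H2. apply Kd; lra. }
  destruct (compactness_value_2d (-B) B (-B) B delta) as [d Hd].
  assert (Hun : forall x y u v, Rabs x <= B -> Rabs y <= B ->
     Rabs (u - x) < d -> Rabs (v - y) < d -> Rabs (f u v) <= Rabs (f x y) + 2).
  (* [compactness_value_2d] provides the centre only under a double negation, so the inequality is
     proved by contradiction. *)
  { intros x y u v Hx Hy Hu Hv. apply Rnot_lt_le. intro Hlt.
    apply Rabs_le_between in Hx. apply Rabs_le_between in Hy.
    apply (Hd x y Hx Hy). intros [a [b [_ [_ [Ha [Hb Hab]]]]]].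
    assert (P0 := cond_pos (delta a b)).
    assert (K1 : Rabs (f x y - f a b) < 1) by (apply Hdelta; lra).
    assert (K2 : Rabs (f u v - f a b) < 1).
    { apply Hdelta.
      - replace (u - a) with ((u - x) + (x - a)) by ring.
        eapply Rle_lt_trans; [apply Rabs_triang | lra].
      - replace (v - b) with ((v - y) + (y - b)) by ring.
        eapply Rle_lt_trans; [apply Rabs_triang | lra]. }
    apply Rabs_def2 in K1. apply Rabs_def2 in K2.
    revert Hlt. unfold Rabs; repeat destruct Rcase_abs; lra. }
  destruct (nfloor_ex (Rmax 0 (B / d))) as [n Hn]; [apply Rmax_l |].
  assert (Hn1 : B < (INR n + 1) * d).
  { assert (K := Rmax_r 0 (B / d)).
    assert (B / d < INR n + 1) by lra.
    assert (P0 := cond_pos d).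
    apply Rmult_lt_reg_r with (/ d); [apply Rinv_0_lt_compat; auto |].
    replace ((INR n + 1) * d * / d) with (INR n + 1) by (field; lra). auto. }
  exists (Rabs (f 0 0) + 2 * INR (S n)).
  assert (Pn := pos_INR n).
  split. { rewrite S_INR. generalize (Rabs_pos (f 0 0)); lra. }
  intros x y Hx Hy.
  assert (Hch : forall j, (j <= S n)%nat ->
    Rabs (f (INR j * (x / INR (S n))) (INR j * (y / INR (S n)))) <= Rabs (f 0 0) + 2 * INR j).
  { induction j as [|j IH]; intro Hj.
    - simpl. rewrite !Rmult_0_l. lra.
    - rewrite (S_INR j).
      assert (Hjn : INR j <= INR (S n)) by (apply le_INR; lia).
      assert (Pj := pos_INR j).
      assert (PS : 0 < INR (S n)) by (rewrite S_INR; lra).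
      assert (Hfrac : forall z, Rabs z <= B -> Rabs (INR j * (z / INR (S n))) <= B).
      { intros z Hz. replace (INR j * (z / INR (S n))) with (INR j / INR (S n) * z) by (field; lra).
        rewrite Rabs_mult. rewrite Rabs_right.
        2: { apply Rle_ge, Rdiv_le_0_compat; lra. }
        assert (INR j / INR (S n) <= 1).
        { apply Rmult_le_reg_r with (INR (S n)); auto. field_simplify; lra. }
        generalize (Rabs_pos z); nra. }
      assert (Hstep : forall z, Rabs z <= B ->
         Rabs ((INR j + 1) * (z / INR (S n)) - INR j * (z / INR (S n))) < d).
      { intros z Hz. replace ((INR j + 1) * (z / INR (S n)) - INR j * (z / INR (S n)))
          with (z / INR (S n)) by ring.
        unfold Rdiv. rewrite Rabs_mult, Rabs_inv, (Rabs_right (INR (S n))) by lra.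
        apply Rmult_lt_reg_r with (INR (S n)); auto.
        rewrite Rmult_assoc, Rinv_l, Rmult_1_r by lra. rewrite S_INR. lra. }
      eapply Rle_trans; [apply (Hun _ _ _ _ (Hfrac x Hx) (Hfrac y Hy) (Hstep x Hx) (Hstep y Hy)) |].
      assert (K := IH ltac:(lia)). lra. }
  specialize (Hch (S n) (le_n _)).
  assert (PS : 0 < INR (S n)) by (rewrite S_INR; lra).
  replace (INR (S n) * (x / INR (S n))) with x in Hch by (field; lra).
  replace (INR (S n) * (y / INR (S n))) with y in Hch by (field; lra).
  auto.
Qed.

Lemma lipschitz_on_square (f : R -> R -> R) (B : R) :
  Ck 1 f ->
  exists M, 0 <= M /\ forall x y x' y',
    Rabs x <= B -> Rabs y <= B -> Rabs x' <= B -> Rabs y' <= B ->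
    Rabs (f x y - f x' y') <= M * (Rabs (x - x') + Rabs (y - y')).
Proof.
  intros [_ [Hex [[H1 _] [H2 _]]]].
  destruct (bounded_on_square _ B H1) as [M1 [P1 K1]].
  destruct (bounded_on_square _ B H2) as [M2 [P2 K2]].
  exists (M1 + M2). split; [lra |]. intros x y x' y' Hx Hy Hx' Hy'.
  assert (Hb : forall a b t, Rabs a <= B -> Rabs b <= B -> Rmin a b <= t <= Rmax a b -> Rabs t <= B).
  { intros a b t Ha Hb [T1 T2]. apply Rabs_le_between in Ha. apply Rabs_le_between in Hb.
    apply Rabs_le_between. revert T1 T2. unfold Rmin, Rmax. destruct Rle_dec; lra. }
  assert (L1 : Rabs (f x y - f x' y) <= M1 * Rabs (x - x')).
  { apply (derive_bound_gen (fun t => f t y) (fun t => d1 f t y)).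
    - intros t _. apply Derive_correct. exact (proj1 (Hex t y)).
    - intros t Ht. apply K1; auto. apply Hb with x' x; auto. }
  assert (L2 : Rabs (f x' y - f x' y') <= M2 * Rabs (y - y')).
  { apply (derive_bound_gen (fun t => f x' t) (fun t => d2 f x' t)).
    - intros t _. apply Derive_correct. exact (proj2 (Hex x' t)).
    - intros t Ht. apply K2; auto. apply Hb with y' y; auto. }
  replace (f x y - f x' y') with ((f x y - f x' y) + (f x' y - f x' y')) by ring.
  triangle.
  generalize (Rabs_pos (x - x')) (Rabs_pos (y - y')); nra.
Qed.

(** * Bounded Lipschitz functions and slowly varying differential equations *)

Section BoundedLipschitz.

Variable X : Type.
Variable d : X -> X -> R.
Hypothesis d_ge_0 : forall x y, 0 <= d x y.

Definition Lips (f : X -> R) : Prop :=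
  exists M, 0 <= M /\ forall x y, Rabs (f x - f y) <= M * d x y.

(** Boundedness makes the class stable under products and, given positive lower bounds, under
    quotients and square roots. Membership is then checked along the syntax of a formula, and it
    yields constants valid for all orbits and all [eps] at once. *)
Definition BL (f : X -> R) : Prop :=
  Lips f /\ exists M, 0 <= M /\ forall x, Rabs (f x) <= M.

Lemma BL_Lips f : BL f -> Lips f.
Proof. now intros [H _]. Qed.

Lemma Lips_plus f g : Lips f -> Lips g -> Lips (fun x => f x + g x).
Proof.
  intros [M [PM H]] [N [PN K]]. exists (M + N). split; [lra |]. intros x y.
  replace (f x + g x - (f y + g y)) with ((f x - f y) + (g x - g y)) by ring.
  triangle. specialize (H x y). specialize (K x y). lra.
Qed.

Lemma Lips_comp (h : R -> R) (K : R) f :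
  0 <= K -> (forall a b, Rabs (h a - h b) <= K * Rabs (a - b)) -> Lips f -> Lips (fun x => h (f x)).
Proof.
  intros PK HK [M [PM H]]. exists (K * M). split; [nra |]. intros x y.
  eapply Rle_trans; [apply HK |]. rewrite Rmult_assoc. apply Rmult_le_compat_l; auto.
Qed.

Lemma BL_const c : BL (fun _ => c).
Proof.
  split.
  - exists 0. split; [lra |]. intros. rewrite Rminus_diag, Rabs_R0. lra.
  - exists (Rabs c). split; [apply Rabs_pos | intros; lra].
Qed.

Lemma BL_plus f g : BL f -> BL g -> BL (fun x => f x + g x).
Proof.
  intros [Hf [M [PM H]]] [Hg [N [PN K]]]. split; [now apply Lips_plus |].
  exists (M + N). split; [lra |]. intro x.
  triangle. specialize (H x). specialize (K x). lra.
Qed.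

Lemma BL_opp f : BL f -> BL (fun x => - f x).
Proof.
  intros [[M [PM H]] [N [PN K]]]. split.
  - exists M. split; auto. intros x y.
    replace (- f x - - f y) with (- (f x - f y)) by ring. now rewrite Rabs_Ropp.
  - exists N. split; auto. intro x. now rewrite Rabs_Ropp.
Qed.

Lemma BL_minus f g : BL f -> BL g -> BL (fun x => f x - g x).
Proof. intros Hf Hg. apply (BL_plus f (fun x => - g x)); auto. now apply BL_opp. Qed.

Lemma BL_mult f g : BL f -> BL g -> BL (fun x => f x * g x).
Proof.
  intros [[M [PM H]] [M' [PM' H']]] [[N [PN K]] [N' [PN' K']]]. split.
  - exists (M' * N + N' * M). split; [nra |]. intros x y.
    replace (f x * g x - f y * g y) with (f x * (g x - g y) + g y * (f x - f y)) by ring.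
    triangle. rewrite !Rabs_mult.
    specialize (H x y). specialize (K x y). specialize (H' x). specialize (K' y).
    assert (A := Rabs_pos (f x)). assert (B := Rabs_pos (g y)).
    assert (A' := Rabs_pos (f x - f y)). assert (B' := Rabs_pos (g x - g y)).
    specialize (d_ge_0 x y).
    rewrite Rmult_plus_distr_r, !Rmult_assoc.
    apply Rplus_le_compat; apply Rmult_le_compat; auto.
  - exists (M' * N'). split; [nra |]. intro x. rewrite Rabs_mult.
    apply Rmult_le_compat; auto; apply Rabs_pos.
Qed.

Lemma BL_pow f n : BL f -> BL (fun x => f x ^ n).
Proof.
  intro Hf. induction n as [| n IH]; simpl; [apply BL_const |].
  apply (BL_mult f (fun x => f x ^ n)); auto.
Qed.

Lemma BL_inv (c : R) f : 0 < c -> (forall x, c <= f x) -> BL f -> BL (fun x => / f x).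
Proof.
  intros Hc Hl [[M [PM H]] _]. split.
  - exists (M * / c * / c). assert (0 < / c) by (now apply Rinv_0_lt_compat).
    split; [apply Rmult_le_pos; [apply Rmult_le_pos |]; lra |]. intros x y.
    assert (Hx := Hl x). assert (Hy := Hl y).
    replace (/ f x - / f y) with (- (f x - f y) * (/ f x * / f y)) by (field; lra).
    rewrite !Rabs_mult, Rabs_Ropp.
    rewrite (Rabs_right (/ f x)) by (apply Rle_ge, Rlt_le, Rinv_0_lt_compat; lra).
    rewrite (Rabs_right (/ f y)) by (apply Rle_ge, Rlt_le, Rinv_0_lt_compat; lra).
    assert (0 < / f x) by (apply Rinv_0_lt_compat; lra).
    assert (0 < / f y) by (apply Rinv_0_lt_compat; lra).
    assert (/ f x <= / c) by (apply Rinv_le_contravar; lra).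
    assert (/ f y <= / c) by (apply Rinv_le_contravar; lra).
    replace (M * / c * / c * d x y) with ((M * d x y) * (/ c * / c)) by ring.
    apply Rmult_le_compat; auto; [apply Rabs_pos | nra | apply Rmult_le_compat; lra].
  - exists (/ c). split; [left; now apply Rinv_0_lt_compat |].
    intro x. specialize (Hl x). rewrite Rabs_right.
    + apply Rinv_le_contravar; lra.
    + apply Rle_ge, Rlt_le, Rinv_0_lt_compat; lra.
Qed.

Lemma BL_div (c : R) f g :
  0 < c -> (forall x, c <= g x) -> BL f -> BL g -> BL (fun x => f x / g x).
Proof.
  intros. apply (BL_mult f (fun x => / g x)); auto. now apply BL_inv with c.
Qed.

Lemma BL_sqrt (c : R) f : 0 < c -> (forall x, c <= f x) -> BL f -> BL (fun x => sqrt (f x)).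
Proof.
  intros Hc Hl [[M [PM H]] [N [PN K]]].
  assert (Hs : 0 < sqrt c) by (now apply sqrt_lt_R0).
  split.
  - exists (M * / sqrt c). assert (0 < / sqrt c) by (now apply Rinv_0_lt_compat).
    split; [nra |]. intros x y.
    assert (Hx := Hl x). assert (Hy := Hl y).
    assert (sqrt c <= sqrt (f x)) by (apply sqrt_le_1; lra).
    assert (sqrt c <= sqrt (f y)) by (apply sqrt_le_1; lra).
    assert (E : f x - f y = (sqrt (f x) - sqrt (f y)) * (sqrt (f x) + sqrt (f y))).
    { rewrite <- (sqrt_sqrt (f x)) at 1 by lra. rewrite <- (sqrt_sqrt (f y)) at 1 by lra. ring. }
    specialize (H x y). rewrite E, Rabs_mult, (Rabs_right (sqrt (f x) + sqrt (f y))) in H by lra.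
    apply Rmult_le_reg_r with (sqrt c); auto.
    replace (M * / sqrt c * d x y * sqrt c) with (M * d x y) by (field; lra).
    eapply Rle_trans; [| apply H]. apply Rmult_le_compat_l; [apply Rabs_pos | lra].
  - exists (sqrt N). split; [apply sqrt_pos |]. intro x.
    rewrite Rabs_right by (apply Rle_ge, sqrt_pos).
    apply sqrt_le_1_alt. eapply Rle_trans; [apply Rle_abs | apply K].
Qed.

Lemma trig_lipschitz (a b : R) :
  Rabs (cos a - cos b) <= 1 * Rabs (a - b) /\ Rabs (sin a - sin b) <= 1 * Rabs (a - b).
Proof.
  split.
  - apply (derive_bound_gen cos (fun t => - sin t)).
    + intros t _. auto_derive; auto; ring.
    + intros t _. rewrite Rabs_Ropp. apply Rabs_le. apply SIN_bound.
  - apply (derive_bound_gen sin cos).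
    + intros t _. auto_derive; auto; ring.
    + intros t _. apply Rabs_le. apply COS_bound.
Qed.

Lemma BL_cos f : Lips f -> BL (fun x => cos (f x)).
Proof.
  intro H. split.
  - apply (Lips_comp cos 1); auto; [lra |]. intros; apply trig_lipschitz.
  - exists 1. split; [lra |]. intro x. apply Rabs_le, COS_bound.
Qed.

Lemma BL_sin f : Lips f -> BL (fun x => sin (f x)).
Proof.
  intro H. split.
  - apply (Lips_comp sin 1); auto; [lra |]. intros; apply trig_lipschitz.
  - exists 1. split; [lra |]. intro x. apply Rabs_le, SIN_bound.
Qed.

Lemma BL_comp2 (h : R -> R -> R) f g :
  Ck 1 h -> BL f -> BL g -> BL (fun x => h (f x) (g x)).
Proof.
  intros Hh [[M [PM H]] [M' [PM' H']]] [[N [PN K]] [N' [PN' K']]].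
  set (B := M' + N').
  assert (BM : M' <= B) by (unfold B; lra). assert (BN : N' <= B) by (unfold B; lra).
  destruct (lipschitz_on_square h B Hh) as [C [PC HC]].
  destruct (bounded_on_square h B (proj1 Hh)) as [C' [PC' HC']].
  split.
  - exists (C * (M + N)). split; [nra |]. intros x y.
    specialize (H x y). specialize (K x y).
    assert (A1 := H' x). assert (A2 := H' y). assert (A3 := K' x). assert (A4 := K' y).
    eapply Rle_trans; [apply HC; lra |].
    rewrite Rmult_assoc. apply Rmult_le_compat_l; lra.
  - exists C'. split; auto. intro x. assert (A1 := H' x). assert (A3 := K' x). apply HC'; lra.
Qed.

End BoundedLipschitz.

Definition clamp (a b x : R) : R := Rmax a (Rmin b x).

Lemma clamp_bounds a b x : a <= b -> a <= clamp a b x <= b.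
Proof. intro. unfold clamp, Rmax, Rmin. repeat destruct Rle_dec; lra. Qed.

Lemma clamp_id a b x : a <= x <= b -> clamp a b x = x.
Proof. intro. unfold clamp, Rmax, Rmin. repeat destruct Rle_dec; lra. Qed.

Lemma clamp_lipschitz a b x y : Rabs (clamp a b x - clamp a b y) <= 1 * Rabs (x - y).
Proof.
  unfold clamp, Rmax, Rmin. repeat destruct Rle_dec; unfold Rabs; repeat destruct Rcase_abs; lra.
Qed.

Lemma BL_clamp X (d : X -> X -> R) a b f :
  a <= b -> Lips X d f -> BL X d (fun x => clamp a b (f x)).
Proof.
  intros Hab H. split.
  - apply (Lips_comp X d (clamp a b) 1); auto; [lra | intros; apply clamp_lipschitz].
  - exists (Rmax (Rabs a) (Rabs b)). split; [apply Rle_trans with (Rabs a); [apply Rabs_pos | apply Rmax_l] |].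
    intro x. assert (K := clamp_bounds a b (f x) Hab).
    unfold Rmax, Rabs in *. repeat destruct Rle_dec; repeat destruct Rcase_abs; lra.
Qed.

(** Vectors are functions on [nat] so that one statement covers all components; the drift reads only
    the entries 0, 1 and 2, and these three are the source of the factors 3 below. *)
Definition dist3 (v v' : nat -> R) : R :=
  Rabs (v 0%nat - v' 0%nat) + Rabs (v 1%nat - v' 1%nat) + Rabs (v 2%nat - v' 2%nat).

Lemma dist3_pos v v' : 0 <= dist3 v v'.
Proof. unfold dist3. abs_lra. Qed.

Lemma dist3_le v v' e : (forall i, Rabs (v i - v' i) <= e) -> dist3 v v' <= 3 * e.
Proof. intro H. unfold dist3. assert (A := H 0%nat). assert (B := H 1%nat). assert (C := H 2%nat). lra. Qed.

Lemma lipschitz_continuous (f : R -> R) (K : R) :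
  (forall a b, Rabs (f a - f b) <= K * Rabs (a - b)) -> forall x, continuous f x.
Proof.
  intros H x. apply filterlim_locally. intro e.
  assert (Hm : 0 < e / (Rabs K + 1)).
  { apply Rdiv_lt_0_compat; [apply e | generalize (Rabs_pos K); lra]. }
  exists (mkposreal _ Hm). intros y Hy. change (Rabs (y - x) < e / (Rabs K + 1)) in Hy.
  change (Rabs (f y - f x) < e). eapply Rle_lt_trans; [apply H |].
  assert (0 < Rabs K + 1) by (generalize (Rabs_pos K); lra).
  apply Rlt_div_r in Hy; [| lra].
  assert (K <= Rabs K) by apply Rle_abs. generalize (Rabs_pos (y - x)); nra.
Qed.

Lemma is_derive_primitive (f : R -> R) (s : R) :
  (forall x, continuous f x) -> is_derive (fun t => RInt f 0 t) s (f s).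
Proof.
  intro H. apply (is_derive_RInt f (fun t => RInt f 0 t) 0 s); [| apply H].
  apply filter_forall. intro x. apply (RInt_correct f 0 x).
  apply (ex_RInt_continuous f). intros z _. apply H.
Qed.

(** [real (Lim_seq u)] is a total expression, so that the limit of the Picard iterates can be
    written down pointwise before its convergence is known. *)
Lemma geometric_limit (u : nat -> R) :
  (forall n, Rabs (u (S n) - u n) <= (1 / 2) ^ n) ->
  forall n, Rabs (u n - real (Lim_seq u)) <= 2 * (1 / 2) ^ n.
Proof.
  intros H.
  assert (Hpos : forall n, 0 < (1/2)^n) by (intro; apply pow_lt; lra).
  assert (Hd : forall n k, Rabs (u (n + k)%nat - u n) <= 2 * (1 / 2) ^ n - 2 * (1/2) ^ (n + k)).
  { intros n k. induction k as [| k IH].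
    - rewrite Nat.add_0_r, Rminus_diag, Rabs_R0. lra.
    - rewrite Nat.add_succ_r. replace (u (S (n + k)) - u n) with
        ((u (S (n + k)) - u (n + k)%nat) + (u (n + k)%nat - u n)) by ring.
      triangle. specialize (H (n + k)%nat). simpl. lra. }
  assert (Hd2 : forall n p, (n <= p)%nat -> Rabs (u p - u n) <= 2 * (1 / 2) ^ n).
  { intros n p Hp. replace p with (n + (p - n))%nat by lia.
    eapply Rle_trans; [apply Hd |]. specialize (Hpos (n + (p - n))%nat). lra. }
  assert (Hex : ex_finite_lim_seq u).
  { apply ex_lim_seq_cauchy_corr. intro e.
    assert (He : 0 < e / 4) by (generalize (cond_pos e); lra).
    destruct (pow_lt_1_zero (1/2)) with (y := e / 4) as [N HN]; auto.
    { rewrite Rabs_right; lra. }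
    exists N. intros n p Hn Hp.
    specialize (HN N (le_n _)). rewrite Rabs_right in HN by (specialize (Hpos N); lra).
    assert (A := Hd2 N n Hn). assert (B := Hd2 N p Hp).
    replace (u n - u p) with ((u n - u N) - (u p - u N)) by ring.
    eapply Rle_lt_trans; [apply Rabs_triang |]. rewrite Rabs_Ropp. lra. }
  destruct Hex as [l Hl]. intro n. rewrite (is_lim_seq_unique _ _ Hl). simpl.
  assert (Hle : Rbar_le (Rabs (l - u n)) (2 * (1/2)^n)).
  { apply (is_lim_seq_le_loc (fun p => Rabs (u p - u n)) (fun _ => 2 * (1/2)^n)).
    - exists n. intros p Hp. now apply Hd2.
    - apply (is_lim_seq_abs (fun p => u p - u n) (l - u n)).
      apply (is_lim_seq_minus' u (fun _ => u n)); auto. apply is_lim_seq_const.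
    - apply is_lim_seq_const. }
  simpl in Hle. now rewrite Rabs_minus_sym.
Qed.

(** With [C = 0] it also turns [Rabs x <= 0] into [x = 0]. *)
Lemma eq_0_of_geometric_bound (x C : R) : (forall n, Rabs x <= C * (1 / 2) ^ n) -> x = 0.
Proof.
  intro H. destruct (Req_dec x 0) as [E | E]; auto. exfalso.
  assert (Px := Rabs_pos_lt x E).
  assert (PC : 0 < C) by (specialize (H 0%nat); simpl in H; lra).
  destruct (pow_lt_1_zero (1/2)) with (y := Rabs x / C) as [N HN].
  { rewrite Rabs_right; lra. }
  { now apply Rdiv_lt_0_compat. }
  specialize (HN N (le_n _)). specialize (H N).
  rewrite Rabs_right in HN by (assert (0 < (1/2)^N) by (apply pow_lt; lra); lra).
  apply Rmult_lt_compat_l with (r := C) in HN; auto.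
  replace (C * (Rabs x / C)) with (Rabs x) in HN by (field; lra). lra.
Qed.

(** * Picard iteration for an equation whose right-hand side has size [eps] *)

Section SlowEquation.

Variable G : nat -> R -> (nat -> R) -> R.
Variables M P eps : R.
Hypothesis P_ge_0 : 0 <= P.
Hypothesis M_ge_0 : 0 <= M.
Hypothesis G_bounded : forall i s v, Rabs (G i s v) <= M.
Hypothesis G_lipschitz : forall i s s' v v',
  Rabs (G i s v - G i s' v') <= M * (Rabs (s - s') + dist3 v v').
Hypothesis eps_small : Rabs eps * M * P <= 1 / 6.

Variable v0 : nat -> R.

Definition picard_step (y : R -> nat -> R) (s : R) (i : nat) : R :=
  v0 i + eps * RInt (fun t => G i t (y t)) 0 s.

Definition slow_curve (y : R -> nat -> R) : Prop :=
  exists K, forall i a b, Rabs (y a i - y b i) <= K * Rabs (a - b).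

Lemma continuous_along y i s : slow_curve y -> continuous (fun t => G i t (y t)) s.
Proof.
  intros [K HK]. apply lipschitz_continuous with (M * (1 + 3 * K)). intros a b.
  eapply Rle_trans; [apply G_lipschitz |]. rewrite Rmult_assoc.
  apply Rmult_le_compat_l; auto.
  assert (D := dist3_le (y a) (y b) (K * Rabs (a - b)) (fun i => HK i a b)). lra.
Qed.

Lemma picard_derive y i s :
  slow_curve y -> is_derive (fun t => picard_step y t i) s (eps * G i s (y s)).
Proof.
  intro H. unfold picard_step.
  assert (D := is_derive_primitive (fun t => G i t (y t)) s (fun x => continuous_along y i x H)).
  replace (eps * G i s (y s)) with (plus 0 (scal eps (G i s (y s)))).
  2: { unfold plus, scal; simpl; unfold mult; simpl; ring. }
  apply (is_derive_plus (fun _ => v0 i) (fun t => eps * RInt (fun u => G i u (y u)) 0 t)).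
  - apply (@is_derive_const R_AbsRing R_NormedModule).
  - now apply (is_derive_scal (fun t => RInt (fun u => G i u (y u)) 0 t)).
Qed.

Lemma picard_0 y i : picard_step y 0 i = v0 i.
Proof.
  unfold picard_step. rewrite (RInt_point 0 (fun t => G i t (y t))).
  change (v0 i + eps * 0 = v0 i). ring.
Qed.

Lemma picard_slow y : slow_curve y -> slow_curve (picard_step y).
Proof.
  intro H. exists (Rabs eps * M). intros i a b.
  apply (derive_bound_gen (fun t => picard_step y t i) (fun t => eps * G i t (y t))).
  - intros t _. now apply picard_derive.
  - intros t _. rewrite Rabs_mult. apply Rmult_le_compat_l; [apply Rabs_pos | apply G_bounded].
Qed.

(** A gap [e] in each component is a [dist3] of at most [3 * e], hence a gap of at most
    [3 * (Rabs eps * M * P) * e] after one step: the threshold [1 / 6] makes the factor [1 / 2]. A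
    single contraction covers all of [[0, P]], because [eps] is small. *)
Lemma picard_contracts y y' e :
  slow_curve y -> slow_curve y' -> 0 <= e ->
  (forall i s, 0 <= s <= P -> Rabs (y s i - y' s i) <= e) ->
  forall i s, 0 <= s <= P -> Rabs (picard_step y s i - picard_step y' s i) <= e / 2.
Proof.
  intros Hy Hy' He H i s Hs.
  assert (B : Rabs ((picard_step y s i - picard_step y' s i) - (picard_step y 0 i - picard_step y' 0 i))
     <= Rabs eps * (M * (3 * e)) * (s - 0)).
  { apply (derive_bound (fun t => picard_step y t i - picard_step y' t i)
      (fun t => eps * G i t (y t) - eps * G i t (y' t))); [lra | |].
    - intros t Ht. apply (is_derive_minus (fun t => picard_step y t i) (fun t => picard_step y' t i));
        now apply picard_derive.
    - intros t Ht. rewrite <- Rmult_minus_distr_l, Rabs_mult.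
      apply Rmult_le_compat_l; [apply Rabs_pos |].
      eapply Rle_trans; [apply G_lipschitz |]. apply Rmult_le_compat_l; auto.
      rewrite Rminus_diag, Rabs_R0, Rplus_0_l. apply dist3_le. intro j. apply H. lra. }
  rewrite !picard_0, Rminus_diag, !Rminus_0_r in B.
  eapply Rle_trans; [apply B |].
  assert (PE := Rabs_pos eps).
  assert (Rabs eps * M * s <= Rabs eps * M * P).
  { apply Rmult_le_compat_l; [nra | lra]. }
  replace (Rabs eps * (M * (3 * e)) * s) with (3 * e * (Rabs eps * M * s)) by ring.
  apply Rle_trans with (3 * e * (1 / 6)); [| lra].
  apply Rmult_le_compat_l; lra.
Qed.

Fixpoint picard (n : nat) : R -> nat -> R :=
  match n with
  | O => fun _ i => v0 i
  | S n => picard_step (picard n)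
  end.

Lemma picard_iterates_slow n : slow_curve (picard n).
Proof.
  induction n as [| n IH]; simpl; [| now apply picard_slow].
  exists 0. intros. rewrite Rminus_diag, Rabs_R0. lra.
Qed.

Lemma picard_close n : forall i s, 0 <= s <= P ->
  Rabs (picard (S n) s i - picard n s i) <= (1 / 2) ^ n.
Proof.
  induction n as [| n IH].
  - intros i s Hs. simpl. unfold picard_step.
    assert (B := derive_bound (fun t => picard 1 t i) (fun t => eps * G i t (picard 0 t)) 0 s
      (Rabs eps * M) ltac:(lra)).
    assert (E : picard 1 0 i = v0 i) by apply picard_0.
    cbv beta in B. rewrite E in B.
    eapply Rle_trans; [apply B |].
    + intros t Ht. apply picard_derive, (picard_iterates_slow 0).
    + intros t Ht. rewrite Rabs_mult. apply Rmult_le_compat_l; [apply Rabs_pos | apply G_bounded].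
    + assert (PE := Rabs_pos eps).
      assert (Rabs eps * M * (s - 0) <= Rabs eps * M * P) by (apply Rmult_le_compat_l; [nra | lra]).
      lra.
  - intros i s Hs.
    replace ((1 / 2) ^ S n) with ((1 / 2) ^ n / 2) by (simpl; field).
    apply (picard_contracts (picard (S n)) (picard n)); auto; try apply picard_iterates_slow.
    left. apply pow_lt; lra.
Qed.

(** The limit [z] of the iterates is a fixed point on [[0, P]]. The curve returned is
    [picard_step z] instead of [z]: it agrees with [z] on [[0, P]] and is differentiable on both
    sides of the endpoints, beyond which [z] is frozen by the clamp. *)
Lemma slow_ode : exists y : R -> nat -> R,
  (forall i, y 0 i = v0 i) /\
  (forall i s, 0 <= s <= P -> is_derive (fun t => y t i) s (eps * G i s (y s))).
Proof.
  set (z := fun s i => real (Lim_seq (fun n => picard n (clamp 0 P s) i))).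
  assert (Hz : forall n i s, Rabs (picard n (clamp 0 P s) i - z s i) <= 2 * (1 / 2) ^ n).
  { intros n i s. apply (geometric_limit (fun n => picard n (clamp 0 P s) i)).
    intro p. apply picard_close. now apply clamp_bounds. }
  assert (Hz' : forall n i s, 0 <= s <= P -> Rabs (picard n s i - z s i) <= 2 * (1 / 2) ^ n).
  { intros n i s Hs. rewrite <- (clamp_id 0 P s Hs) at 1. apply Hz. }
  assert (Hslow : slow_curve z).
  { exists (Rabs eps * M). intros i a b.
    apply Rnot_lt_le. intro Hlt.
    (* The excess over the Lipschitz bound of the iterates is positive by [Hlt] and at most
       [4 * (1 / 2) ^ n] for all [n]: a contradiction. *)
    assert (K : forall n, Rabs (Rabs (z a i - z b i) - Rabs eps * M * Rabs (a - b)) <= 4 * (1/2) ^ n).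
    { intro n. rewrite Rabs_right by lra.
      assert (A := Hz n i a). assert (B := Hz n i b).
      assert (C : Rabs (picard n (clamp 0 P a) i - picard n (clamp 0 P b) i) <= Rabs eps * M * Rabs (a - b)).
      { apply Rle_trans with (Rabs eps * M * Rabs (clamp 0 P a - clamp 0 P b)).
        - destruct n as [| n]; simpl.
          + rewrite Rminus_diag, Rabs_R0. repeat apply Rmult_le_pos; auto; apply Rabs_pos.
          + apply (derive_bound_gen (fun t => picard_step (picard n) t i) (fun t => eps * G i t (picard n t))).
            * intros t _. apply picard_derive, picard_iterates_slow.
            * intros t _. rewrite Rabs_mult. apply Rmult_le_compat_l; [apply Rabs_pos | apply G_bounded].
        - apply Rmult_le_compat_l; [apply Rmult_le_pos; auto; apply Rabs_pos |].
          rewrite <- (Rmult_1_l (Rabs (a - b))). apply clamp_lipschitz. }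
      replace (z a i - z b i) with ((picard n (clamp 0 P a) i - picard n (clamp 0 P b) i)
        - (picard n (clamp 0 P a) i - z a i) + (picard n (clamp 0 P b) i - z b i)) by ring.
      assert (T1 := Rabs_triang ((picard n (clamp 0 P a) i - picard n (clamp 0 P b) i)
        - (picard n (clamp 0 P a) i - z a i)) (picard n (clamp 0 P b) i - z b i)).
      assert (T2 := Rabs_triang (picard n (clamp 0 P a) i - picard n (clamp 0 P b) i)
        (- (picard n (clamp 0 P a) i - z a i))).
      rewrite Rabs_Ropp in T2. unfold Rminus in *. lra. }
    apply eq_0_of_geometric_bound in K. lra. }
  exists (picard_step z).
  split; [intro; apply picard_0 |].
  assert (Heq : forall i s, 0 <= s <= P -> picard_step z s i = z s i).
  { intros i s Hs. apply Rminus_diag_uniq. apply (eq_0_of_geometric_bound _ 2). intro n.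
    assert (A := Hz' (S n) i s Hs).
    assert (B := picard_contracts (picard n) z (2 * (1 / 2) ^ n) (picard_iterates_slow n) Hslow
      ltac:(assert (0 < (1/2)^n) by (apply pow_lt; lra); lra) (Hz' n) i s Hs).
    replace (picard_step z s i - z s i) with
      (- (picard_step (picard n) s i - picard_step z s i) + (picard (S n) s i - z s i)) by (simpl; ring).
    triangle. rewrite Rabs_Ropp. simpl in A |- *. lra. }
  intros i s Hs.
  replace (eps * G i s (picard_step z s)) with (eps * G i s (z s)); [now apply picard_derive |].
  f_equal. apply Rminus_diag_uniq.
  assert (A := G_lipschitz i s s (z s) (picard_step z s)).
  unfold dist3 in A. rewrite !Heq in A by auto. rewrite !Rminus_diag, Rabs_R0 in A.
  apply (eq_0_of_geometric_bound _ 0). intro n. lra.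
Qed.

End SlowEquation.

(** In place of Gronwall's inequality, the largest distance [D sm] is absorbed: the three components
    give [D sm <= D 0 + (del + D sm) / 2]. The conclusion bounds the change of the difference, not
    the difference, and so keeps a factor [Rabs eps]; the monotonicity of the shooting map rests on
    this factor. *)
Lemma slow_dependence (G G' : nat -> R -> (nat -> R) -> R) (M P eps del : R) (y y' : R -> nat -> R) :
  0 <= P -> 0 <= M -> 0 <= del -> Rabs eps * M * P <= 1 / 6 ->
  (forall i s v v', 0 <= s <= P -> Rabs (G i s v - G' i s v') <= M * (del + dist3 v v')) ->
  (forall i s, 0 <= s <= P -> is_derive (fun t => y t i) s (eps * G i s (y s))) ->
  (forall i s, 0 <= s <= P -> is_derive (fun t => y' t i) s (eps * G' i s (y' s))) ->
  forall i s, 0 <= s <= P ->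
  Rabs ((y s i - y' s i) - (y 0 i - y' 0 i)) <= Rabs eps * M * P * (2 * del + 2 * dist3 (y 0) (y' 0)).
Proof.
  intros HP HM Hdel Heps HG Hy Hy'.
  set (D := fun s => dist3 (y s) (y' s)).
  destruct (continuity_ab_maj D 0 P HP) as [sm [Hmax Hsm]].
  { intros c Hc.
    assert (Hi : forall i, continuity_pt (fun s => Rabs (y s i - y' s i)) c).
    { intro i. apply (continuity_pt_comp (fun s => y s i - y' s i) Rabs).
      - apply continuity_pt_minus; apply continuity_pt_filterlim.
        + apply (ex_derive_continuous (fun s => y s i) c). eexists; now apply Hy.
        + apply (ex_derive_continuous (fun s => y' s i) c). eexists; now apply Hy'.
      - apply Rcontinuity_abs. }
    unfold D, dist3. apply (continuity_pt_plus (fun s => Rabs (y s 0%nat - y' s 0%nat) + Rabs (y s 1%nat - y' s 1%nat))).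
    - apply (continuity_pt_plus (fun s => Rabs (y s 0%nat - y' s 0%nat))); apply Hi.
    - apply Hi. }
  assert (PE := Rabs_pos eps).
  assert (B : forall i s, 0 <= s <= P ->
     Rabs ((y s i - y' s i) - (y 0 i - y' 0 i)) <= Rabs eps * M * P * (del + D sm)).
  { intros i s Hs.
    apply Rle_trans with (Rabs eps * (M * (del + D sm)) * (s - 0)).
    - apply (derive_bound (fun t => y t i - y' t i) (fun t => eps * G i t (y t) - eps * G' i t (y' t))); [lra | |].
      + intros t Ht. apply (is_derive_minus (fun t => y t i) (fun t => y' t i)); [apply Hy | apply Hy']; lra.
      + intros t Ht. rewrite <- Rmult_minus_distr_l, Rabs_mult.
        apply Rmult_le_compat_l; auto.
        eapply Rle_trans; [apply HG; lra |]. apply Rmult_le_compat_l; auto.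
        specialize (Hmax t ltac:(lra)). unfold D in *. lra.
    - assert (0 <= D sm) by apply dist3_pos.
      replace (Rabs eps * (M * (del + D sm)) * (s - 0)) with (Rabs eps * M * (del + D sm) * s) by ring.
      replace (Rabs eps * M * P * (del + D sm)) with (Rabs eps * M * (del + D sm) * P) by ring.
      apply Rmult_le_compat_l; [| lra]. repeat apply Rmult_le_pos; auto; lra. }
  assert (PD := dist3_pos (y sm) (y' sm)). fold (D sm) in PD.
  assert (PD0 := dist3_pos (y 0) (y' 0)). fold (D 0) in PD0.
  assert (HD : D sm <= 2 * D 0 + del).
  { assert (T : forall i, Rabs (y sm i - y' sm i) <= Rabs (y 0 i - y' 0 i) + 1 / 6 * (del + D sm)).
    { intro i. specialize (B i sm Hsm).
      replace (y sm i - y' sm i) with ((y 0 i - y' 0 i) + ((y sm i - y' sm i) - (y 0 i - y' 0 i))) by ring.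
      triangle. apply Rplus_le_compat_l.
      eapply Rle_trans; [apply B |]. apply Rmult_le_compat_r; lra. }
    assert (T0 := T 0%nat). assert (T1 := T 1%nat). assert (T2 := T 2%nat).
    unfold D in *. unfold dist3 at 1 in T0. unfold dist3 at 1 in T1. unfold dist3 at 1 in T2.
    unfold dist3 in *. lra. }
  intros i s Hs. eapply Rle_trans; [apply B; auto |].
  apply Rmult_le_compat_l; [repeat apply Rmult_le_pos; auto |]. unfold D in HD at 2. lra.
Qed.

(** * Orbital elements *)

Definition polar (U : R -> R -> R) (r th : R) : R := U (r * cos th) (r * sin th).
Definition polar_r (U : R -> R -> R) (r th : R) : R :=
  Defs.d1 U (r * cos th) (r * sin th) * cos th + Defs.d2 U (r * cos th) (r * sin th) * sin th.
Definition polar_t (U : R -> R -> R) (r th : R) : R :=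
  r * (- Defs.d1 U (r * cos th) (r * sin th) * sin th + Defs.d2 U (r * cos th) (r * sin th) * cos th).

Lemma derive_value (f : R -> R) (x l : R) : is_derive f x l -> Derive f x = l.
Proof. exact (is_derive_unique f x l). Qed.

(** [auto_derive] leaves [Derive] of the unknown functions in its goal; their values are taken from
    the context. *)
Ltac rewrite_derivatives := repeat match goal with
  | D : is_derive ?f ?x _ |- context [Derive (fun y => ?f y) ?x] =>
    rewrite (derive_value (fun y : R => f y) _ _ D)
  end.

Lemma is_derive_polar (U : R -> R -> R) (r th : R -> R) (s dr dth : R) :
  Ck 1 U -> is_derive r s dr -> is_derive th s dth ->
  is_derive (fun t => polar U (r t) (th t)) s (polar_r U (r s) (th s) * dr + polar_t U (r s) (th s) * dth).
Proof.
  intros [_ [Hex [[Hc _] _]]] Hr Ht. unfold polar.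
  replace (polar_r U (r s) (th s) * dr + polar_t U (r s) (th s) * dth) with
   (Defs.d1 U (r s * cos (th s)) (r s * sin (th s)) * (dr * cos (th s) - r s * (sin (th s) * dth)) +
    Defs.d2 U (r s * cos (th s)) (r s * sin (th s)) * (dr * sin (th s) + r s * (cos (th s) * dth)))
   by (unfold polar_r, polar_t; ring).
  apply (is_derive_comp_2d U (fun t => r t * cos (th t)) (fun t => r t * sin (th t))); auto.
  - auto_derive; [repeat split; eexists; eauto | rewrite_derivatives; ring].
  - auto_derive; [repeat split; eexists; eauto | rewrite_derivatives; ring].
Qed.

Lemma polar_periodic U r th : polar U r (th + 2 * PI) = polar U r th.
Proof. unfold polar. now rewrite cos_plus, sin_plus, cos_2PI, sin_2PI, !Rmult_0_r, !Rmult_1_r, Rminus_0_r, Rplus_0_r. Qed.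

Lemma polar_r_periodic U r th : polar_r U r (th + 2 * PI) = polar_r U r th.
Proof. unfold polar_r. now rewrite cos_plus, sin_plus, cos_2PI, sin_2PI, !Rmult_0_r, !Rmult_1_r, Rminus_0_r, Rplus_0_r. Qed.

Lemma polar_t_periodic U r th : polar_t U r (th + 2 * PI) = polar_t U r th.
Proof. unfold polar_t. now rewrite cos_plus, sin_plus, cos_2PI, sin_2PI, !Rmult_0_r, !Rmult_1_r, Rminus_0_r, Rplus_0_r. Qed.

(* [ell2 lam w] is [L^2 - 2 lam], where [L] is the angular momentum and
   [w = sqrt (L^2 - 2 lam) / L] is the frequency of the radial oscillation with respect to the angle. *)
Definition ell2 (lam w : R) : R := 2 * lam * w ^ 2 / (1 - w ^ 2).
Definition angmom (lam w : R) : R := sqrt (2 * lam / (1 - w ^ 2)).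
Definition radius (kap lam A g w : R) : R := ell2 lam w / (kap + A * cos g).
(** The radial velocity: the derivative of [radius] in the angle with the elements frozen, where [g]
    has speed [w], times the angular velocity [L / r^2]. *)
Definition radmom (lam A g w : R) : R := A * sin g / (w * angmom lam w).

(* [V = A cos g] and [Q = - A sin g] satisfy [V' = w Q + eps drift_V], [Q' = - w V + eps drift_Q]. *)
Definition drift_V (U : R -> R -> R) (r th : R) : R := 2 * r * polar_t U r th.
Definition drift_Q (lam : R) (U : R -> R -> R) (A g w r th : R) : R :=
  - w * r ^ 2 * polar_r U r th - r ^ 2 * polar_t U r th * A * sin g / ell2 lam w.
(** Variation of constants: [A = V cos g - Q sin g], and the rotation part of the equations for [V]
    and [Q] leaves [A] fixed. *)
Definition drift_A (lam : R) (U : R -> R -> R) (A g w r th : R) : R :=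
  drift_V U r th * cos g - drift_Q lam U A g w r th * sin g.
(** From the torque, which reads [L L' = eps r^2 polar_t] in the angle variable, by differentiating
    [L^2 (1 - w^2) = 2 lam]. *)
Definition drift_w (lam : R) (U : R -> R -> R) (w r th : R) : R :=
  r ^ 2 * polar_t U r th * (1 - w ^ 2) ^ 2 / (2 * lam * w).
(** Since [g = w s + gam], the derivative of [gam] is that of [g] minus [w] and minus [s w']. The
    division by [A] is why circular orbits are kept at a distance. *)
Definition drift_gam (lam : R) (U : R -> R -> R) (s A g w r th : R) : R :=
  - (drift_V U r th * sin g + drift_Q lam U A g w r th * cos g) / A - s * drift_w lam U w r th.

(* For unit mass, to which the theorem reduces by dividing [kap], [lam], [eps] and [H] by [m]. *)
Definition mech_energy (kap lam eps : R) (U : R -> R -> R) (r p L th : R) : R :=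
  p ^ 2 / 2 + L ^ 2 / (2 * r ^ 2) - kap / r - lam / r ^ 2 - eps * polar U r th.

Lemma angmom_sqr lam w : 0 < lam -> 0 < w < 1 -> 0 < angmom lam w /\ angmom lam w ^ 2 * (1 - w ^ 2) = 2 * lam.
Proof.
  intros Hl Hw. assert (0 < 1 - w ^ 2) by nra.
  assert (0 < 2 * lam / (1 - w ^ 2)) by (apply Rdiv_lt_0_compat; lra).
  unfold angmom. split; [now apply sqrt_lt_R0 |].
  rewrite pow2_sqrt by lra. field. lra.
Qed.

Lemma ell2_angmom lam w : 0 < lam -> 0 < w < 1 -> ell2 lam w = w ^ 2 * angmom lam w ^ 2.
Proof.
  intros Hl Hw. destruct (angmom_sqr lam w Hl Hw) as [_ E].
  unfold ell2. rewrite <- E. field. nra.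
Qed.

(** The Kepler energy with [ell2] as squared angular momentum: [lam / r^2] is absorbed in the
    centrifugal term. *)
Lemma mech_energy_elements kap lam eps U A g w th :
  0 < lam -> 0 < w < 1 -> 0 < kap + A * cos g ->
  mech_energy kap lam eps U (radius kap lam A g w) (radmom lam A g w) (angmom lam w) th =
  (A ^ 2 - kap ^ 2) / (2 * ell2 lam w) - eps * polar U (radius kap lam A g w) th.
Proof.
  intros Hl Hw Hd. unfold mech_energy. f_equal.
  unfold radius, radmom. rewrite ell2_angmom by auto.
  destruct (angmom_sqr lam w Hl Hw) as [PL E]. set (L := angmom lam w) in *.
  assert (El : lam = L ^ 2 * (1 - w ^ 2) / 2) by lra. rewrite El.
  assert (S : sin g ^ 2 = 1 - cos g ^ 2) by (generalize (sin2_cos2 g); unfold Rsqr; intro; lra).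
  unfold Rdiv at 2. rewrite !Rpow_mult_distr, S.
  field. repeat split; nra.
Qed.

Section Motion.

Variables kap lam eps th0 : R.
Variable U : R -> R -> R.
Hypothesis lam_pos : 0 < lam.
Hypothesis U_smooth : Ck 1 U.

Section ElementsToPolar.

Variables A gam w : R -> R.
Variable s : R.
Let g t := w t * t + gam t.
Let r t := radius kap lam (A t) (g t) (w t).
Let p t := radmom lam (A t) (g t) (w t).
Let L t := angmom lam (w t).
Hypothesis A_pos : 0 < A s < kap.
Hypothesis w_pos : 0 < w s < 1.
Hypothesis A_derive : is_derive A s (eps * drift_A lam U (A s) (g s) (w s) (r s) (th0 + s)).
Hypothesis gam_derive : is_derive gam s (eps * drift_gam lam U s (A s) (g s) (w s) (r s) (th0 + s)).
Hypothesis w_derive : is_derive w s (eps * drift_w lam U (w s) (r s) (th0 + s)).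

Lemma den_pos : 0 < kap + A s * cos (g s).
Proof. assert (H := COS_bound (g s)). nra. Qed.

Lemma r_pos : 0 < r s.
Proof.
  unfold r, radius. rewrite ell2_angmom by auto.
  destruct (angmom_sqr lam (w s) lam_pos w_pos) as [PL _].
  apply Rdiv_lt_0_compat; [| apply den_pos]. apply Rmult_lt_0_compat; apply pow_lt; [apply w_pos | apply PL].
Qed.

Lemma g_derive : is_derive g s (w s - eps * (drift_V U (r s) (th0 + s) * sin (g s) +
   drift_Q lam U (A s) (g s) (w s) (r s) (th0 + s) * cos (g s)) / A s).
Proof.
  unfold g at 1. auto_derive.
  - repeat split; eexists; eassumption.
  - rewrite_derivatives. unfold drift_gam. field. lra.
Qed.

Lemma V_derive : is_derive (fun t => A t * cos (g t)) s
  (- w s * (A s * sin (g s)) + eps * drift_V U (r s) (th0 + s)).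
Proof.
  assert (Dg := g_derive).
  assert (S : sin (g s) ^ 2 = 1 - cos (g s) ^ 2) by (generalize (sin2_cos2 (g s)); unfold Rsqr; intro; lra).
  auto_derive.
  - repeat split; eexists; eassumption.
  - rewrite_derivatives. unfold drift_A. field_simplify; [| lra]. rewrite S. ring.
Qed.

(** The function here is the opposite of the [Q] in which the drift is written, hence the sign of
    [drift_Q]. *)
Lemma Q_derive : is_derive (fun t => A t * sin (g t)) s
  (w s * (A s * cos (g s)) - eps * drift_Q lam U (A s) (g s) (w s) (r s) (th0 + s)).
Proof.
  assert (Dg := g_derive).
  assert (S : sin (g s) ^ 2 = 1 - cos (g s) ^ 2) by (generalize (sin2_cos2 (g s)); unfold Rsqr; intro; lra).
  auto_derive.
  - repeat split; eexists; eassumption.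
  - rewrite_derivatives. unfold drift_A. field_simplify; [| lra]. rewrite S. ring.
Qed.

Lemma L_derive : is_derive L s (eps * r s ^ 2 * polar_t U (r s) (th0 + s) / L s).
Proof.
  destruct (angmom_sqr lam (w s) lam_pos w_pos) as [PL E].
  assert (W1 := proj1 w_pos). assert (W2 : 0 < 1 - w s ^ 2) by (clear - w_pos; nra).
  unfold L, angmom. auto_derive.
  - split; [eexists; apply w_derive |]. split; [simpl in W2; lra |].
    split; [| auto]. apply Rdiv_lt_0_compat; [lra |]. simpl in W2; lra.
  - rewrite_derivatives. fold (angmom lam (w s)).
    change (sqrt (2 * lam * / (1 + - (w s * (w s * 1))))) with (angmom lam (w s)).
    unfold drift_w. field. repeat split; nra.
Qed.

(** The elements are osculating: the terms in [eps] cancel, because [drift_V = 2 r polar_t]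
    compensates the variation of [ell2] in [r = ell2 / (kap + V)]. *)
Lemma r_derive : is_derive r s (r s ^ 2 * p s / L s).
Proof.
  assert (DV := V_derive). set (V := fun t => A t * cos (g t)).
  match type of DV with is_derive _ _ ?l => change (is_derive V s l) in DV end.
  assert (EV : V s = A s * cos (g s)) by reflexivity.
  destruct (angmom_sqr lam (w s) lam_pos w_pos) as [PL E].
  assert (W1 := proj1 w_pos). assert (W2 : 0 < 1 - w s ^ 2) by (clear - w_pos; nra).
  assert (Hd := den_pos).
  apply is_derive_ext with (fun t => 2 * lam * w t ^ 2 / (1 - w t ^ 2) / (kap + V t)).
  { reflexivity. }
  (* With [V] opaque, [auto_derive] works with the short derivative [DV] instead of expanding the
     cosine. *)
  clearbody V. rewrite <- EV in Hd.
  auto_derive.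
  - repeat split; try (eexists; eassumption); simpl in W2; lra.
  - rewrite_derivatives.
    assert (Er : r s = w s ^ 2 * L s ^ 2 / (kap + A s * cos (g s))).
    { unfold r, radius. now rewrite ell2_angmom. }
    unfold drift_V, drift_w, p, radmom.
    fold (L s). fold (L s) in PL, E.
    set (T := polar_t U (r s) (th0 + s)). rewrite Er.
    assert (El : lam = L s ^ 2 * (1 - w s ^ 2) / 2) by lra. rewrite El, <- EV.
    field. repeat split; try nra.
Qed.

(** The radial equation of motion, multiplied by [dt / ds = r^2 / L]. *)
Lemma p_derive : is_derive p s
  ((L s ^ 2 / r s - 2 * lam / r s - kap + eps * r s ^ 2 * polar_r U (r s) (th0 + s)) / L s).
Proof.
  assert (DQ := Q_derive). set (Q := fun t => A t * sin (g t)).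
  match type of DQ with is_derive _ _ ?l => change (is_derive Q s l) in DQ end.
  assert (EQ : Q s = A s * sin (g s)) by reflexivity.
  assert (DL := L_derive). assert (ELs : L s = angmom lam (w s)) by reflexivity.
  destruct (angmom_sqr lam (w s) lam_pos w_pos) as [PL E].
  assert (W1 := proj1 w_pos). assert (W2 : 0 < 1 - w s ^ 2) by (clear - w_pos; nra).
  assert (Hd := den_pos).
  apply is_derive_ext with (fun t => Q t / (w t * L t)).
  { reflexivity. }
  fold (L s) in PL, E.
  assert (Er : r s = w s ^ 2 * L s ^ 2 / (kap + A s * cos (g s))).
  { unfold r, radius. now rewrite ell2_angmom. }
  clearbody Q L.
  auto_derive.
  - repeat split; try (eexists; eassumption); nra.
  - rewrite_derivatives.
    unfold drift_Q, drift_w. rewrite ell2_angmom by auto. rewrite <- ELs.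
    set (T := polar_t U (r s) (th0 + s)). set (T' := polar_r U (r s) (th0 + s)). rewrite Er.
    assert (El : lam = L s ^ 2 * (1 - w s ^ 2) / 2) by lra. rewrite El, EQ.
    field. repeat split; nra.
Qed.

End ElementsToPolar.

Lemma energy_derive (r p L : R -> R) (s : R) :
  0 < r s -> 0 < L s ->
  is_derive r s (r s ^ 2 * p s / L s) ->
  is_derive p s ((L s ^ 2 / r s - 2 * lam / r s - kap + eps * r s ^ 2 * polar_r U (r s) (th0 + s)) / L s) ->
  is_derive L s (eps * r s ^ 2 * polar_t U (r s) (th0 + s) / L s) ->
  is_derive (fun t => mech_energy kap lam eps U (r t) (p t) (L t) (th0 + t)) s 0.
Proof.
  intros Pr PL Hr Hp HL.
  assert (HW : is_derive (fun t => polar U (r t) (th0 + t)) s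
    (polar_r U (r s) (th0 + s) * (r s ^ 2 * p s / L s) + polar_t U (r s) (th0 + s) * 1)).
  { apply (is_derive_polar U r (fun t => th0 + t)); auto. auto_derive; auto; ring. }
  set (W := fun t => polar U (r t) (th0 + t)).
  match type of HW with is_derive _ _ ?l => change (is_derive W s l) in HW end.
  apply is_derive_ext with (fun t => p t ^ 2 / 2 + L t ^ 2 / (2 * r t ^ 2) - kap / r t - lam / r t ^ 2
     - eps * W t).
  { reflexivity. }
  clearbody W.
  auto_derive.
  - assert (0 < r s * r s) by nra.
    repeat split; try (eexists; eassumption); nra.
  - rewrite_derivatives. field. lra.
Qed.

End Motion.

(** * The flow of the orbital elements *)

(* A point [(s, th, v)] records the elapsed angle, the initial angle, and the elements [A, gam, w]
   as [v 0], [v 1], [v 2]. *)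
Definition pt : Type := (R * R * (nat -> R))%type.
Definition dist_pt (x y : pt) : R :=
  Rabs (fst (fst x) - fst (fst y)) + Rabs (snd (fst x) - snd (fst y)) + dist3 (snd x) (snd y).

Lemma dist_pt_ge_0 x y : 0 <= dist_pt x y.
Proof. unfold dist_pt, dist3. abs_lra. Qed.

Notation BLp := (BL pt dist_pt).
Notation Lipsp := (Lips pt dist_pt).

Lemma Lips_angle : Lipsp (fun x => fst (fst x)).
Proof. exists 1. split; [lra |]. intros x y. unfold dist_pt, dist3. abs_lra. Qed.

Lemma Lips_initial_angle : Lipsp (fun x => snd (fst x)).
Proof. exists 1. split; [lra |]. intros x y. unfold dist_pt, dist3. abs_lra. Qed.

Lemma Lips_element i : (i < 3)%nat -> Lipsp (fun x => snd x i).
Proof.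
  intro Hi. exists 1. split; [lra |]. intros x y. unfold dist_pt, dist3.
  destruct i as [|[|[|i]]]; [abs_lra | abs_lra | abs_lra | lia].
Qed.

Section Clamped.

Variables kap lam D ws P : R.
Variable U : R -> R -> R.
Hypothesis lam_pos : 0 < lam.
Hypothesis D_bounds : 0 < D < kap.
Hypothesis ws_bounds : 0 < ws < 1.
Hypothesis P_ge_0 : 0 <= P.
Hypothesis U_C2 : Ck 2 U.

(* The elements are clamped to a box around the unperturbed ones, so that their drift is globally
   bounded and Lipschitz; solutions that start near the centre of the box never feel the clamps. *)
Definition cS (x : pt) : R := clamp 0 P (fst (fst x)).
Definition cTh (x : pt) : R := snd (fst x) + cS x.
(** The bounds lie halfway from [D] to two singular values: [0], where the drift divides by [A], and
    [kap], where the denominator of [radius] may vanish. The bounds for [w] lie halfway to [0] and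
    [1] in the same way. *)
Definition cA (x : pt) : R := clamp (D / 2) ((D + kap) / 2) (snd x 0%nat).
Definition cw (x : pt) : R := clamp (ws / 2) ((1 + ws) / 2) (snd x 2%nat).
Definition cg (x : pt) : R := cw x * cS x + snd x 1%nat.
Definition cr (x : pt) : R := radius kap lam (cA x) (cg x) (cw x).

Lemma cA_bounds x : D / 2 <= cA x <= (D + kap) / 2.
Proof. apply clamp_bounds; lra. Qed.

Lemma cw_bounds x : ws / 2 <= cw x <= (1 + ws) / 2.
Proof. apply clamp_bounds; lra. Qed.

Lemma cw_bounds' x : 0 < cw x < 1.
Proof. generalize (cw_bounds x). lra. Qed.

Lemma BL_cS : BLp cS.
Proof. apply (BL_clamp pt dist_pt 0 P); [lra | apply Lips_angle]. Qed.

Lemma Lips_cTh : Lipsp cTh.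
Proof. apply Lips_plus; [apply Lips_initial_angle | apply BL_Lips, BL_cS]. Qed.

Lemma BL_cA : BLp cA.
Proof. apply (BL_clamp pt dist_pt); [lra | apply Lips_element; lia]. Qed.

Lemma BL_cw : BLp cw.
Proof. apply (BL_clamp pt dist_pt); [lra | apply Lips_element; lia]. Qed.

(** Like [cTh], the phase is Lipschitz but unbounded, since [gam] is not clamped; this suffices
    because both enter only through cosines and sines. *)
Lemma Lips_cg : Lipsp cg.
Proof.
  apply Lips_plus; [| apply Lips_element; lia].
  apply BL_Lips, BL_mult; [apply dist_pt_ge_0 | apply BL_cw | apply BL_cS].
Qed.

Lemma one_minus_cw2 x : (1 - ((1 + ws) / 2) ^ 2) <= 1 - cw x ^ 2.
Proof. generalize (cw_bounds x). intro. nra. Qed.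

Lemma one_minus_ws2 : 0 < 1 - ((1 + ws) / 2) ^ 2.
Proof. nra. Qed.

Ltac bl := repeat first
  [ apply BL_const | apply BL_cS | apply BL_cA | apply BL_cw
  | apply BL_cos; first [apply Lips_cg | apply Lips_cTh]
  | apply BL_sin; first [apply Lips_cg | apply Lips_cTh]
  | assumption
  | apply BL_minus | apply BL_plus | apply BL_opp
  | apply BL_mult; [apply dist_pt_ge_0 | |] | apply BL_pow; [apply dist_pt_ge_0 |]].

Lemma BL_one_minus_cw2_inv : BLp (fun x => / (1 - cw x ^ 2)).
Proof.
  apply BL_inv with (1 - ((1 + ws) / 2) ^ 2); [apply one_minus_ws2 | apply one_minus_cw2 | bl].
Qed.

Lemma BL_cw_inv : BLp (fun x => / cw x).
Proof. apply BL_inv with (ws / 2); [lra | apply cw_bounds | bl]. Qed.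

Lemma BL_cA_inv : BLp (fun x => / cA x).
Proof. apply BL_inv with (D / 2); [lra | apply cA_bounds | bl]. Qed.

Lemma cden_ge x : (kap - D) / 2 <= kap + cA x * cos (cg x).
Proof. generalize (cA_bounds x) (COS_bound (cg x)). intros. nra. Qed.

Lemma BL_cell2 : BLp (fun x => ell2 lam (cw x)).
Proof. unfold ell2. assert (H := BL_one_minus_cw2_inv). unfold Rdiv. bl. Qed.

Lemma BL_cell2_inv : BLp (fun x => / ell2 lam (cw x)).
Proof.
  assert (H : BLp (fun x => / (2 * lam) * (1 - cw x ^ 2) * / cw x * / cw x)) by (assert (K := BL_cw_inv); bl).
  assert (E : forall x, / (2 * lam) * (1 - cw x ^ 2) * / cw x * / cw x = / ell2 lam (cw x)).
  { intro x. unfold ell2. generalize (cw_bounds' x). intro. field. repeat split; nra. }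
  destruct H as [[M [PM H]] [N [PN K]]]. split.
  - exists M. split; auto. intros x y. rewrite <- !E. apply H.
  - exists N. split; auto. intros x. rewrite <- !E. apply K.
Qed.

Lemma BL_cr : BLp cr.
Proof.
  unfold cr, radius. apply BL_div with ((kap - D) / 2); [apply dist_pt_ge_0 | lra | apply cden_ge | apply BL_cell2 | bl].
Qed.

Lemma cr_pos : exists c, 0 < c /\ forall x, c <= cr x.
Proof.
  exists (2 * lam * (ws / 2) ^ 2 / (kap + (D + kap) / 2)).
  assert (P1 : 0 < ws / 2) by lra.
  split.
  - apply Rdiv_lt_0_compat; [| lra]. apply Rmult_lt_0_compat; [lra | now apply pow_lt].
  - intro x. unfold cr, radius, ell2.
    assert (A := cA_bounds x). assert (W := cw_bounds x). assert (C := COS_bound (cg x)).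
    assert (Hd := cden_ge x). assert (W2 := one_minus_cw2 x). assert (W3 := one_minus_ws2).
    assert (Q1 : (ws / 2) ^ 2 <= cw x ^ 2) by (apply pow_incr; lra).
    assert (Q2 : 1 - cw x ^ 2 <= 1) by nra.
    apply Rmult_le_compat.
    + apply Rmult_le_pos; [lra | apply pow2_ge_0].
    + left; apply Rinv_0_lt_compat; lra.
    + apply Rle_trans with (2 * lam * cw x ^ 2); [apply Rmult_le_compat_l; lra |].
      apply Rmult_le_reg_r with (1 - cw x ^ 2); [lra |].
      unfold Rdiv. rewrite (Rmult_assoc (2 * lam * cw x ^ 2) (/ _)), Rinv_l, Rmult_1_r by lra.
      assert (0 <= 2 * lam * cw x ^ 2) by (apply Rmult_le_pos; [lra | apply pow2_ge_0]). nra.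
    + apply Rinv_le_contravar; [lra |]. nra.
Qed.

Lemma BL_polar : BLp (fun x => polar U (cr x) (cTh x)).
Proof.
  assert (H := BL_cr). unfold polar.
  apply (BL_comp2 pt dist_pt U (fun x => cr x * cos (cTh x)) (fun x => cr x * sin (cTh x))); [now apply Ck_le | bl | bl].
Qed.

Lemma BL_polar_grad : BLp (fun x => Defs.d1 U (cr x * cos (cTh x)) (cr x * sin (cTh x))) /\
  BLp (fun x => Defs.d2 U (cr x * cos (cTh x)) (cr x * sin (cTh x))).
Proof.
  assert (H := BL_cr). destruct U_C2 as [H0 [H1 [H2 H3]]].
  split; apply (BL_comp2 pt dist_pt _ (fun x => cr x * cos (cTh x)) (fun x => cr x * sin (cTh x))); auto; bl.
Qed.

Lemma BL_polar_r : BLp (fun x => polar_r U (cr x) (cTh x)).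
Proof. destruct BL_polar_grad. assert (H1 := BL_cr). unfold polar_r. bl. Qed.

Lemma BL_polar_t : BLp (fun x => polar_t U (cr x) (cTh x)).
Proof. destruct BL_polar_grad. assert (H1 := BL_cr). unfold polar_t. bl. Qed.

Lemma BL_drift_V : BLp (fun x => drift_V U (cr x) (cTh x)).
Proof. assert (H1 := BL_cr). assert (H2 := BL_polar_t). unfold drift_V. bl. Qed.

Lemma BL_drift_Q : BLp (fun x => drift_Q lam U (cA x) (cg x) (cw x) (cr x) (cTh x)).
Proof.
  assert (H1 := BL_cr). assert (H2 := BL_polar_t). assert (H3 := BL_polar_r).
  assert (H4 := BL_cell2_inv). unfold drift_Q, Rdiv. bl.
Qed.

Lemma BL_drift_A : BLp (fun x => drift_A lam U (cA x) (cg x) (cw x) (cr x) (cTh x)).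
Proof. assert (H1 := BL_drift_V). assert (H2 := BL_drift_Q). unfold drift_A. bl. Qed.

Lemma BL_drift_w : BLp (fun x => drift_w lam U (cw x) (cr x) (cTh x)).
Proof.
  assert (H1 := BL_cr). assert (H2 := BL_polar_t). unfold drift_w.
  apply BL_div with (2 * lam * (ws / 2)); [apply dist_pt_ge_0 | nra | | bl | bl].
  intro x. apply Rmult_le_compat_l; [lra | apply cw_bounds].
Qed.

Lemma BL_drift_gam : BLp (fun x => drift_gam lam U (cS x) (cA x) (cg x) (cw x) (cr x) (cTh x)).
Proof.
  assert (H1 := BL_drift_V). assert (H2 := BL_drift_Q). assert (H3 := BL_drift_w).
  assert (H4 := BL_cA_inv). unfold drift_gam, Rdiv. bl.
Qed.

Lemma BL_angmom : BLp (fun x => angmom lam (cw x)).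
Proof.
  unfold angmom. apply BL_sqrt with (2 * lam).
  - lra.
  - intro x. assert (W2 := one_minus_cw2 x). assert (W3 := one_minus_ws2).
    apply Rmult_le_reg_r with (1 - cw x ^ 2); [lra |].
    unfold Rdiv. rewrite (Rmult_assoc (2 * lam) (/ _)), Rinv_l, Rmult_1_r by lra. nra.
  - unfold Rdiv. assert (H := BL_one_minus_cw2_inv). bl.
Qed.

Lemma angmom_ge x : sqrt (2 * lam) <= angmom lam (cw x).
Proof.
  unfold angmom. apply sqrt_le_1_alt.
  assert (W2 := one_minus_cw2 x). assert (W3 := one_minus_ws2).
  apply Rmult_le_reg_r with (1 - cw x ^ 2); [lra |].
  unfold Rdiv. rewrite (Rmult_assoc (2 * lam) (/ _)), Rinv_l, Rmult_1_r by lra. nra.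
Qed.

Lemma BL_angmom_inv : BLp (fun x => / angmom lam (cw x)).
Proof.
  apply BL_inv with (sqrt (2 * lam)); [apply sqrt_lt_R0; lra | apply angmom_ge | apply BL_angmom].
Qed.

Lemma BL_radmom : BLp (fun x => radmom lam (cA x) (cg x) (cw x)).
Proof.
  unfold radmom. assert (0 < sqrt (2 * lam)) by (apply sqrt_lt_R0; lra).
  assert (H1 := BL_angmom).
  apply BL_div with (ws / 2 * sqrt (2 * lam)); [apply dist_pt_ge_0 | nra | | bl | bl].
  intro x. apply Rmult_le_compat; try lra; [apply cw_bounds | apply angmom_ge].
Qed.

Definition drift (i : nat) (x : pt) : R :=
  match i with
  | O => drift_A lam U (cA x) (cg x) (cw x) (cr x) (cTh x)
  | 1%nat => drift_gam lam U (cS x) (cA x) (cg x) (cw x) (cr x) (cTh x)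
  | 2%nat => drift_w lam U (cw x) (cr x) (cTh x)
  | _ => 0
  end.

Lemma drift_uniform : exists M, 0 <= M /\
  (forall i x, Rabs (drift i x) <= M) /\
  (forall i x y, Rabs (drift i x - drift i y) <= M * dist_pt x y).
Proof.
  destruct BL_drift_A as [[M0 [P0 H0]] [N0 [Q0 K0]]].
  destruct BL_drift_gam as [[M1 [P1 H1]] [N1 [Q1 K1]]].
  destruct BL_drift_w as [[M2 [P2 H2]] [N2 [Q2 K2]]].
  exists (M0 + M1 + M2 + N0 + N1 + N2). split; [lra |]. split.
  - intros [|[|[|i]]] x; simpl.
    + specialize (K0 x); lra.
    + specialize (K1 x); lra.
    + specialize (K2 x); lra.
    + rewrite Rabs_R0. lra.
  - intros i x y. assert (Hd := dist_pt_ge_0 x y).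
    destruct i as [|[|[|i]]]; simpl.
    + specialize (H0 x y). nra.
    + specialize (H1 x y). nra.
    + specialize (H2 x y). nra.
    + rewrite Rminus_diag, Rabs_R0. nra.
Qed.

Lemma drift_periodic i s th v : drift i (s, th + 2 * PI, v) = drift i (s, th, v).
Proof.
  assert (E1 : cTh (s, th + 2 * PI, v) = cTh (s, th, v) + 2 * PI) by (unfold cTh, cS; simpl; ring).
  assert (E2 : cr (s, th + 2 * PI, v) = cr (s, th, v)) by reflexivity.
  assert (E3 : cg (s, th + 2 * PI, v) = cg (s, th, v)) by reflexivity.
  destruct i as [|[|[|i]]]; simpl; auto;
  unfold drift_gam, drift_A, drift_w, drift_Q, drift_V; rewrite ?E1, ?E2, ?E3, ?polar_t_periodic, ?polar_r_periodic; reflexivity.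
Qed.

(* For initial angle [th] and initial elements [v], the elements are [Y th v s]. *)
Lemma slow_flow : exists C e1, 0 < C /\ 0 < e1 /\ forall eps, Rabs eps <= e1 ->
  exists Y : R -> (nat -> R) -> R -> nat -> R,
    (forall th v i, Y th v 0 i = v i) /\
    (forall th v i s, 0 <= s <= P ->
       is_derive (fun t => Y th v t i) s (eps * drift i (s, th, Y th v s))) /\
    (forall th v i s, 0 <= s <= P -> Rabs (Y th v s i - v i) <= C * Rabs eps) /\
    (forall th th' v v' i s, 0 <= s <= P ->
       Rabs ((Y th v s i - v i) - (Y th' v' s i - v' i)) <= C * Rabs eps * (Rabs (th - th') + dist3 v v')) /\
    (forall th v i s, 0 <= s <= P -> Y (th + 2 * PI) v s i = Y th v s i).
Proof.
  destruct drift_uniform as [M [PM [HB HL]]].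
  (* The second value secures the threshold [1 / 6] of the Picard iteration; [2 * M * P] is the
     constant of [slow_dependence], and adding 1 makes it positive. *)
  exists (2 * M * P + 1), (1 / (6 * (M * P + 1))).
  assert (PMP : 0 <= M * P) by (now apply Rmult_le_pos).
  split; [lra |]. split; [apply Rdiv_lt_0_compat; lra |].
  intros eps Heps. assert (PE := Rabs_pos eps).
  assert (Hsmall : Rabs eps * M * P <= 1 / 6).
  { apply Rle_div_r in Heps; [| lra]. nra. }
  assert (Hex : forall q : R * (nat -> R), exists y : R -> nat -> R,
     (forall i, y 0 i = snd q i) /\
     (forall i s, 0 <= s <= P -> is_derive (fun t => y t i) s (eps * drift i (s, fst q, y s)))).
  { intros [th v]. apply (slow_ode (fun i s v => drift i (s, th, v)) M P eps); auto.
    intros i s s' w w'. eapply Rle_trans; [apply HL |]. apply Rmult_le_compat_l; auto.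
    unfold dist_pt; simpl. rewrite Rminus_diag, Rabs_R0. lra. }
  destruct (functional_choice _ Hex) as [Y HY].
  exists (fun th v => Y (th, v)).
  assert (Y0 : forall th v i, Y (th, v) 0 i = v i) by (intros th v i; apply (proj1 (HY (th, v)))).
  assert (YD : forall th v i s, 0 <= s <= P ->
     is_derive (fun t => Y (th, v) t i) s (eps * drift i (s, th, Y (th, v) s))).
  { intros th v i s. apply (proj2 (HY (th, v))). }
  split; [auto | split; [auto |]].
  split; [| split].
  - intros th v i s Hs. rewrite <- (Y0 th v i) at 1.
    apply Rle_trans with (Rabs eps * M * (s - 0)).
    + apply (derive_bound (fun t => Y (th, v) t i) (fun t => eps * drift i (t, th, Y (th, v) t))); [lra | |].
      * intros t Ht. apply YD. lra.
      * intros t Ht. rewrite Rabs_mult. apply Rmult_le_compat_l; auto.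
    + assert (Rabs eps * M * (s - 0) <= Rabs eps * M * P).
      { apply Rmult_le_compat_l; [now apply Rmult_le_pos | lra]. }
      nra.
  - intros th th' v v' i s Hs.
    assert (K := slow_dependence (fun i s v => drift i (s, th, v)) (fun i s v => drift i (s, th', v))
      M P eps (Rabs (th - th')) (Y (th, v)) (Y (th', v')) P_ge_0 PM (Rabs_pos _) Hsmall).
    assert (K' := fun h => K h (YD th v) (YD th' v') i s Hs). clear K.
    rewrite !Y0 in K'.
    replace (Y (th, v) s i - v i - (Y (th', v') s i - v' i)) with
      (Y (th, v) s i - Y (th', v') s i - (v i - v' i)) by ring.
    eapply Rle_trans; [apply K' |].
    + intros j t u u' Ht. eapply Rle_trans; [apply HL |]. apply Rmult_le_compat_l; auto.
      unfold dist_pt; simpl. rewrite Rminus_diag, Rabs_R0. lra.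
    + assert (ED : dist3 (Y (th, v) 0) (Y (th', v') 0) = dist3 v v') by (unfold dist3; now rewrite !Y0).
      rewrite ED. assert (D0 := dist3_pos v v'). assert (T0 := Rabs_pos (th - th')).
      replace (Rabs eps * M * P * (2 * Rabs (th - th') + 2 * dist3 v v')) with
        (2 * M * P * Rabs eps * (Rabs (th - th') + dist3 v v')) by ring.
      apply Rmult_le_compat_r; [lra |]. nra.
  - intros th v i s Hs.
    (* The two drifts coincide, so the dependence estimate with [del = 0] and equal initial values
       is a uniqueness statement. *)
    assert (K := slow_dependence (fun i s v => drift i (s, th + 2 * PI, v)) (fun i s v => drift i (s, th, v))
      M P eps 0 (Y (th + 2 * PI, v)) (Y (th, v)) P_ge_0 PM (Rle_refl 0) Hsmall).
    assert (K' := fun h => K h (YD (th + 2 * PI) v) (YD th v) i s Hs). clear K.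
    rewrite !Y0 in K'.
    assert (ED : dist3 (Y (th + 2 * PI, v) 0) (Y (th, v) 0) = 0).
    { unfold dist3; now rewrite !Y0, !Rminus_diag, Rabs_R0, !Rplus_0_l. }
    rewrite ED in K'. rewrite Rmult_0_r, Rplus_0_r, Rmult_0_r, Rminus_diag, Rminus_0_r in K'.
    apply Rminus_diag_uniq. apply (eq_0_of_geometric_bound _ 0). intro n. rewrite Rmult_0_l. apply K'.
    intros j t u u' Ht. rewrite drift_periodic. eapply Rle_trans; [apply HL |]. apply Rmult_le_compat_l; auto.
    unfold dist_pt; simpl. rewrite !Rminus_diag, Rabs_R0. lra.
Qed.

End Clamped.

(** * Shooting from pericentre to pericentre *)

(* A triple [(eps, r, th)]: the perturbation size and the position of the starting apsis. *)
Definition tri : Type := (R * R * R)%type.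
Definition dist_tri (x y : tri) : R :=
  Rabs (fst (fst x) - fst (fst y)) + Rabs (snd (fst x) - snd (fst y)) + Rabs (snd x - snd y).

Lemma dist_tri_ge_0 x y : 0 <= dist_tri x y.
Proof. unfold dist_tri. abs_lra. Qed.

Notation BLt := (BL tri dist_tri).

Lemma Lips_tri_1 : Lips tri dist_tri (fun x => fst (fst x)).
Proof. exists 1. split; [lra |]. intros x y. unfold dist_tri. abs_lra. Qed.

Lemma Lips_tri_2 : Lips tri dist_tri (fun x => snd (fst x)).
Proof. exists 1. split; [lra |]. intros x y. unfold dist_tri. abs_lra. Qed.

Lemma Lips_tri_3 : Lips tri dist_tri (fun x => snd x).
Proof. exists 1. split; [lra |]. intros x y. unfold dist_tri. abs_lra. Qed.

Definition vec3 (a b c : R) : nat -> R :=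
  fun i => match i with O => a | 1%nat => b | 2%nat => c | _ => 0 end.

Lemma dist3_vec3 a b c a' b' c' :
  dist3 (vec3 a b c) (vec3 a' b' c') = Rabs (a - a') + Rabs (b - b') + Rabs (c - c').
Proof. reflexivity. Qed.

Section Shooting.

Variables kap lam H : R.
Variable U : R -> R -> R.
Variable k : nat.
Hypothesis kap_pos : 0 < kap.
Hypothesis lam_pos : 0 < lam.
Hypothesis H_neg : H < 0.
Hypothesis U_C2 : Ck 2 U.
Hypothesis k_ge_2 : (2 <= k)%nat.

(** Half of [ell2], that is [L^2 / 2 - lam], as given by the energy relation at a point where
    [p = 0]. Then [Ainit] comes from [ell2 = r (kap + A)], and [winit] from
    [w^2 = q / (q + lam)]. *)
Definition qinit (eps r th : R) : R :=
  H * r ^ 2 + kap * r + eps * (r ^ 2 * polar U r th).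
Definition Ainit (eps r th : R) : R :=
  2 * H * r + kap + 2 * eps * (r * polar U r th).
Definition winit (eps r th : R) : R :=
  sqrt (1 - lam / (qinit eps r th + lam)).

Lemma winit_sqr eps r th :
  0 < qinit eps r th ->
  let w := winit eps r th in
  0 < w < 1 /\ w ^ 2 = qinit eps r th / (qinit eps r th + lam).
Proof.
  intros Hq. unfold winit. set (q := qinit eps r th) in *.
  assert (E : 1 - lam / (q + lam) = q / (q + lam)) by (field; lra). rewrite E.
  assert (H1 : 0 < q / (q + lam)) by (apply Rdiv_lt_0_compat; lra).
  assert (H2 : q / (q + lam) < 1).
  { apply Rmult_lt_reg_r with (q + lam); [lra |]. unfold Rdiv. rewrite Rmult_assoc, Rinv_l; lra. }
  cbv zeta. split; [split |].
  - now apply sqrt_lt_R0.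
  - rewrite <- sqrt_1. apply sqrt_lt_1; lra.
  - apply pow2_sqrt. lra.
Qed.

Lemma mech_energy_init eps r th :
  0 < r -> 0 < qinit eps r th ->
  let A := Ainit eps r th in let w := winit eps r th in
  mech_energy kap lam eps U (radius kap lam A 0 w) (radmom lam A 0 w) (angmom lam w) th = H.
Proof.
  intros Hr Hq A w.
  destruct (winit_sqr eps r th Hq) as [Hw E]. fold w in Hw, E.
  set (q := qinit eps r th) in *.
  assert (EA : kap + A = 2 * q / r) by (unfold A, q, Ainit, qinit; field; lra).
  assert (PA : 0 < kap + A) by (rewrite EA; apply Rdiv_lt_0_compat; lra).
  assert (Eell : ell2 lam w = 2 * q) by (unfold ell2; rewrite E; field; lra).
  assert (Erad : radius kap lam A 0 w = r).
  { unfold radius. rewrite cos_0, Rmult_1_r, EA, Eell. field. lra. }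
  rewrite mech_energy_elements; auto.
  2: { rewrite cos_0. lra. }
  rewrite Erad, Eell.
  replace (A ^ 2 - kap ^ 2) with ((kap + A) * (A - kap)) by ring. rewrite EA.
  unfold A, Ainit. field. lra.
Qed.

(** One radial oscillation in [k] turns; [qstar] is the value of [q] for which
    [q / (q + lam) = wstar ^ 2]. *)
Definition wstar : R := / INR k.
Definition qstar : R := lam / (INR k ^ 2 - 1).
Hypothesis noncircular : 0 < kap ^ 2 + 4 * H * qstar.
(** The unperturbed [A], from the energy relation [A^2 - kap^2 = 2 H ell2] with [ell2 = 2 qstar].
    Accordingly [rstar] is the smaller root of [H r^2 + kap r = qstar], the pericentre. *)
Definition Dstar : R := sqrt (kap ^ 2 + 4 * H * qstar).
Definition rstar : R := (kap - Dstar) / (- 2 * H).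
Definition turn : R := 2 * PI * INR k.
Definition vstar : nat -> R := vec3 Dstar 0 wstar.

Lemma INR_k_ge_2 : 2 <= INR k.
Proof. apply (le_INR 2). auto. Qed.

Lemma wstar_bounds : 0 < wstar < 1.
Proof.
  assert (K := INR_k_ge_2). unfold wstar. split; [apply Rinv_0_lt_compat; lra |].
  rewrite <- Rinv_1. apply Rinv_lt_contravar; lra.
Qed.

Lemma qstar_pos : 0 < qstar.
Proof. assert (K := INR_k_ge_2). unfold qstar. apply Rdiv_lt_0_compat; nra. Qed.

Lemma Dstar_sqr : Dstar ^ 2 = kap ^ 2 + 4 * H * qstar.
Proof. unfold Dstar. apply pow2_sqrt. lra. Qed.

Lemma Dstar_bounds : 0 < Dstar < kap.
Proof.
  assert (Q := qstar_pos). assert (E := Dstar_sqr).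
  assert (0 < Dstar) by (unfold Dstar; now apply sqrt_lt_R0). split; nra.
Qed.

Lemma rstar_pos : 0 < rstar.
Proof. assert (B := Dstar_bounds). unfold rstar. apply Rdiv_lt_0_compat; lra. Qed.

Lemma rstar_slope : 2 * H * rstar + kap = Dstar.
Proof. unfold rstar. field. lra. Qed.

Lemma qinit_star th : qinit 0 rstar th = qstar.
Proof.
  assert (E := Dstar_sqr). unfold qinit, rstar. rewrite Rmult_0_l, Rplus_0_r.
  replace (H * ((kap - Dstar) / (-2 * H)) ^ 2 + kap * ((kap - Dstar) / (-2 * H)))
    with ((Dstar ^ 2 - kap ^ 2) / (4 * H)) by (field; lra).
  rewrite E. field. lra.
Qed.

Lemma winit_star th : winit 0 rstar th = wstar.
Proof.
  assert (K := INR_k_ge_2). unfold winit. rewrite qinit_star. unfold qstar, wstar.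
  replace (1 - lam / (lam / (INR k ^ 2 - 1) + lam)) with ((/ INR k) ^ 2).
  2: { assert (0 < INR k ^ 2 - 1) by nra. field. repeat split; nra. }
  apply sqrt_pow2. left. apply Rinv_0_lt_compat. lra.
Qed.

Lemma Ainit_star th : Ainit 0 rstar th = Dstar.
Proof. unfold Ainit. rewrite <- rstar_slope. ring. Qed.

Lemma turn_pos : 0 < turn.
Proof. assert (K := INR_k_ge_2). assert (P := PI_RGT_0). unfold turn. nra. Qed.

Lemma turn_wstar : turn * wstar = 2 * PI.
Proof. assert (K := INR_k_ge_2). unfold turn, wstar. field. lra. Qed.

(** The derivative of [H r^2 + kap r] at [rstar] is [Dstar]: positivity of the eccentricity makes
    [q], and with it [w], strictly increasing in the pericentre radius. Clamping [eps] and [r] gives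
    access to the calculus of bounded Lipschitz functions. *)
Lemma initial_elements : exists del e1 M c, 0 < del < rstar /\ 0 < e1 /\ 0 <= M /\ 0 < c /\
  (forall eps r th, Rabs eps <= e1 -> Rabs (r - rstar) <= del -> 0 < qinit eps r th) /\
  (forall eps r th eps' r' th', Rabs eps <= e1 -> Rabs (r - rstar) <= del ->
     Rabs eps' <= e1 -> Rabs (r' - rstar) <= del ->
     Rabs (Ainit eps r th - Ainit eps' r' th') <=
       M * (Rabs (eps - eps') + Rabs (r - r') + Rabs (th - th')) /\
     Rabs (winit eps r th - winit eps' r' th') <=
       M * (Rabs (eps - eps') + Rabs (r - r') + Rabs (th - th'))) /\
  (forall eps r r' th, Rabs eps <= e1 -> Rabs (r - rstar) <= del -> Rabs (r' - rstar) <= del -> r' <= r ->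
     c * (r - r') <= winit eps r th - winit eps r' th).
Proof.
  assert (Rp := rstar_pos). assert (Dp := Dstar_bounds). assert (Qp := qstar_pos).
  assert (Rs := rstar_slope). assert (Q0 := qinit_star).
  (* The three bounds keep [r] between [rstar / 2] and [2 * rstar], the slope [H * (r + r') + kap]
     above [Dstar / 2], and the unperturbed [q] within [qstar / 4] of [qstar]. *)
  set (del := Rmin (rstar / 2) (Rmin (Dstar / (- 4 * H)) (qstar / (4 * kap)))).
  assert (D1 : del <= rstar / 2) by apply Rmin_l.
  assert (D2 : del <= Dstar / (- 4 * H)).
  { eapply Rle_trans; [apply Rmin_r | apply Rmin_l]. }
  assert (D3 : del <= qstar / (4 * kap)).
  { eapply Rle_trans; [apply Rmin_r | apply Rmin_r]. }
  assert (D0 : 0 < del).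
  { unfold del. repeat apply Rmin_pos; try apply Rdiv_lt_0_compat; lra. }
  assert (D2' : del * (- 4 * H) <= Dstar).
  { apply Rle_div_r in D2; [| lra]. auto. }
  assert (D3' : del * (4 * kap) <= qstar).
  { apply Rle_div_r in D3; [| lra]. auto. }
  clearbody del. clear D2 D3.
  destruct (bounded_on_square U (2 * rstar) (proj1 U_C2)) as [B [PB HB]].
  assert (HW : forall r th, Rabs r <= 2 * rstar -> Rabs (polar U r th) <= B).
  { intros r th Hr. unfold polar. apply HB; rewrite Rabs_mult;
    rewrite <- (Rmult_1_r (2 * rstar)); (apply Rmult_le_compat; auto; try apply Rabs_pos);
    apply Rabs_le; [apply COS_bound | apply SIN_bound]. }
  (* Leaves the perturbation at most another [qstar / 4], so that [q >= qstar / 2]. *)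
  set (e0 := qstar / (4 * ((2 * rstar) ^ 2 * B + 1))).
  assert (PB2 : 0 <= (2 * rstar) ^ 2 * B) by (apply Rmult_le_pos; [apply pow2_ge_0 | auto]).
  assert (E0 : 0 < e0) by (apply Rdiv_lt_0_compat; lra).
  assert (E1 : e0 * ((2 * rstar) ^ 2 * B) <= qstar / 4).
  { assert (E : e0 * (4 * ((2 * rstar) ^ 2 * B + 1)) = qstar) by (unfold e0; field; lra).
    clearbody e0. set (X := (2 * rstar) ^ 2 * B) in *. lra. }
  set (te := fun x : tri => clamp (- e0) e0 (fst (fst x))).
  set (tr := fun x : tri => clamp (rstar - del) (rstar + del) (snd (fst x))).
  assert (Bte : forall x, - e0 <= te x <= e0) by (intro; apply clamp_bounds; lra).
  assert (Btr : forall x, rstar - del <= tr x <= rstar + del) by (intro; apply clamp_bounds; lra).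
  assert (BLe : BLt te) by (apply (BL_clamp tri dist_tri); [lra | apply Lips_tri_1]).
  assert (BLr : BLt tr) by (apply (BL_clamp tri dist_tri); [lra | apply Lips_tri_2]).
  assert (BLW : BLt (fun x => polar U (tr x) (snd x))).
  { unfold polar.
    apply (BL_comp2 tri dist_tri U (fun x => tr x * cos (snd x)) (fun x => tr x * sin (snd x))).
    - now apply Ck_le.
    - apply BL_mult; [apply dist_tri_ge_0 | auto | apply BL_cos, Lips_tri_3].
    - apply BL_mult; [apply dist_tri_ge_0 | auto | apply BL_sin, Lips_tri_3]. }
  assert (BLr2W : BLt (fun x => tr x ^ 2 * polar U (tr x) (snd x))).
  { apply BL_mult; [apply dist_tri_ge_0 | apply BL_pow; [apply dist_tri_ge_0 | auto] | auto]. }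
  assert (BLq : BLt (fun x => qinit (te x) (tr x) (snd x))).
  { unfold qinit. repeat (apply BL_plus || (apply BL_mult; [apply dist_tri_ge_0 | |]) || apply BL_const
      || (apply BL_pow; [apply dist_tri_ge_0 |]) || assumption). }
  assert (BLA : BLt (fun x => Ainit (te x) (tr x) (snd x))).
  { unfold Ainit. repeat (apply BL_plus || (apply BL_mult; [apply dist_tri_ge_0 | |]) || apply BL_const
      || assumption). }
  assert (Hq : forall eps r th, Rabs eps <= e0 -> Rabs (r - rstar) <= del -> qstar / 2 <= qinit eps r th).
  { intros eps r th He Hr.
    assert (Hr' := proj1 (Rabs_le_between _ _) Hr).
    assert (R2 : 0 <= r ^ 2 <= (2 * rstar) ^ 2) by (split; [apply pow2_ge_0 | apply pow_incr; lra]).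
    assert (T1 : Rabs (eps * (r ^ 2 * polar U r th)) <= qstar / 4).
    { rewrite !Rabs_mult, (Rabs_right (r ^ 2)) by lra.
      apply Rle_trans with (e0 * ((2 * rstar) ^ 2 * B)); auto.
      apply Rmult_le_compat; auto; [apply Rabs_pos | apply Rmult_le_pos; [lra | apply Rabs_pos] |].
      apply Rmult_le_compat; [lra | apply Rabs_pos | lra |].
      apply HW. rewrite Rabs_right; lra. }
    apply Rabs_le_between in T1. unfold qinit.
    assert (T2 : H * r ^ 2 + kap * r - qstar = (r - rstar) * (H * (r + rstar) + kap)).
    { rewrite <- (Q0 0). unfold qinit. ring. }
    assert (T3 : 0 <= H * (r + rstar) + kap <= kap).
    { assert (r + rstar > 0) by lra. split; nra. }
    assert (T4 : Rabs ((r - rstar) * (H * (r + rstar) + kap)) <= del * kap).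
    { rewrite Rabs_mult. apply Rmult_le_compat; auto; try apply Rabs_pos.
      rewrite Rabs_right; lra. }
    apply Rabs_le_between in T4. lra. }
  assert (BLw : BLt (fun x => winit (te x) (tr x) (snd x))).
  { unfold winit.
    assert (Hq' : forall x, qstar / 2 <= qinit (te x) (tr x) (snd x)).
    { intro x. specialize (Bte x). specialize (Btr x). apply Hq; apply Rabs_le; lra. }
    apply BL_sqrt with (1 - lam / (qstar / 2 + lam)).
    - replace (1 - lam / (qstar / 2 + lam)) with ((qstar / 2) / (qstar / 2 + lam)) by (field; lra).
      apply Rdiv_lt_0_compat; lra.
    - intro x. specialize (Hq' x).
      assert (/ (qinit (te x) (tr x) (snd x) + lam) <= / (qstar / 2 + lam)) by (apply Rinv_le_contravar; lra).
      unfold Rdiv. nra.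
    - apply BL_minus; [apply BL_const |].
      apply BL_div with (qstar / 2 + lam); [apply dist_tri_ge_0 | lra | | apply BL_const |].
      + intro x. specialize (Hq' x). lra.
      + apply BL_plus; [auto | apply BL_const]. }
  destruct BLA as [[MA [PA HA]] _]. destruct BLw as [[Mw [Pw Hw]] _].
  destruct BLq as [_ [Qm [PQ HQ]]]. destruct BLr2W as [[M2 [P2 H2]] _].
  assert (Cte : forall eps r th, Rabs eps <= e0 -> te (eps, r, th) = eps).
  { intros eps r th He. unfold te; simpl. apply clamp_id. now apply Rabs_le_between. }
  assert (Ctr : forall eps r th, Rabs (r - rstar) <= del -> tr (eps, r, th) = r).
  { intros eps r th Hr. unfold tr; simpl. apply clamp_id. apply Rabs_le_between in Hr. lra. }
  (* Now the perturbation changes the slope of [q] by at most [Dstar / 4], out of the [Dstar / 2]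
     available. *)
  set (e1 := Rmin e0 (Dstar / (4 * (M2 + 1)))).
  assert (Ee : e1 <= e0) by apply Rmin_l.
  assert (E4 : e1 * M2 <= Dstar / 4).
  { assert (e1 <= Dstar / (4 * (M2 + 1))) by apply Rmin_r.
    assert (0 < Dstar / (4 * (M2 + 1))) by (apply Rdiv_lt_0_compat; lra).
    assert (Dstar / (4 * (M2 + 1)) * (M2 + 1) = Dstar / 4) by (field; lra). nra. }
  (* The last constant comes from [(w - w') * (w + w') = lam * (q - q') / ((q + lam) * (q' + lam))],
     with [q] at most [Qm] and [w + w'] at most 2. *)
  exists del, e1, (MA + Mw), (lam * (Dstar / 4) / (2 * (Qm + lam) ^ 2)).
  split; [lra |]. split; [unfold e1; apply Rmin_pos; auto; apply Rdiv_lt_0_compat; lra |].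
  split; [lra |]. split.
  { apply Rdiv_lt_0_compat; [nra |]. apply Rmult_lt_0_compat; [lra | apply pow_lt; lra]. }
  split; [| split].
  - intros eps r th He Hr. specialize (Hq eps r th ltac:(lra) Hr). lra.
  - intros eps r th eps' r' th' He Hr He' Hr'.
    specialize (HA (eps, r, th) (eps', r', th')). specialize (Hw (eps, r, th) (eps', r', th')).
    cbv beta in HA, Hw. rewrite !Cte, !Ctr in HA, Hw by (auto; lra). simpl in HA, Hw.
    unfold dist_tri in HA, Hw; simpl in HA, Hw.
    assert (T1 := Rabs_pos (eps - eps')). assert (T2 := Rabs_pos (r - r')). assert (T3 := Rabs_pos (th - th')).
    rewrite !(Rmult_plus_distr_r MA).
    assert (0 <= MA * (Rabs (eps - eps') + Rabs (r - r') + Rabs (th - th'))) by (apply Rmult_le_pos; lra).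
    assert (0 <= Mw * (Rabs (eps - eps') + Rabs (r - r') + Rabs (th - th'))) by (apply Rmult_le_pos; lra).
    split; lra.
  - intros eps r r' th He Hr Hr' Hle.
    assert (G1 := Hq eps r th ltac:(lra) Hr). assert (G2 := Hq eps r' th ltac:(lra) Hr').
    destruct (winit_sqr eps r th ltac:(lra)) as [W1 S1].
    destruct (winit_sqr eps r' th ltac:(lra)) as [W2 S2].
    assert (F1 := HQ (eps, r, th)). assert (F2 := HQ (eps, r', th)).
    specialize (H2 (eps, r, th) (eps, r', th)).
    cbv beta in H2, F1, F2.
    rewrite (Ctr eps r th Hr), (Ctr eps r' th Hr') in H2.
    rewrite (Cte eps r th ltac:(lra)), (Ctr eps r th Hr) in F1.
    rewrite (Cte eps r' th ltac:(lra)), (Ctr eps r' th Hr') in F2. simpl snd in H2, F1, F2.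
    unfold dist_tri in H2; simpl fst in H2; simpl snd in H2.
    rewrite !Rminus_diag, Rabs_R0, Rplus_0_r, Rplus_0_l, (Rabs_right (r - r')) in H2 by lra.
    set (w := winit eps r th) in *. set (w' := winit eps r' th) in *.
    assert (Eq : qinit eps r th - qinit eps r' th =
      (r - r') * (H * (r + r') + kap) + eps * (r ^ 2 * polar U r th - r' ^ 2 * polar U r' th)) by (unfold qinit; ring).
    set (q := qinit eps r th) in *. set (q' := qinit eps r' th) in *.
    assert (Hdq : Dstar / 4 * (r - r') <= q - q').
    { rewrite Eq. apply Rabs_le_between in Hr. apply Rabs_le_between in Hr'.
      assert (Dstar / 2 <= H * (r + r') + kap) by nra.
      assert (T : Rabs (eps * (r ^ 2 * polar U r th - r' ^ 2 * polar U r' th)) <= Dstar / 4 * (r - r')).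
      { rewrite Rabs_mult. apply Rle_trans with (e1 * (M2 * (r - r'))).
        - apply Rmult_le_compat; auto; apply Rabs_pos.
        - nra. }
      apply Rabs_le_between in T. nra. }
    apply Rabs_le_between in F1. apply Rabs_le_between in F2.
    assert (Ew : (w - w') * (w + w') = lam * (q - q') / ((q + lam) * (q' + lam))).
    { replace ((w - w') * (w + w')) with (w ^ 2 - w' ^ 2) by ring. rewrite S1, S2. field. lra. }
    assert (Hlow : lam * (Dstar / 4 * (r - r')) / (Qm + lam) ^ 2 <= (w - w') * (w + w')).
    { rewrite Ew. unfold Rdiv at 1 3. apply Rmult_le_compat.
      - apply Rmult_le_pos; [lra |]. apply Rmult_le_pos; lra.
      - left. apply Rinv_0_lt_compat. apply pow_lt. lra.
      - apply Rmult_le_compat_l; lra.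
      - apply Rinv_le_contravar; [nra |]. simpl. rewrite Rmult_1_r. apply Rmult_le_compat; lra. }
    replace (lam * (Dstar / 4) / (2 * (Qm + lam) ^ 2) * (r - r')) with
      (lam * (Dstar / 4 * (r - r')) / (Qm + lam) ^ 2 / 2) by (field; lra).
    assert (0 <= lam * (Dstar / 4 * (r - r')) / (Qm + lam) ^ 2).
    { apply Rdiv_le_0_compat; [apply Rmult_le_pos; [lra |]; apply Rmult_le_pos; lra | apply pow_lt; lra]. }
    assert (0 <= w - w') by nra. nra.
Qed.

(** The phase gained over [k] turns is [turn * winit eps r th] up to an error that is [O(eps)] and
    Lipschitz with constant [O(eps)]. So it is strictly increasing in [r] and takes the value [2 PI]
    near [rstar]; a slope of at least [c1] also makes the root Lipschitz in [th]. *)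
Lemma orbit_family : exists C e0, 0 < C /\ 0 < e0 /\ forall eps, Rabs eps <= e0 ->
  exists Z : R -> R -> nat -> R,
    (forall th i s, 0 <= s <= turn -> is_derive (fun t => Z th t i) s
        (eps * drift kap lam Dstar wstar turn U i (s, th, Z th s))) /\
    (forall th s i, 0 <= s <= turn -> Rabs (Z th s i - vstar i) <= C * Rabs eps) /\
    (forall th, Z th 0 1%nat = 0 /\ turn * Z th turn 2%nat + Z th turn 1%nat = 2 * PI /\
       mech_energy kap lam eps U (radius kap lam (Z th 0 0%nat) 0 (Z th 0 2%nat))
         (radmom lam (Z th 0 0%nat) 0 (Z th 0 2%nat)) (angmom lam (Z th 0 2%nat)) th = H) /\
    (forall th th' s i, 0 <= s <= turn -> Rabs (Z th s i - Z th' s i) <= C * Rabs (th - th')) /\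
    (forall th s i, 0 <= s <= turn -> Z (th + 2 * PI) s i = Z th s i).
Proof.
  assert (Tp := turn_pos). assert (Tw := turn_wstar).
  destruct initial_elements as [del [e1 [M [c [Hdel [He1 [PM [Pc [Hq [HL Hslope]]]]]]]]]].
  destruct (slow_flow kap lam Dstar wstar turn U lam_pos Dstar_bounds wstar_bounds ltac:(lra) U_C2)
    as [C [e2 [PC [He2 Hflow]]]].
  (* [K1] bounds the phase error at [rstar] and [K2] the Lipschitz constant of the deviation from
     [turn * winit], both per unit of [Rabs eps]; [c1] is half the slope [turn * c], and [K3] the
     Lipschitz constant of the root. *)
  set (K1 := turn * M + (turn + 1) * C).
  set (K2 := (turn + 1) * C * (1 + 2 * M)).
  assert (PK1 : 0 < K1) by (unfold K1; nra).
  assert (PK2 : 0 < K2) by (unfold K2; repeat apply Rmult_lt_0_compat; lra).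
  set (c1 := turn * c / 2). assert (Pc1 : 0 < c1) by (unfold c1; nra).
  set (K3 := (turn * M + K2) / c1). assert (PK3 : 0 < K3) by (apply Rdiv_lt_0_compat; nra).
  (* [c1 / K2] lets the perturbation consume at most half of the slope; [c1 * del / K1] keeps the
     phase error at [rstar] small enough for a zero within [del]. *)
  set (e0 := Rmin 1 (Rmin e1 (Rmin e2 (Rmin (c1 / K2) (c1 * del / K1))))).
  exists (C * (1 + 2 * (M * (K3 + 1))) + M * (K3 + 1) + M * (K1 / c1 + 1) + C), e0.
  assert (PMK : 0 <= M * (K3 + 1)) by (apply Rmult_le_pos; lra).
  assert (PKc : 0 < K1 / c1) by (now apply Rdiv_lt_0_compat).
  assert (PMK' : 0 <= M * (K1 / c1 + 1)) by (apply Rmult_le_pos; lra).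
  split; [nra |]. split.
  { unfold e0. repeat apply Rmin_pos; try lra; repeat apply Rdiv_lt_0_compat; try lra; try (apply Rmult_lt_0_compat; lra). }
  intros eps Heps.
  destruct (Rmin_le _ _ _ Heps) as [L0 L1']. destruct (Rmin_le _ _ _ L1') as [L1 L2'].
  destruct (Rmin_le _ _ _ L2') as [L2 L3']. destruct (Rmin_le _ _ _ L3') as [L3 L4].
  clear L1' L2' L3'.
  clear Heps. clearbody e0.
  assert (PE := Rabs_pos eps).
  assert (L3' : Rabs eps * K2 <= c1).
  { apply Rle_div_r in L3; [| lra]. auto. }
  assert (L4' : Rabs eps * K1 <= c1 * del).
  { apply Rle_div_r in L4; [| lra]. auto. }
  destruct (Hflow eps L2) as [Y [Y0 [YD [Yclose [YL Yper]]]]].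
  set (v := fun r th => vec3 (Ainit eps r th) 0 (winit eps r th)).
  set (f := fun th r => turn * Y th (v r th) turn 2%nat + Y th (v r th) turn 1%nat - 2 * PI).
  assert (Hdiff : forall r r' th th', Rabs (r - rstar) <= del -> Rabs (r' - rstar) <= del ->
     dist3 (v r th) (v r' th') <= 2 * M * (Rabs (r - r') + Rabs (th - th'))).
  { intros r r' th th' Hr Hr'. unfold v. rewrite dist3_vec3.
    destruct (HL eps r th eps r' th' L1 Hr L1 Hr') as [A1 A2].
    rewrite Rminus_diag, Rabs_R0 in *. lra. }
  assert (Hf : forall r r' th th', Rabs (r - rstar) <= del -> Rabs (r' - rstar) <= del ->
     Rabs ((f th r - f th' r') - turn * (winit eps r th - winit eps r' th'))
      <= Rabs eps * K2 * (Rabs (r - r') + Rabs (th - th'))).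
  { intros r r' th th' Hr Hr'. unfold f.
    assert (B1 := YL th th' (v r th) (v r' th') 1%nat turn ltac:(lra)).
    assert (B2 := YL th th' (v r th) (v r' th') 2%nat turn ltac:(lra)).
    assert (B3 := Hdiff r r' th th' Hr Hr').
    replace (v r th 1%nat) with 0 in B1 by reflexivity.
    replace (v r' th' 1%nat) with 0 in B1 by reflexivity.
    replace (v r th 2%nat) with (winit eps r th) in B2 by reflexivity.
    replace (v r' th' 2%nat) with (winit eps r' th') in B2 by reflexivity.
    assert (Q1 := Rabs_pos (r - r')). assert (Q2 := Rabs_pos (th - th')).
    set (x1 := Y th (v r th) turn 1%nat) in *. set (x2 := Y th' (v r' th') turn 1%nat) in *.
    set (z1 := Y th (v r th) turn 2%nat) in *. set (z2 := Y th' (v r' th') turn 2%nat) in *.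
    set (w1 := winit eps r th) in *. set (w2 := winit eps r' th') in *.
    set (d3 := dist3 (v r th) (v r' th')) in *.
    replace (turn * z1 + x1 - 2 * PI - (turn * z2 + x2 - 2 * PI) - turn * (w1 - w2)) with
      (turn * (z1 - w1 - (z2 - w2)) + (x1 - 0 - (x2 - 0))) by ring.
    triangle. rewrite Rabs_mult, (Rabs_right turn) by lra.
    apply Rle_trans with ((turn + 1) * (C * Rabs eps * (Rabs (th - th') + d3))).
    - apply Rmult_le_compat_l with (r := turn) in B2; [| lra]. lra.
    - unfold K2. replace (Rabs eps * ((turn + 1) * C * (1 + 2 * M)) * (Rabs (r - r') + Rabs (th - th')))
        with ((turn + 1) * (C * Rabs eps * ((1 + 2 * M) * (Rabs (r - r') + Rabs (th - th'))))) by ring.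
      apply Rmult_le_compat_l; [lra |]. apply Rmult_le_compat_l; [nra |].
      rewrite Rmult_plus_distr_r. lra. }
  assert (Hmono : forall th r r', Rabs (r - rstar) <= del -> Rabs (r' - rstar) <= del -> r' <= r ->
     c1 * (r - r') <= f th r - f th r').
  { intros th r r' Hr Hr' Hle. assert (B := Hf r r' th th Hr Hr').
    assert (S := Hslope eps r r' th L1 Hr Hr' Hle).
    rewrite Rminus_diag, Rabs_R0, Rplus_0_r, (Rabs_right (r - r')) in B by lra.
    apply Rabs_le_between in B.
    assert (Rabs eps * K2 * (r - r') <= c1 * (r - r')) by (apply Rmult_le_compat_r; lra).
    assert (T := Rmult_le_compat_l turn _ _ ltac:(lra) S).
    replace (turn * (c * (r - r'))) with (2 * (c1 * (r - r'))) in T by (unfold c1; field). lra. }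
  assert (Hlow : forall th r r', Rabs (r - rstar) <= del -> Rabs (r' - rstar) <= del ->
     c1 * Rabs (r - r') <= Rabs (f th r - f th r')).
  { intros th r r' Hr Hr'. destruct (Rle_dec r' r) as [L | L].
    - rewrite (Rabs_right (r - r')) by lra. eapply Rle_trans; [now apply Hmono | apply Rle_abs].
    - rewrite (Rabs_minus_sym r), (Rabs_minus_sym (f th r)), (Rabs_right (r' - r)) by lra.
      eapply Rle_trans; [apply Hmono; auto; lra | apply Rle_abs]. }
  assert (Hstar : forall th, Rabs (f th rstar) <= Rabs eps * K1).
  { intro th. assert (Z0 : Rabs (rstar - rstar) <= del) by (rewrite Rminus_diag, Rabs_R0; lra).
    assert (B1 := Yclose th (v rstar th) 1%nat turn ltac:(lra)).
    assert (B2 := Yclose th (v rstar th) 2%nat turn ltac:(lra)).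
    replace (v rstar th 1%nat) with 0 in B1 by reflexivity.
    replace (v rstar th 2%nat) with (winit eps rstar th) in B2 by reflexivity.
    destruct (HL eps rstar th 0 rstar th L1 Z0 ltac:(rewrite Rabs_R0; lra) Z0) as [_ B3].
    rewrite winit_star, !Rminus_diag, Rabs_R0, !Rplus_0_r, Rminus_0_r in B3.
    unfold f. rewrite <- Tw.
    set (x1 := Y th (v rstar th) turn 1%nat) in *. set (z1 := Y th (v rstar th) turn 2%nat) in *.
    set (w1 := winit eps rstar th) in *.
    replace (turn * z1 + x1 - turn * wstar) with (turn * (z1 - w1) + (x1 - 0) + turn * (w1 - wstar)) by ring.
    triangle.
    assert (T := Rabs_triang (turn * (z1 - w1)) (x1 - 0)).
    rewrite Rabs_mult, (Rabs_right turn) in T by lra.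
    rewrite (Rabs_mult turn (w1 - wstar)), (Rabs_right turn) by lra.
    apply Rmult_le_compat_l with (r := turn) in B2; [| lra].
    apply Rmult_le_compat_l with (r := turn) in B3; [| lra].
    unfold K1. lra. }
  assert (Hroot : forall th, exists r, Rabs (r - rstar) <= del /\ f th r = 0).
  (* The intermediate value theorem is applied to a function continuous on the whole line, obtained
     by clamping the radius. *)
  { intro th. set (cl := clamp (rstar - del) (rstar + del)).
    assert (Hcl : forall x, Rabs (cl x - rstar) <= del).
    { intro x. assert (B := clamp_bounds (rstar - del) (rstar + del) x ltac:(lra)). fold cl in B.
      apply Rabs_le. lra. }
    assert (Hcont : forall x, continuous (fun x => f th (cl x)) x).
    { apply lipschitz_continuous with (turn * M + Rabs eps * K2). intros a b.
      assert (B := Hf (cl a) (cl b) th th (Hcl a) (Hcl b)).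
      destruct (HL eps (cl a) th eps (cl b) th L1 (Hcl a) L1 (Hcl b)) as [_ B3].
      rewrite !Rminus_diag, Rabs_R0, !Rplus_0_r in *. rewrite Rplus_0_l in B3.
      set (wd := winit eps (cl a) th - winit eps (cl b) th) in *.
      replace (f th (cl a) - f th (cl b)) with ((f th (cl a) - f th (cl b) - turn * wd) + turn * wd) by ring.
      triangle. rewrite (Rabs_mult turn), (Rabs_right turn) by lra.
      assert (Hab : Rabs (cl a - cl b) <= 1 * Rabs (a - b)) by apply clamp_lipschitz.
      apply Rmult_le_compat_l with (r := turn) in B3; [| lra].
      assert (Rabs eps * K2 * Rabs (cl a - cl b) <= Rabs eps * K2 * Rabs (a - b)).
      { apply Rmult_le_compat_l; [nra | lra]. }
      assert (turn * (M * Rabs (cl a - cl b)) <= turn * (M * Rabs (a - b))).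
      { apply Rmult_le_compat_l; [lra |]. apply Rmult_le_compat_l; lra. }
      lra. }
    assert (Ea : cl (rstar - del) = rstar - del) by (apply clamp_id; lra).
    assert (Eb : cl (rstar + del) = rstar + del) by (apply clamp_id; lra).
    assert (S0 := Hstar th). apply Rabs_le_between in S0.
    assert (Hself : Rabs (rstar - rstar) <= del) by (rewrite Rminus_diag, Rabs_R0; lra).
    assert (S1 := Hmono th (rstar + del) rstar ltac:(apply Rabs_le; lra) Hself ltac:(lra)).
    assert (S2 := Hmono th rstar (rstar - del) Hself ltac:(apply Rabs_le; lra) ltac:(lra)).
    replace (rstar + del - rstar) with del in S1 by ring.
    replace (rstar - (rstar - del)) with del in S2 by ring.
    destruct (IVT_gen (fun x => f th (cl x)) (rstar - del) (rstar + del) 0) as [x [_ Hx]].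
    - intro x. apply continuity_pt_filterlim, Hcont.
    - rewrite Ea, Eb. rewrite Rmin_left, Rmax_right by lra. lra.
    - exists (cl x). split; auto. }
  destruct (functional_choice _ Hroot) as [rh Hrh].
  assert (Hrad : forall th, Rabs (rh th - rstar) <= K1 / c1 * Rabs eps).
  { intro th. destruct (Hrh th) as [A1 A2].
    assert (Hself : Rabs (rstar - rstar) <= del) by (rewrite Rminus_diag, Rabs_R0; lra).
    assert (S0 := Hstar th).
    apply Rmult_le_reg_l with c1; auto.
    replace (c1 * (K1 / c1 * Rabs eps)) with (Rabs eps * K1) by (field; lra).
    rewrite Rabs_minus_sym. assert (S := Hlow th rstar (rh th) Hself A1). rewrite A2, Rminus_0_r in S. lra. }
  assert (HrhL : forall th th', Rabs (rh th - rh th') <= K3 * Rabs (th - th')).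
  { intros th th'. destruct (Hrh th) as [A1 A2]. destruct (Hrh th') as [A1' A2'].
    assert (B := Hf (rh th') (rh th') th th' A1' A1').
    destruct (HL eps (rh th') th eps (rh th') th' L1 A1' L1 A1') as [_ B3].
    rewrite !Rminus_diag, Rabs_R0, !Rplus_0_l in *. rewrite A2', Rminus_0_r in B.
    set (wd := winit eps (rh th') th - winit eps (rh th') th') in *.
    assert (B4 : Rabs (f th (rh th')) <= (turn * M + K2) * Rabs (th - th')).
    { replace (f th (rh th')) with ((f th (rh th') - turn * wd) + turn * wd) by ring.
      triangle. rewrite (Rabs_mult turn), (Rabs_right turn) by lra.
      apply Rmult_le_compat_l with (r := turn) in B3; [| lra].
      assert (T := Rabs_pos (th - th')).
      assert (Rabs eps * K2 * Rabs (th - th') <= K2 * Rabs (th - th')) by (apply Rmult_le_compat_r; nra).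
      lra. }
    apply Rmult_le_reg_l with c1; auto. unfold K3.
    replace (c1 * ((turn * M + K2) / c1 * Rabs (th - th'))) with ((turn * M + K2) * Rabs (th - th')) by (field; lra).
    rewrite Rabs_minus_sym. assert (S := Hlow th (rh th') (rh th) A1' A1). rewrite A2, Rminus_0_r in S. lra. }
  assert (Hvper : forall r th, v r (th + 2 * PI) = v r th).
  { intros r th. unfold v, Ainit, winit, qinit. now rewrite polar_periodic. }
  (* The roots were chosen separately for each [th]; their periodicity follows from uniqueness. *)
  assert (Hrper : forall th, rh (th + 2 * PI) = rh th).
  { intro th. destruct (Hrh th) as [A1 A2]. destruct (Hrh (th + 2 * PI)) as [A1' A2'].
    unfold f in A2'. rewrite Hvper, !Yper in A2' by lra.
    change (f th (rh (th + 2 * PI)) = 0) in A2'.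
    assert (S := Hlow th _ _ A1' A1). rewrite A2, A2', Rminus_diag, Rabs_R0 in S.
    apply Rminus_diag_uniq, (eq_0_of_geometric_bound _ 0). intro n. nra. }
  exists (fun th s => Y th (v (rh th) th) s).
  split; [intros; now apply YD |].
  split; [| split; [| split]].
  - intros th s i Hs.
    assert (B := Yclose th (v (rh th) th) i s Hs).
    destruct (Hrh th) as [A1 _]. assert (A3 := Hrad th).
    assert (Z0 : Rabs (rstar - rstar) <= del) by (rewrite Rminus_diag, Rabs_R0; lra).
    destruct (HL eps (rh th) th 0 rstar th L1 A1 ltac:(rewrite Rabs_R0; lra) Z0) as [B2 B3].
    rewrite Ainit_star, Rminus_diag, Rabs_R0, Rplus_0_r, Rminus_0_r in B2.
    rewrite winit_star, Rminus_diag, Rabs_R0, Rplus_0_r, Rminus_0_r in B3.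
    assert (B4 : Rabs (v (rh th) th i - vstar i) <= M * (K1 / c1 + 1) * Rabs eps).
    { assert (T : M * (Rabs eps + Rabs (rh th - rstar)) <= M * (K1 / c1 + 1) * Rabs eps).
      { rewrite Rmult_assoc. apply Rmult_le_compat_l; lra. }
      assert (0 <= M * (K1 / c1 + 1) * Rabs eps) by (apply Rmult_le_pos; lra).
      destruct i as [|[|[|i]]]; unfold v, vstar; simpl; try rewrite Rminus_diag, Rabs_R0; lra. }
    set (vi := v (rh th) th i) in *.
    replace (Y th (v (rh th) th) s i - vstar i) with ((Y th (v (rh th) th) s i - vi) + (vi - vstar i)) by ring.
    triangle.
    assert (0 <= C * (1 + 2 * (M * (K3 + 1)))) by (apply Rmult_le_pos; lra).
    rewrite !Rmult_plus_distr_r. nra.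
  - intros th. destruct (Hrh th) as [A1 A2]. rewrite !Y0.
    split; [reflexivity |]. split; [unfold f in A2; lra |].
    apply (mech_energy_init eps (rh th) th).
    + apply Rabs_le_between in A1. lra.
    + apply Hq; auto.
  - intros th th' s i Hs.
    destruct (Hrh th) as [A1 _]. destruct (Hrh th') as [A1' _].
    assert (B := YL th th' (v (rh th) th) (v (rh th') th') i s Hs).
    destruct (HL eps (rh th) th eps (rh th') th' L1 A1 L1 A1') as [B2 B3].
    rewrite !Rminus_diag, Rabs_R0, !Rplus_0_l in *.
    assert (A3 := HrhL th th'). assert (T0 := Rabs_pos (th - th')).
    assert (T : M * (Rabs (rh th - rh th') + Rabs (th - th')) <= M * (K3 + 1) * Rabs (th - th')).
    { rewrite Rmult_assoc. apply Rmult_le_compat_l; lra. }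
    assert (T1 : 0 <= M * (K3 + 1) * Rabs (th - th')) by (apply Rmult_le_pos; lra).
    assert (B4 : Rabs (v (rh th) th i - v (rh th') th' i) <= M * (K3 + 1) * Rabs (th - th')).
    { destruct i as [|[|[|i]]]; unfold v; simpl; try rewrite Rminus_diag, Rabs_R0; lra. }
    assert (B5 : dist3 (v (rh th) th) (v (rh th') th') <= 2 * (M * (K3 + 1)) * Rabs (th - th')).
    { unfold v. rewrite dist3_vec3, Rminus_diag, Rabs_R0. lra. }
    set (d3 := dist3 (v (rh th) th) (v (rh th') th')) in *.
    assert (B6 : C * Rabs eps * (Rabs (th - th') + d3) <= C * ((1 + 2 * (M * (K3 + 1))) * Rabs (th - th'))).
    { rewrite Rmult_assoc. apply Rmult_le_compat_l; [lra |].
      assert (0 <= d3) by apply dist3_pos.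
      apply Rle_trans with (1 * (Rabs (th - th') + d3)); [apply Rmult_le_compat_r; lra | lra]. }
    set (vi := v (rh th) th i) in *. set (vi' := v (rh th') th' i) in *.
    replace (Y th (v (rh th) th) s i - Y th' (v (rh th') th') s i) with
      ((Y th (v (rh th) th) s i - vi - (Y th' (v (rh th') th') s i - vi')) + (vi - vi')) by ring.
    triangle.
    rewrite !Rmult_plus_distr_r. rewrite Rmult_assoc.
    assert (0 <= M * (K1 / c1 + 1) * Rabs (th - th')) by (apply Rmult_le_pos; lra).
    nra.
  - intros th s i Hs. rewrite Hrper, Hvper. now apply Yper.
Qed.

End Shooting.

(** * First variation of the action *)

(** The gradient of [polar] is Lipschitz for radii in [[a, b]], so the mean value estimate on the
    segment, after subtraction of the linear part, yields a quadratic remainder. *)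
Lemma polar_taylor (U : R -> R -> R) (a b : R) : a <= b -> Ck 2 U ->
  exists K, 0 <= K /\ forall r r' th th', a <= r <= b -> a <= r' <= b ->
  Rabs (polar U r' th' - polar U r th - (polar_r U r th * (r' - r) + polar_t U r th * (th' - th))) <=
  K * (Rabs (r' - r) + Rabs (th' - th)) ^ 2.
Proof.
  intros Hab HU. destruct (proj2 HU) as [_ [H2 H3]].
  set (tr := fun x : tri => clamp a b (snd (fst x))).
  assert (BLr : BLt tr) by (apply (BL_clamp tri dist_tri); [lra | apply Lips_tri_2]).
  assert (BLc : BLt (fun x => cos (snd x))) by apply BL_cos, Lips_tri_3.
  assert (BLs : BLt (fun x => sin (snd x))) by apply BL_sin, Lips_tri_3.
  assert (BLx : BLt (fun x => tr x * cos (snd x))) by (apply BL_mult; [apply dist_tri_ge_0 | auto | auto]).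
  assert (BLy : BLt (fun x => tr x * sin (snd x))) by (apply BL_mult; [apply dist_tri_ge_0 | auto | auto]).
  assert (B1 := BL_comp2 tri dist_tri (Defs.d1 U) _ _ H2 BLx BLy).
  assert (B2 := BL_comp2 tri dist_tri (Defs.d2 U) _ _ H3 BLx BLy).
  cbv beta in B1, B2.
  assert (Br : BLt (fun x => polar_r U (tr x) (snd x))).
  { unfold polar_r. repeat (apply BL_plus || (apply BL_mult; [apply dist_tri_ge_0 | |]) || assumption). }
  assert (Bt : BLt (fun x => polar_t U (tr x) (snd x))).
  { unfold polar_t. repeat (apply BL_plus || apply BL_opp || (apply BL_mult; [apply dist_tri_ge_0 | |]) || assumption). }
  destruct Br as [[Mr [Pr Kr]] _]. destruct Bt as [[Mt [Pt Kt]] _].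
  exists (Mr + Mt). split; [lra |]. intros r r' th th' Hr Hr'.
  set (dr := r' - r). set (dt := th' - th). set (n := Rabs dr + Rabs dt).
  assert (Pn : 0 <= n) by (unfold n; generalize (Rabs_pos dr) (Rabs_pos dt); lra).
  set (gr := polar_r U r th). set (gt := polar_t U r th).
  assert (B := derive_bound (fun t => polar U (r + t * dr) (th + t * dt) - t * (gr * dr + gt * dt))
    (fun t => (polar_r U (r + t * dr) (th + t * dt) * dr + polar_t U (r + t * dr) (th + t * dt) * dt)
       - (gr * dr + gt * dt)) 0 1 ((Mr + Mt) * n ^ 2) ltac:(lra)).
  replace (polar U r' th' - polar U r th - (gr * dr + gt * dt)) with
    (polar U (r + 1 * dr) (th + 1 * dt) - 1 * (gr * dr + gt * dt) -
      (polar U (r + 0 * dr) (th + 0 * dt) - 0 * (gr * dr + gt * dt))).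
  2: { unfold dr, dt. replace (r + 1 * (r' - r)) with r' by ring.
       replace (th + 1 * (th' - th)) with th' by ring.
       rewrite !Rmult_0_l, !Rplus_0_r. ring. }
  eapply Rle_trans; [apply B | lra]; clear B.
  - intros t Ht.
    apply (is_derive_minus (fun t => polar U (r + t * dr) (th + t * dt)) (fun t => t * (gr * dr + gt * dt))).
    + apply (is_derive_polar U (fun t => r + t * dr) (fun t => th + t * dt)).
      * now apply Ck_le.
      * auto_derive; auto; ring.
      * auto_derive; auto; ring.
    + auto_derive; auto; ring.
  - intros t Ht.
    assert (Hin : a <= r + t * dr <= b) by (unfold dr; nra).
    specialize (Kr (0, r + t * dr, th + t * dt) (0, r, th)).
    specialize (Kt (0, r + t * dr, th + t * dt) (0, r, th)).
    unfold tr, dist_tri in Kr, Kt; simpl in Kr, Kt.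
    rewrite (clamp_id a b r), (clamp_id a b (r + t * dr)), Rminus_diag, Rabs_R0, Rplus_0_l in Kr, Kt by auto.
    fold gr in Kr. fold gt in Kt.
    replace (r + t * dr - r) with (t * dr) in Kr, Kt by ring.
    replace (th + t * dt - th) with (t * dt) in Kr, Kt by ring.
    rewrite !Rabs_mult, (Rabs_right t) in Kr, Kt by lra.
    assert (Hn : t * Rabs dr + t * Rabs dt <= n) by (unfold n in *; nra).
    set (x := polar_r U (r + t * dr) (th + t * dt)) in *.
    set (y := polar_t U (r + t * dr) (th + t * dt)) in *.
    replace (x * dr + y * dt - (gr * dr + gt * dt)) with ((x - gr) * dr + (y - gt) * dt) by ring.
    triangle. rewrite !Rabs_mult.
    assert (X1 : Rabs (x - gr) <= Mr * n) by nra.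
    assert (X2 : Rabs (y - gt) <= Mt * n) by nra.
    assert (X3 : Rabs dr <= n) by (unfold n; generalize (Rabs_pos dt); lra).
    assert (X4 : Rabs dt <= n) by (unfold n; generalize (Rabs_pos dr); lra).
    assert (Rabs (x - gr) * Rabs dr <= (Mr * n) * n) by (apply Rmult_le_compat; auto; apply Rabs_pos).
    assert (Rabs (y - gt) * Rabs dt <= (Mt * n) * n) by (apply Rmult_le_compat; auto; apply Rabs_pos).
    nra.
Qed.

(** Near 0 the linear term dominates; [h = g / (Rabs K + 1)] is close enough to 0 for a
    contradiction. *)
Lemma linear_eq_0 (g K : R) : (forall h, g * h <= K * h ^ 2) -> g = 0.
Proof.
  intro H. destruct (Req_dec g 0) as [E | E]; auto. exfalso.
  assert (PK : 0 < Rabs K + 1) by (generalize (Rabs_pos K); lra).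
  specialize (H (g / (Rabs K + 1))).
  replace (g * (g / (Rabs K + 1))) with (g ^ 2 / (Rabs K + 1)) in H by (field; lra).
  replace (K * (g / (Rabs K + 1)) ^ 2) with (K * g ^ 2 / (Rabs K + 1) / (Rabs K + 1)) in H by (field; lra).
  apply Rmult_le_compat_r with (r := (Rabs K + 1) * (Rabs K + 1)) in H; [| nra].
  replace (g ^ 2 / (Rabs K + 1) * ((Rabs K + 1) * (Rabs K + 1))) with (g ^ 2 * (Rabs K + 1)) in H by (field; lra).
  replace (K * g ^ 2 / (Rabs K + 1) / (Rabs K + 1) * ((Rabs K + 1) * (Rabs K + 1))) with (K * g ^ 2) in H by (field; lra).
  assert (K <= Rabs K) by apply Rle_abs.
  assert (0 < g ^ 2) by (apply pow2_gt_0; auto). nra.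
Qed.

Lemma periodic_shift (S : R -> R) (P : R) (n : Z) x :
  (forall x, S (x + P) = S x) -> S (x + P * IZR n) = S x.
Proof.
  intro H. revert x.
  assert (Hn : forall n x, S (x + P * INR n) = S x).
  { induction n0 as [| n0 IH]; intro x.
    - simpl. f_equal. ring.
    - rewrite S_INR. replace (x + P * (INR n0 + 1)) with ((x + P * INR n0) + P) by ring. now rewrite H. }
  intro x. destruct (Z_le_dec 0 n) as [L | L].
  - rewrite <- (Z2Nat.id n L), <- INR_IZR_INZ. apply Hn.
  - replace n with (- Z.of_nat (Z.to_nat (- n)))%Z by lia.
    rewrite opp_IZR, <- INR_IZR_INZ.
    rewrite <- (Hn (Z.to_nat (- n)) (x + P * - INR (Z.to_nat (- n)))). f_equal. ring.
Qed.

(** The quadratic estimate makes [g] the derivative of [S], so it vanishes at a maximum and at a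
    minimum, both of which are brought into [[0, P)] by periodicity. *)
Lemma two_critical_points (S g : R -> R) (K P : R) :
  0 < P -> (forall x, S (x + P) = S x) ->
  (forall x y, Rabs (S y - S x - g x * (y - x)) <= K * (y - x) ^ 2) ->
  exists a b, 0 <= a < P /\ 0 <= b < P /\ a <> b /\ g a = 0 /\ g b = 0.
Proof.
  intros HP Hper Hq.
  assert (Hlip : forall x, continuity_pt S x).
  { intro x. apply derivable_continuous_pt. exists (g x). intros e He.
    assert (Hm : 0 < e / (Rabs K + 1)) by (apply Rdiv_lt_0_compat; generalize (Rabs_pos K); lra).
    exists (mkposreal _ Hm). intros h Hh Hlt. simpl in Hlt.
    specialize (Hq x (x + h)). replace (x + h - x) with h in Hq by ring.
    replace ((S (x + h) - S x) / h - g x) with ((S (x + h) - S x - g x * h) / h) by (field; auto).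
    unfold Rdiv. rewrite Rabs_mult, Rabs_inv.
    assert (Ph : 0 < Rabs h) by (now apply Rabs_pos_lt).
    apply Rmult_lt_reg_r with (Rabs h); auto.
    rewrite Rmult_assoc, Rinv_l, Rmult_1_r by lra.
    eapply Rle_lt_trans; [apply Hq |]. rewrite <- pow2_abs.
    assert (PK : 0 < Rabs K + 1) by (generalize (Rabs_pos K); lra).
    apply Rlt_div_r in Hlt; [| lra].
    assert (K <= Rabs K) by apply Rle_abs. nra. }
  assert (Hred : forall x, exists y, 0 <= y < P /\ S x = S y).
  { intro x. assert (B := Int_part_scaled P x HP). cbv zeta in B.
    exists (x - P * IZR (Int_part (x / P))). split; [lra |].
    rewrite <- (periodic_shift S P (Int_part (x / P)) (x - _)); auto. f_equal. ring. }
  assert (Hmax : exists a, 0 <= a < P /\ forall x, S x <= S a).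
  { destruct (continuity_ab_maj S 0 P) as [a [Ha Ha']]; [lra | auto |].
    destruct (Hred a) as [a' [Ba Ea]]. exists a'. split; auto. intro x.
    destruct (Hred x) as [y [By Ey]]. rewrite Ey, <- Ea. apply Ha. lra. }
  assert (Hmin : exists b, 0 <= b < P /\ forall x, S b <= S x).
  { destruct (continuity_ab_min S 0 P) as [a [Ha Ha']]; [lra | auto |].
    destruct (Hred a) as [a' [Ba Ea]]. exists a'. split; auto. intro x.
    destruct (Hred x) as [y [By Ey]]. rewrite Ey, <- Ea. apply Ha. lra. }
  assert (Gmax : forall a, (forall x, S x <= S a) -> g a = 0).
  { intros a Ha. apply (linear_eq_0 _ K). intro h.
    specialize (Hq a (a + h)). specialize (Ha (a + h)). replace (a + h - a) with h in Hq by ring.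
    apply Rabs_le_between in Hq. lra. }
  assert (Gmin : forall a, (forall x, S a <= S x) -> g a = 0).
  { intros a Ha. apply Ropp_eq_reg. rewrite Ropp_0. apply (linear_eq_0 _ K). intro h.
    specialize (Hq a (a + h)). specialize (Ha (a + h)). replace (a + h - a) with h in Hq by ring.
    apply Rabs_le_between in Hq. lra. }
  destruct Hmax as [a [Ba Ha]]. destruct Hmin as [b [Bb Hb]].
  destruct (Req_dec a b) as [E | E].
  (* If one point is both a maximum and a minimum, [S] is constant and any two points will do. *)
  - subst b. assert (Hc : forall x y, S x <= S y).
    { intros x y. apply Rle_trans with (S a); auto. }
    exists 0, (P / 2). repeat split; try lra; apply Gmax; intro; apply Hc.
  - exists a, b. auto 10.
Qed.

(* The integrand [I = p r' + L] of the action: the difference of its values on two orbits is,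
   up to second order, the derivative of [p1 (r2 - r1) + L1 d]. *)
Lemma first_variation (lam kap H eps K d r1 r2 p1 p2 L1 L2 W1 W2 Wr Wt : R) :
  0 < r1 -> 0 < r2 -> 0 < L1 -> 0 < L2 -> 1 <= K -> Rabs eps <= 1 -> Rabs H <= K ->
  L1 ^ 2 = 2 * lam + r1 ^ 2 * (2 * H - p1 ^ 2) + 2 * kap * r1 + 2 * eps * r1 ^ 2 * W1 ->
  L2 ^ 2 = 2 * lam + r2 ^ 2 * (2 * H - p2 ^ 2) + 2 * kap * r2 + 2 * eps * r2 ^ 2 * W2 ->
  let v1 := r1 ^ 2 * p1 / L1 in let v2 := r2 ^ 2 * p2 / L2 in
  Rabs (r2 - r1) <= K * Rabs d -> Rabs (p2 - p1) <= K * Rabs d -> Rabs (L2 - L1) <= K * Rabs d ->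
  Rabs (v2 - v1) <= K * Rabs d -> Rabs (r2 * p2 - r1 * p1) <= K * Rabs d ->
  Rabs (W2 - W1) <= K * Rabs d -> Rabs (W2 - W1 - (Wr * (r2 - r1) + Wt * d)) <= K * d ^ 2 ->
  Rabs r1 <= K -> Rabs r2 <= K -> Rabs (r1 * p1) <= K -> Rabs L1 <= K -> Rabs W1 <= K -> / L1 <= K ->
  Rabs ((p2 * v2 + L2) - (p1 * v1 + L1) -
    ((L1 ^ 2 / r1 - 2 * lam / r1 - kap + eps * r1 ^ 2 * Wr) / L1 * (r2 - r1) + p1 * (v2 - v1)) -
    eps * r1 ^ 2 * Wt / L1 * d) <= 10 * K ^ 4 * d ^ 2.
Proof.
  intros Pr1 Pr2 PL1 PL2 PK He HH E1 E2 v1 v2 Dr Dp DL Dv Dy DW DT Br1 Br2 By BL1 BW BiL.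
  set (T := W2 - W1 - (Wr * (r2 - r1) + Wt * d)) in *.
  (* With [L1 ^ 2] and [L2 ^ 2] expressed through the energy, all first-order terms cancel exactly:
     each remaining term contains a product of two differences, or the Taylor remainder [T] of the
     perturbation. *)
  replace ((p2 * v2 + L2) - (p1 * v1 + L1) -
    ((L1 ^ 2 / r1 - 2 * lam / r1 - kap + eps * r1 ^ 2 * Wr) / L1 * (r2 - r1) + p1 * (v2 - v1)) -
    eps * r1 ^ 2 * Wt / L1 * d) with
   (/ L1 * ((p2 - p1) * L1 * (v2 - v1) - (L2 - L1) ^ 2 / 2 + H * (r2 - r1) ^ 2
      - (r1 * p1) * (r2 - r1) * (p2 - p1) - (r2 * p2 - r1 * p1) ^ 2 / 2
      + eps * (r1 ^ 2 * T + (r2 + r1) * (r2 - r1) * (W2 - W1) + (r2 - r1) ^ 2 * W1))).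
  2: { assert (EL : L2 - L1 = (L2 ^ 2 - L1 ^ 2 - (L2 - L1) ^ 2) / (2 * L1)) by (field; lra).
       assert (Ep : L1 ^ 2 / r1 - 2 * lam / r1 = r1 * (2 * H - p1 ^ 2) + 2 * kap + 2 * eps * r1 * W1).
       { rewrite E1. field. lra. }
       rewrite Ep.
       assert (EL' : L2 - L1 = (2 * lam + r2 ^ 2 * (2 * H - p2 ^ 2) + 2 * kap * r2 + 2 * eps * r2 ^ 2 * W2 -
         (2 * lam + r1 ^ 2 * (2 * H - p1 ^ 2) + 2 * kap * r1 + 2 * eps * r1 ^ 2 * W1) - (L2 - L1) ^ 2) / (2 * L1)).
       { rewrite <- E1, <- E2. exact EL. }
       set (x := L2 - L1) in *.
       replace (p2 * v2 + L2 - (p1 * v1 + L1)) with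
         ((p2 - p1) * (v2 - v1) + (p2 - p1) * v1 + p1 * (v2 - v1) + x) by (unfold x; ring).
       assert (Ev : v1 = r1 ^ 2 * p1 / L1) by reflexivity.
       unfold T. clearbody v1 v2 x. rewrite EL' at 2. rewrite Ev at 3. field. lra. }
  set (e := Rabs d) in *.
  assert (Ed : d ^ 2 = e * e) by (unfold e; rewrite <- pow2_abs; ring). rewrite Ed in *.
  assert (Pe : 0 <= e) by apply Rabs_pos.
  assert (Pm : forall a b x y, Rabs a <= x -> Rabs b <= y -> Rabs (a * b) <= x * y).
  { intros a b x y Ha Hb. rewrite Rabs_mult. apply Rmult_le_compat; auto; apply Rabs_pos. }
  assert (T1 := Pm _ _ _ _ (Pm _ _ _ _ Dp BL1) Dv).
  assert (T2 := Pm _ _ _ _ DL DL).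
  assert (T3 := Pm _ _ _ _ HH (Pm _ _ _ _ Dr Dr)).
  assert (T4 := Pm _ _ _ _ (Pm _ _ _ _ By Dr) Dp).
  assert (T5 := Pm _ _ _ _ Dy Dy).
  assert (T6 := Pm _ _ _ _ (Pm _ _ _ _ Br1 Br1) DT).
  assert (Br12 : Rabs (r2 + r1) <= K + K) by (eapply Rle_trans; [apply Rabs_triang | lra]).
  assert (T7 := Pm _ _ _ _ (Pm _ _ _ _ Br12 Dr) DW).
  assert (T8 := Pm _ _ _ _ (Pm _ _ _ _ Dr Dr) BW).
  assert (BiL' : Rabs (/ L1) <= K).
  { rewrite Rabs_right; auto. apply Rle_ge, Rlt_le, Rinv_0_lt_compat; auto. }
  assert (Ee : 0 <= e * e) by nra.
  assert (K2 : 1 <= K * K) by nra. assert (K3 : K * K <= K * K * K) by nra.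
  assert (M3 : K * K * (e * e) <= K * K * K * (e * e)) by (apply Rmult_le_compat_r; auto).
  assert (T9 : Rabs (r1 * r1 * T + (r2 + r1) * (r2 - r1) * (W2 - W1) + (r2 - r1) * (r2 - r1) * W1)
     <= 4 * (K * K * K) * (e * e)).
  { triangle.
    assert (Q := Rabs_triang (r1 * r1 * T) ((r2 + r1) * (r2 - r1) * (W2 - W1))). lra. }
  assert (T10 := Pm _ _ _ _ He T9).
  set (X := (p2 - p1) * L1 * (v2 - v1) - (L2 - L1) ^ 2 / 2 + H * (r2 - r1) ^ 2
      - (r1 * p1) * (r2 - r1) * (p2 - p1) - (r2 * p2 - r1 * p1) ^ 2 / 2
      + eps * (r1 ^ 2 * T + (r2 + r1) * (r2 - r1) * (W2 - W1) + (r2 - r1) ^ 2 * W1)).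
  (* The terms add up to at most [8 * K ^ 3 * d ^ 2]; the factor [/ L1] then brings the fourth power
     of [K]. *)
  assert (HX : Rabs X <= 10 * (K * K * K) * (e * e)).
  { apply Rabs_le_between in T1. apply Rabs_le_between in T2. apply Rabs_le_between in T3.
    apply Rabs_le_between in T4. apply Rabs_le_between in T5. apply Rabs_le_between in T10.
    replace X with ((p2 - p1) * L1 * (v2 - v1) - (L2 - L1) * (L2 - L1) / 2 + H * ((r2 - r1) * (r2 - r1))
      - (r1 * p1) * (r2 - r1) * (p2 - p1) - (r2 * p2 - r1 * p1) * (r2 * p2 - r1 * p1) / 2
      + eps * (r1 * r1 * T + (r2 + r1) * (r2 - r1) * (W2 - W1) + (r2 - r1) * (r2 - r1) * W1))
      by (unfold X; field).
    apply Rabs_le. lra. }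
  assert (T11 := Pm _ _ _ _ BiL' HX). lra.
Qed.

(** * Closing up *)

Section Family.

Variables kap lam H D ws : R.
Variable k : nat.
Variable U : R -> R -> R.
Hypothesis lam_pos : 0 < lam.
Hypothesis D_bounds : 0 < D < kap.
Hypothesis ws_bounds : 0 < ws < 1.
Hypothesis k_ge_2 : (2 <= k)%nat.
Hypothesis U_C2 : Ck 2 U.
Let P := turn k.
Variable C : R.
Hypothesis C_pos : 0 < C.

(* [Z th s] lists the elements, after an angle [s], of the orbit with a pericentre at the angle [th]. *)
Definition is_family (eps : R) (Z : R -> R -> nat -> R) : Prop :=
  (forall th i s, 0 <= s <= P -> is_derive (fun t => Z th t i) s
      (eps * drift kap lam D ws P U i (s, th, Z th s))) /\
  (forall th s i, 0 <= s <= P -> Rabs (Z th s i - vec3 D 0 ws i) <= C * Rabs eps) /\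
  (forall th, Z th 0 1%nat = 0 /\ P * Z th P 2%nat + Z th P 1%nat = 2 * PI /\
     mech_energy kap lam eps U (radius kap lam (Z th 0 0%nat) 0 (Z th 0 2%nat))
       (radmom lam (Z th 0 0%nat) 0 (Z th 0 2%nat)) (angmom lam (Z th 0 2%nat)) th = H) /\
  (forall th th' s i, 0 <= s <= P -> Rabs (Z th s i - Z th' s i) <= C * Rabs (th - th')) /\
  (forall th s i, 0 <= s <= P -> Z (th + 2 * PI) s i = Z th s i).

Let Ppos : 0 < P := turn_pos k k_ge_2.
Let P_ge_0 : 0 <= P := Rlt_le _ _ Ppos.

(** The distance from the unperturbed elements to the boundary of the clamping box. *)
Definition box_size : R := Rmin (Rmin (D / 2) ((kap - D) / 2)) (Rmin (ws / 2) ((1 - ws) / 2)).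

Lemma box_size_pos : 0 < box_size.
Proof. unfold box_size. repeat apply Rmin_pos; lra. Qed.

(** * Equations of motion and boundary values along one family *)

Section OneFamily.

Variable eps : R.
Variable Z : R -> R -> nat -> R.
Hypothesis Z_family : is_family eps Z.
Hypothesis eps_small : C * Rabs eps <= box_size.

Definition fg (th s : R) : R := Z th s 2%nat * s + Z th s 1%nat.
Definition fr (th s : R) : R := radius kap lam (Z th s 0%nat) (fg th s) (Z th s 2%nat).
Definition fp (th s : R) : R := radmom lam (Z th s 0%nat) (fg th s) (Z th s 2%nat).
Definition fL (th s : R) : R := angmom lam (Z th s 2%nat).

Lemma family_box th s : 0 <= s <= P ->
  D / 2 <= Z th s 0%nat <= (D + kap) / 2 /\ ws / 2 <= Z th s 2%nat <= (1 + ws) / 2.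
Proof.
  intro Hs. destruct Z_family as [_ [Hc _]].
  assert (A := Hc th s 0%nat Hs). assert (B := Hc th s 2%nat Hs).
  simpl in A, B. apply Rabs_le_between in A. apply Rabs_le_between in B.
  unfold box_size in eps_small.
  destruct (Rmin_le _ _ _ eps_small) as [I1 I2].
  destruct (Rmin_le _ _ _ I1) as [I3 I4]. destruct (Rmin_le _ _ _ I2) as [I5 I6].
  split; split; lra.
Qed.

Lemma family_clamps th s : 0 <= s <= P -> let x := (s, th, Z th s) in
  cS P x = s /\ cTh P x = th + s /\ cA kap D x = Z th s 0%nat /\ cw ws x = Z th s 2%nat /\
  cg ws P x = fg th s /\ cr kap lam D ws P x = fr th s.
Proof.
  intros Hs x. destruct (family_box th s Hs) as [B1 B2].
  assert (E1 : cS P x = s) by (now apply clamp_id).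
  assert (E2 : cA kap D x = Z th s 0%nat) by (now apply clamp_id).
  assert (E3 : cw ws x = Z th s 2%nat) by (now apply clamp_id).
  assert (E4 : cg ws P x = fg th s) by (unfold cg, fg; now rewrite E1, E3).
  repeat split; auto.
  - unfold cTh. now rewrite E1.
  - unfold cr. now rewrite E2, E3, E4.
Qed.

Lemma family_ranges th s : 0 <= s <= P -> 0 < Z th s 0%nat < kap /\ 0 < Z th s 2%nat < 1.
Proof. intro Hs. destruct (family_box th s Hs). lra. Qed.

Lemma family_derive th s : 0 <= s <= P ->
  is_derive (fun t => Z th t 0%nat) s (eps * drift_A lam U (Z th s 0%nat) (fg th s) (Z th s 2%nat) (fr th s) (th + s)) /\
  is_derive (fun t => Z th t 1%nat) s (eps * drift_gam lam U s (Z th s 0%nat) (fg th s) (Z th s 2%nat) (fr th s) (th + s)) /\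
  is_derive (fun t => Z th t 2%nat) s (eps * drift_w lam U (Z th s 2%nat) (fr th s) (th + s)).
Proof.
  intro Hs. destruct (family_clamps th s Hs) as [E1 [E2 [E3 [E4 [E5 E6]]]]].
  destruct Z_family as [Hd _].
  assert (D0 := Hd th 0%nat s Hs). assert (D1 := Hd th 1%nat s Hs). assert (D2 := Hd th 2%nat s Hs).
  unfold drift in D0, D1, D2. rewrite ?E1, ?E2, ?E3, ?E4, ?E5, ?E6 in D0. rewrite ?E1, ?E2, ?E3, ?E4, ?E5, ?E6 in D1. rewrite ?E1, ?E2, ?E3, ?E4, ?E5, ?E6 in D2. auto.
Qed.

Lemma fr_pos th s : 0 <= s <= P -> 0 < fr th s.
Proof.
  intro Hs. destruct (family_ranges th s Hs) as [B1 B2].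
  exact (r_pos kap lam lam_pos (fun t => Z th t 0%nat) (fun t => Z th t 1%nat) (fun t => Z th t 2%nat) s B1 B2).
Qed.

Lemma fL_pos th s : 0 <= s <= P -> 0 < fL th s.
Proof. intro Hs. destruct (family_ranges th s Hs) as [B1 B2]. apply angmom_sqr; auto. Qed.

Lemma fr_derive th s : 0 <= s <= P -> is_derive (fr th) s (fr th s ^ 2 * fp th s / fL th s).
Proof.
  intro Hs. destruct (family_ranges th s Hs) as [B1 B2]. destruct (family_derive th s Hs) as [D0 [D1 D2]].
  exact (r_derive kap lam eps th U lam_pos (fun t => Z th t 0%nat) (fun t => Z th t 1%nat)
    (fun t => Z th t 2%nat) s B1 B2 D0 D1 D2).
Qed.

Lemma fp_derive th s : 0 <= s <= P -> is_derive (fp th) s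
  ((fL th s ^ 2 / fr th s - 2 * lam / fr th s - kap + eps * fr th s ^ 2 * polar_r U (fr th s) (th + s)) / fL th s).
Proof.
  intro Hs. destruct (family_ranges th s Hs) as [B1 B2]. destruct (family_derive th s Hs) as [D0 [D1 D2]].
  exact (p_derive kap lam eps th U lam_pos (fun t => Z th t 0%nat) (fun t => Z th t 1%nat)
    (fun t => Z th t 2%nat) s B1 B2 D0 D1 D2).
Qed.

Lemma fL_derive th s : 0 <= s <= P -> is_derive (fL th) s
  (eps * fr th s ^ 2 * polar_t U (fr th s) (th + s) / fL th s).
Proof.
  intro Hs. destruct (family_ranges th s Hs) as [B1 B2]. destruct (family_derive th s Hs) as [D0 [D1 D2]].
  exact (L_derive kap lam eps th U lam_pos (fun t => Z th t 0%nat) (fun t => Z th t 1%nat)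
    (fun t => Z th t 2%nat) s B2 D2).
Qed.

Lemma fg_derive th s : 0 <= s <= P -> is_derive (fg th) s (Z th s 2%nat -
  eps * (drift_V U (fr th s) (th + s) * sin (fg th s) +
   drift_Q lam U (Z th s 0%nat) (fg th s) (Z th s 2%nat) (fr th s) (th + s) * cos (fg th s)) / Z th s 0%nat).
Proof.
  intro Hs. destruct (family_ranges th s Hs) as [B1 B2]. destruct (family_derive th s Hs) as [D0 [D1 D2]].
  exact (g_derive kap lam eps th U (fun t => Z th t 0%nat) (fun t => Z th t 1%nat)
    (fun t => Z th t 2%nat) s B1 D1 D2).
Qed.

Lemma fg_0 th : fg th 0 = 0.
Proof. unfold fg. destruct Z_family as [_ [_ [H0 _]]]. destruct (H0 th) as [E _]. rewrite E. ring. Qed.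

Lemma fg_end th : fg th P = 2 * PI.
Proof. unfold fg. destruct Z_family as [_ [_ [H0 _]]]. destruct (H0 th) as [_ [E _]]. lra. Qed.

Lemma fp_0 th : fp th 0 = 0.
Proof. unfold fp, radmom. rewrite fg_0, sin_0. unfold Rdiv. ring. Qed.

Lemma fp_end th : fp th P = 0.
Proof. unfold fp, radmom. rewrite fg_end, sin_2PI. unfold Rdiv. ring. Qed.

Lemma family_energy th s : 0 <= s <= P ->
  mech_energy kap lam eps U (fr th s) (fp th s) (fL th s) (th + s) = H.
Proof.
  intro Hs.
  assert (E : mech_energy kap lam eps U (fr th 0) (fp th 0) (fL th 0) (th + 0) = H).
  { unfold fr, fp, fL. rewrite fg_0, Rplus_0_r. destruct Z_family as [_ [_ [H0 _]]]. apply H0. }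
  rewrite <- E.
  apply (derive_zero_const (fun t => mech_energy kap lam eps U (fr th t) (fp th t) (fL th t) (th + t)) 0 s); [lra |].
  intros t Ht. assert (Ht' : 0 <= t <= P) by lra.
  apply energy_derive; [now apply Ck_le | now apply fr_pos | now apply fL_pos | now apply fr_derive
   | now apply fp_derive | now apply fL_derive].
Qed.

Lemma family_L_sqr th s : 0 <= s <= P ->
  fL th s ^ 2 = 2 * lam + fr th s ^ 2 * (2 * H - fp th s ^ 2) + 2 * kap * fr th s +
   2 * eps * fr th s ^ 2 * polar U (fr th s) (th + s).
Proof.
  intro Hs. rewrite <- (family_energy th s Hs). assert (Pr := fr_pos th s Hs).
  unfold mech_energy. field. lra.
Qed.

Lemma family_periodic th s : 0 <= s <= P ->
  fr (th + 2 * PI) s = fr th s /\ fp (th + 2 * PI) s = fp th s /\ fL (th + 2 * PI) s = fL th s.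
Proof.
  intro Hs. destruct Z_family as [_ [_ [_ [_ Hp]]]]. unfold fr, fp, fL, fg. rewrite !Hp by auto. auto.
Qed.

Lemma family_dist th th' s : 0 <= s <= P ->
  dist_pt (s, th, Z th s) (s, th', Z th' s) <= (1 + 3 * C) * Rabs (th - th').
Proof.
  intro Hs. destruct Z_family as [_ [_ [_ [HL _]]]].
  unfold dist_pt. simpl. rewrite Rminus_diag, Rabs_R0.
  assert (K := dist3_le (Z th s) (Z th' s) (C * Rabs (th - th')) (fun i => HL th th' s i Hs)). lra.
Qed.

Lemma family_dist_star th s : 0 <= s <= P ->
  dist_pt (s, th, Z th s) (s, th, vec3 D 0 ws) <= 3 * C * Rabs eps.
Proof.
  intro Hs. destruct Z_family as [_ [HL _]].
  unfold dist_pt. simpl. rewrite !Rminus_diag, Rabs_R0.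
  assert (K := dist3_le (Z th s) (vec3 D 0 ws) (C * Rabs eps) (fun i => HL th s i Hs)). lra.
Qed.

End OneFamily.

(** One constant serves for the bound and the Lipschitz estimate, and so does any larger one, so
    that several functions can share it. *)
Lemma BL_common (f : pt -> R) : BLp f -> exists K0, 0 <= K0 /\ forall K, K0 <= K ->
  (forall x, Rabs (f x) <= K) /\ (forall x y, Rabs (f x - f y) <= K * dist_pt x y).
Proof.
  intros [[M [PM HM]] [N [PN HN]]]. exists (M + N). split; [lra |]. intros K HK. split.
  - intro x. specialize (HN x). lra.
  - intros x y. specialize (HM x y). assert (Dp := dist_pt_ge_0 x y). nra.
Qed.

(** [S th] is the integral of [p r' + L] over the [k] turns. Two orbits are compared directly: the
    difference of the integrands minus the derivative of [p (r2 - r1) + L d] is quadratic in [d].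
    Thus the flow is never differentiated in [th], and [K] depends neither on [eps] nor on [Z]. *)
Lemma action_exists : exists K, forall eps Z, is_family eps Z -> C * Rabs eps <= box_size -> Rabs eps <= 1 ->
  exists S : R -> R, (forall th, S (th + 2 * PI) = S th) /\
   forall th th', Rabs (S th' - S th - (fL Z th P - fL Z th 0) * (th' - th)) <= K * (th' - th) ^ 2.
Proof.
  assert (B1 := BL_cr kap lam D ws P D_bounds ws_bounds P_ge_0).
  assert (B2 := BL_radmom kap lam D ws P lam_pos D_bounds ws_bounds P_ge_0).
  assert (B3 := BL_angmom lam ws lam_pos ws_bounds).
  assert (B4 := BL_angmom_inv lam ws lam_pos ws_bounds).
  assert (B5 := BL_polar kap lam D ws P U D_bounds ws_bounds P_ge_0 U_C2).
  assert (B6 := BL_mult pt dist_pt dist_pt_ge_0 _ _ B1 B2).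
  assert (B7 := BL_mult pt dist_pt dist_pt_ge_0 _ _ (BL_mult pt dist_pt dist_pt_ge_0 _ _ B1 B6) B4).
  destruct (BL_common _ B1) as [K1 [PK1 F1]]. destruct (BL_common _ B2) as [K2 [PK2 F2]].
  destruct (BL_common _ B3) as [K3 [PK3 F3]]. destruct (BL_common _ B4) as [K4 [PK4 F4]].
  destruct (BL_common _ B5) as [K5 [PK5 F5]]. destruct (BL_common _ B6) as [K6 [PK6 F6]].
  destruct (BL_common _ B7) as [K7 [PK7 F7]].
  set (K0 := K1 + K2 + K3 + K4 + K5 + K6 + K7).
  assert (P0 : 0 <= K0) by (unfold K0; lra).
  specialize (F1 K0 ltac:(unfold K0; lra)). specialize (F2 K0 ltac:(unfold K0; lra)).
  specialize (F3 K0 ltac:(unfold K0; lra)). specialize (F4 K0 ltac:(unfold K0; lra)).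
  specialize (F5 K0 ltac:(unfold K0; lra)). specialize (F6 K0 ltac:(unfold K0; lra)).
  specialize (F7 K0 ltac:(unfold K0; lra)). clearbody K0.
  destruct (cr_pos kap lam D ws P lam_pos D_bounds ws_bounds) as [c [Pc Hc]].
  assert (HcK : c <= K0).
  { assert (A := Hc (0, 0, vec3 D 0 ws)). assert (B := proj1 F1 (0, 0, vec3 D 0 ws)).
    assert (Q := Rle_abs (cr kap lam D ws P (0, 0, vec3 D 0 ws))). lra. }
  destruct (polar_taylor U c K0 HcK U_C2) as [KT [PKT HT]].
  set (KL := K0 * (1 + 3 * C)). assert (PKL : 0 <= KL) by (apply Rmult_le_pos; lra).
  assert (PKT2 : 0 <= KT * (KL + 1) ^ 2) by (apply Rmult_le_pos; [auto | apply pow2_ge_0]).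
  set (K := 1 + K0 + KL + Rabs H + KT * (KL + 1) ^ 2).
  assert (QH := Rabs_pos H).
  exists (10 * K ^ 4 * P).
  intros eps Z HZ Hbox Heps.
  assert (Hcl := family_clamps eps Z HZ Hbox).
  assert (Hobs : forall th s, 0 <= s <= P ->
     Rabs (fr Z th s) <= K0 /\ Rabs (fL Z th s) <= K0 /\ / fL Z th s <= K0 /\
     Rabs (polar U (fr Z th s) (th + s)) <= K0 /\ Rabs (fr Z th s * fp Z th s) <= K0 /\ c <= fr Z th s <= K0).
  { intros th s Hs. destruct (Hcl th s Hs) as [E1 [E2 [E3 [E4 [E5 E6]]]]].
    set (x := (s, th, Z th s)) in *.
    assert (A1 := proj1 F1 x). assert (A3 := proj1 F3 x). assert (A4 := proj1 F4 x).
    assert (A5 := proj1 F5 x). assert (A6 := proj1 F6 x). assert (A7 := Hc x).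
    cbv beta in A3, A4, A5, A6.
    rewrite E6 in A1. rewrite E4 in A3. rewrite E4 in A4. rewrite E6, E2 in A5. rewrite E6, E3, E4, E5 in A6. rewrite E6 in A7.
    fold (fL Z th s) in A3, A4. fold (fp Z th s) in A6.
    repeat split; auto.
    - eapply Rle_trans; [apply Rle_abs | apply A4].
    - eapply Rle_trans; [apply Rle_abs | apply A1]. }
  assert (Hdif : forall th th' s, 0 <= s <= P ->
     Rabs (fr Z th' s - fr Z th s) <= KL * Rabs (th' - th) /\
     Rabs (fp Z th' s - fp Z th s) <= KL * Rabs (th' - th) /\
     Rabs (fL Z th' s - fL Z th s) <= KL * Rabs (th' - th) /\
     Rabs (polar U (fr Z th' s) (th' + s) - polar U (fr Z th s) (th + s)) <= KL * Rabs (th' - th) /\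
     Rabs (fr Z th' s * fp Z th' s - fr Z th s * fp Z th s) <= KL * Rabs (th' - th) /\
     Rabs (fr Z th' s ^ 2 * fp Z th' s / fL Z th' s - fr Z th s ^ 2 * fp Z th s / fL Z th s) <= KL * Rabs (th' - th)).
  { intros th th' s Hs.
    assert (Dd := family_dist eps Z HZ th' th s Hs).
    destruct (Hcl th s Hs) as [E1 [E2 [E3 [E4 [E5 E6]]]]].
    destruct (Hcl th' s Hs) as [G1 [G2 [G3 [G4 [G5 G6]]]]].
    set (x := (s, th, Z th s)) in *. set (x' := (s, th', Z th' s)) in *.
    assert (KD : K0 * dist_pt x' x <= KL * Rabs (th' - th)).
    { unfold KL. rewrite Rmult_assoc. apply Rmult_le_compat_l; auto. }
    assert (A1 := proj2 F1 x' x). assert (A2 := proj2 F2 x' x). assert (A3 := proj2 F3 x' x).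
    assert (A5 := proj2 F5 x' x). assert (A6 := proj2 F6 x' x). assert (A7 := proj2 F7 x' x).
    cbv beta in A2, A3, A5, A6, A7.
    rewrite E6, G6 in A1. rewrite E3, E4, E5, G3, G4, G5 in A2. rewrite E4, G4 in A3.
    rewrite E6, E2, G6, G2 in A5. rewrite E6, E3, E4, E5, G6, G3, G4, G5 in A6.
    rewrite E6, E3, E4, E5, G6, G3, G4, G5 in A7.
    fold (fL Z th s) in A3, A7. fold (fp Z th s) in A2, A6, A7.
    fold (fL Z th' s) in A3, A7. fold (fp Z th' s) in A2, A6, A7.
    repeat split; try (eapply Rle_trans; [eassumption | apply KD]).
    replace (fr Z th' s ^ 2 * fp Z th' s / fL Z th' s) with (fr Z th' s * (fr Z th' s * fp Z th' s) * / fL Z th' s) by (unfold Rdiv; ring).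
    replace (fr Z th s ^ 2 * fp Z th s / fL Z th s) with (fr Z th s * (fr Z th s * fp Z th s) * / fL Z th s) by (unfold Rdiv; ring).
    eapply Rle_trans; [eassumption | apply KD]. }
  set (lag := fun th s => fp Z th s * (fr Z th s ^ 2 * fp Z th s / fL Z th s) + fL Z th s).
  (* Clamping the angle makes the integrand continuous on the whole line, so that its primitive has
     a two-sided derivative at [0] and [P]. *)
  set (lagc := fun th s => lag th (clamp 0 P s)).
  assert (Hdl : forall th s, 0 <= s <= P -> continuous (lag th) s).
  { intros th s Hs. apply (ex_derive_continuous (lag th) s).
    assert (Pr := fr_pos eps Z HZ Hbox th s Hs). assert (PL := fL_pos eps Z HZ Hbox th s Hs).
    assert (X1 := fr_derive eps Z HZ Hbox th s Hs). assert (X2 := fp_derive eps Z HZ Hbox th s Hs).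
    assert (X3 := fL_derive eps Z HZ Hbox th s Hs).
    unfold lag. auto_derive. repeat split; try (eexists; eassumption). lra. }
  assert (Hcc : forall th s, continuous (lagc th) s).
  { intros th s. unfold lagc. apply (continuous_comp (clamp 0 P) (lag th)).
    - apply lipschitz_continuous with 1. intros; apply clamp_lipschitz.
    - apply Hdl. now apply clamp_bounds. }
  exists (fun th => RInt (lagc th) 0 P). split.
  - intro th. apply RInt_ext. intros s Hs. unfold lagc, lag.
    destruct (family_periodic eps Z HZ th (clamp 0 P s)) as [Q1 [Q2 Q3]]; [now apply clamp_bounds |].
    now rewrite Q1, Q2, Q3.
  - intros th th'. set (d := th' - th).
    (* At both ends [p] vanishes, so [F P - F 0] is exactly the quantity to be estimated. *)
    set (F := fun s => RInt (lagc th') 0 s - RInt (lagc th) 0 s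
        - fp Z th s * (fr Z th' s - fr Z th s) - fL Z th s * d).
    assert (HF : Rabs (F P - F 0) <= 10 * K ^ 4 * d ^ 2 * (P - 0)).
    { set (v := fun th s => fr Z th s ^ 2 * fp Z th s / fL Z th s).
      apply (derive_bound F (fun s => lag th' s - lag th s -
        ((fL Z th s ^ 2 / fr Z th s - 2 * lam / fr Z th s - kap + eps * fr Z th s ^ 2 * polar_r U (fr Z th s) (th + s)) / fL Z th s
          * (fr Z th' s - fr Z th s) + fp Z th s * (v th' s - v th s)) -
        eps * fr Z th s ^ 2 * polar_t U (fr Z th s) (th + s) / fL Z th s * d)); auto.
      - intros s Hs.
        assert (Y1 := fr_derive eps Z HZ Hbox th s Hs). assert (Y1' := fr_derive eps Z HZ Hbox th' s Hs).
        assert (Y2 := fp_derive eps Z HZ Hbox th s Hs). assert (Y3 := fL_derive eps Z HZ Hbox th s Hs).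
        assert (Y4 := is_derive_primitive (lagc th') s (Hcc th')).
        assert (Y5 := is_derive_primitive (lagc th) s (Hcc th)).
        replace (lagc th' s) with (lag th' s) in Y4 by (unfold lagc; now rewrite clamp_id).
        replace (lagc th s) with (lag th s) in Y5 by (unfold lagc; now rewrite clamp_id).
        set (I1 := fun t => RInt (lagc th') 0 t) in *. set (I2 := fun t => RInt (lagc th) 0 t) in *.
        set (r1 := fr Z th) in *. set (r2 := fr Z th') in *. set (p1 := fp Z th) in *. set (L1 := fL Z th) in *.
        assert (EF : forall t, I1 t - I2 t - p1 t * (r2 t - r1 t) - L1 t * d = F t) by reflexivity.
        apply (is_derive_ext _ F s _ EF). clearbody I1 I2.
        set (l1 := lag th s) in *. set (l2 := lag th' s) in *.
        set (dp := (L1 s ^ 2 / r1 s - 2 * lam / r1 s - kap + eps * r1 s ^ 2 * polar_r U (r1 s) (th + s)) / L1 s) in *.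
        set (dL := eps * r1 s ^ 2 * polar_t U (r1 s) (th + s) / L1 s) in *.
        change (r1 s ^ 2 * p1 s / L1 s) with (v th s) in Y1.
        change (r2 s ^ 2 * fp Z th' s / fL Z th' s) with (v th' s) in Y1'.
        clearbody dp dL l1 l2 r1 r2 p1 L1. clear EF.
        apply (is_derive_minus (fun t => I1 t - I2 t - p1 t * (r2 t - r1 t)) (fun t => L1 t * d)).
        + apply (is_derive_minus (fun t => I1 t - I2 t) (fun t => p1 t * (r2 t - r1 t))).
          * apply (is_derive_minus I1 I2); auto.
          * auto_derive; [repeat split; eexists; eassumption |]. rewrite_derivatives. ring.
        + auto_derive; [repeat split; eexists; eassumption |]. rewrite_derivatives. ring.
      - intros s Hs. unfold lag.
        destruct (Hobs th s Hs) as [O1 [O2 [O3 [O4 [O5 O6]]]]].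
        destruct (Hobs th' s Hs) as [O1' [_ [_ [_ [_ O6']]]]].
        destruct (Hdif th th' s Hs) as [G1 [G2 [G3 [G4 [G5 G6]]]]]. fold d in G1, G2, G3, G4, G5, G6.
        assert (Qd := Rabs_pos d).
        assert (HKd : KL * Rabs d <= K * Rabs d) by (apply Rmult_le_compat_r; [auto | unfold K; lra]).
        assert (HKT : KT * (KL * Rabs d + Rabs d) ^ 2 <= K * d ^ 2).
        { rewrite <- (pow2_abs d). replace (KT * (KL * Rabs d + Rabs d) ^ 2) with (KT * (KL + 1) ^ 2 * Rabs d ^ 2) by ring.
          apply Rmult_le_compat_r; [apply pow2_ge_0 | unfold K; lra]. }
        assert (T := HT (fr Z th s) (fr Z th' s) (th + s) (th' + s) O6 O6').
        replace (th' + s - (th + s)) with d in T by (unfold d; ring).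
        apply (first_variation lam kap H eps K d (fr Z th s) (fr Z th' s) (fp Z th s) (fp Z th' s)
          (fL Z th s) (fL Z th' s) (polar U (fr Z th s) (th + s)) (polar U (fr Z th' s) (th' + s))
          (polar_r U (fr Z th s) (th + s)) (polar_t U (fr Z th s) (th + s))); auto;
         try (now apply (family_L_sqr eps Z HZ Hbox)); try (now apply (fr_pos eps Z HZ Hbox));
         try (now apply (fL_pos eps Z HZ Hbox)); try (unfold K; lra); try (fold K; lra).
        eapply Rle_trans; [apply T |]. eapply Rle_trans; [| apply HKT].
        apply Rmult_le_compat_l; auto. apply pow_incr. generalize (Rabs_pos (fr Z th' s - fr Z th s)); lra. }
    unfold F in HF.
    rewrite (fp_0 eps Z HZ th), (fp_end eps Z HZ th), !Rmult_0_l, !Rminus_0_r, !RInt_point in HF.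
    replace (RInt (lagc th') 0 P - RInt (lagc th) 0 P - (fL Z th P - fL Z th 0) * d) with
      (RInt (lagc th') 0 P - RInt (lagc th) 0 P - fL Z th P * d - (@zero R_CompleteNormedModule - @zero R_CompleteNormedModule - fL Z th 0 * d)).
    2: { change (@zero R_CompleteNormedModule) with 0. ring. }
    replace (10 * K ^ 4 * P * d ^ 2) with (10 * K ^ 4 * d ^ 2 * P) by ring. exact HF.
Qed.

(** * Closing condition and uniqueness of the pericentre *)

Lemma polar_turn r th : polar U r (th + P) = polar U r th.
Proof.
  unfold P, turn. rewrite INR_IZR_INZ.
  apply (periodic_shift (fun x => polar U r x) (2 * PI) (Z.of_nat k) th). intro. apply polar_periodic.
Qed.

(** The equation of the conic, which lets the sign of [cos g] be read off from [r] and [L] alone. *)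
Lemma family_ell2 Z th s eps : is_family eps Z -> C * Rabs eps <= box_size -> 0 <= s <= P ->
  fL Z th s ^ 2 - 2 * lam = fr Z th s * (kap + Z th s 0%nat * cos (fg Z th s)) /\
  0 < kap + Z th s 0%nat * cos (fg Z th s).
Proof.
  intros HZ Hb Hs. destruct (family_ranges eps Z HZ Hb th s Hs) as [B1 B2].
  assert (Pd : 0 < kap + Z th s 0%nat * cos (fg Z th s)) by (generalize (COS_bound (fg Z th s)); intro; nra).
  split; auto. unfold fr, radius. rewrite ell2_angmom by auto. fold (fL Z th s).
  destruct (angmom_sqr lam (Z th s 2%nat) lam_pos B2) as [_ E]. fold (fL Z th s) in E.
  unfold Rdiv. rewrite Rmult_assoc, Rinv_l, Rmult_1_r by lra. lra.
Qed.

(** Equal [L] means equal [w]. Both ends are apsides at the same angle modulo [2 PI], so the energy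
    imposes the same equation on both values of [A]. For small [eps] its solution is unique: [A ^ 2]
    separates values at a rate of at least [D], the perturbation only at a rate of order [eps]. *)
Lemma family_closes : exists e, 0 < e /\ forall eps Z, is_family eps Z -> C * Rabs eps <= box_size ->
  Rabs eps <= e -> forall th, fL Z th P = fL Z th 0 -> fr Z th P = fr Z th 0.
Proof.
  destruct (BL_common _ (BL_polar kap lam D ws P U D_bounds ws_bounds P_ge_0 U_C2)) as [M [PM HM]].
  specialize (HM M (Rle_refl M)). destruct HM as [_ HM].
  destruct (BL_common _ (BL_cell2 lam ws ws_bounds)) as [E [PE HE]].
  specialize (HE E (Rle_refl E)). destruct HE as [HE _].
  (* Two solutions would satisfy [Rabs (a1 - a0) * D <= 2 * E * M * Rabs eps * Rabs (a1 - a0)], and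
     this threshold makes the right-hand side at most half of the left. *)
  exists (D / (4 * (E * M + 1))).
  assert (PEM : 0 <= E * M) by nra.
  split; [apply Rdiv_lt_0_compat; lra |].
  intros eps Z HZ Hb He th EL.
  assert (H0 : 0 <= 0 <= P) by lra. assert (HP : 0 <= P <= P) by lra.
  destruct (family_ranges eps Z HZ Hb th 0 H0) as [A0 W0]. destruct (family_ranges eps Z HZ Hb th P HP) as [A1 W1].
  destruct (family_box eps Z HZ Hb th 0 H0) as [X0 Y0]. destruct (family_box eps Z HZ Hb th P HP) as [X1 Y1].
  assert (Ew : Z th P 2%nat = Z th 0 2%nat).
  { destruct (angmom_sqr lam (Z th 0 2%nat) lam_pos W0) as [PL S0].
    destruct (angmom_sqr lam (Z th P 2%nat) lam_pos W1) as [_ S1].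
    fold (fL Z th 0) in S0, PL. fold (fL Z th P) in S1. rewrite EL in S1.
    assert (Q : (Z th P 2%nat - Z th 0 2%nat) * (Z th P 2%nat + Z th 0 2%nat) = 0).
    { apply Rmult_eq_reg_l with (fL Z th 0 ^ 2); [| apply pow_nonzero; lra]. lra. }
    apply Rmult_integral in Q. lra. }
  assert (F0 := family_energy eps Z HZ Hb th 0 H0). assert (F1 := family_energy eps Z HZ Hb th P HP).
  unfold fr, fp, fL in F0, F1. rewrite (fg_0 eps Z HZ) in F0. rewrite (fg_end eps Z HZ) in F1.
  rewrite mech_energy_elements in F0 by (auto; rewrite cos_0; lra).
  rewrite mech_energy_elements in F1 by (auto; rewrite cos_2PI; lra).
  rewrite Rplus_0_r in F0. rewrite polar_turn in F1.
  unfold fr. rewrite (fg_0 eps Z HZ), (fg_end eps Z HZ).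
  assert (E2 : forall A w, radius kap lam A (2 * PI) w = radius kap lam A 0 w).
  { intros. unfold radius. now rewrite cos_2PI, cos_0. }
  rewrite E2 in *. rewrite Ew in *. set (w := Z th 0 2%nat) in *.
  set (a0 := Z th 0 0%nat) in *. set (a1 := Z th P 0%nat) in *.
  assert (HW : Rabs (polar U (radius kap lam a1 0 w) th - polar U (radius kap lam a0 0 w) th) <= M * Rabs (a1 - a0)).
  { assert (Hx : forall a, D / 2 <= a <= (D + kap) / 2 -> let x := (0, th, vec3 a 0 w) in
      cr kap lam D ws P x = radius kap lam a 0 w /\ cTh P x = th).
    { intros a Ha x. assert (Q1 : cS P x = 0) by (apply clamp_id; auto).
      assert (Q2 : cw ws x = w) by (apply clamp_id; auto).
      assert (Q3 : cA kap D x = a) by (apply clamp_id; auto).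
      split; [| unfold cTh; rewrite Q1; simpl; ring].
      unfold cr, cg. rewrite Q1, Q2, Q3. f_equal. simpl. ring. }
    destruct (Hx a0 X0) as [G1 G2]. destruct (Hx a1 X1) as [G3 G4].
    specialize (HM (0, th, vec3 a1 0 w) (0, th, vec3 a0 0 w)). cbv beta in HM.
    rewrite G1, G2, G3, G4 in HM. eapply Rle_trans; [apply HM |].
    apply Rmult_le_compat_l; auto. unfold dist_pt. simpl. rewrite dist3_vec3, !Rminus_diag, Rabs_R0. lra. }
  assert (Hell : 0 < ell2 lam w <= E).
  { split.
    - rewrite ell2_angmom by auto. destruct (angmom_sqr lam w lam_pos W0) as [PL _].
      apply Rmult_lt_0_compat; apply pow_lt; lra.
    - specialize (HE (0, th, Z th 0)). replace (cw ws (0, th, Z th 0)) with w in HE.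
      + eapply Rle_trans; [apply Rle_abs | apply HE].
      + symmetry. now apply clamp_id. }
  set (W1' := polar U (radius kap lam a1 0 w) th) in *. set (W0' := polar U (radius kap lam a0 0 w) th) in *.
  assert (Ea : a1 ^ 2 - a0 ^ 2 = 2 * ell2 lam w * (eps * (W1' - W0'))).
  { assert (Q0 : a0 ^ 2 - kap ^ 2 = 2 * ell2 lam w * (H + eps * W0')) by (rewrite <- F0; field; lra).
    assert (Q1 : a1 ^ 2 - kap ^ 2 = 2 * ell2 lam w * (H + eps * W1')) by (rewrite <- F1; field; lra).
    lra. }
  assert (Ea' : a1 = a0); [| now rewrite Ea'].
  destruct (Req_dec a1 a0) as [| N]; auto. exfalso.
  assert (Pa : 0 < Rabs (a1 - a0)) by (apply Rabs_pos_lt; lra).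
  assert (T1 : Rabs (a1 - a0) * D <= Rabs (a1 ^ 2 - a0 ^ 2)).
  { replace (a1 ^ 2 - a0 ^ 2) with ((a1 - a0) * (a1 + a0)) by ring. rewrite Rabs_mult.
    apply Rmult_le_compat_l; [lra |]. rewrite Rabs_right; lra. }
  rewrite Ea, !Rabs_mult, (Rabs_right 2), (Rabs_right (ell2 lam w)) in T1 by lra.
  assert (QE := Rabs_pos eps). assert (QW := Rabs_pos (W1' - W0')).
  assert (T2 : 2 * ell2 lam w * (Rabs eps * Rabs (W1' - W0')) <= 2 * E * (Rabs eps * (M * Rabs (a1 - a0)))).
  { apply Rmult_le_compat; [lra | now apply Rmult_le_pos | lra | now apply Rmult_le_compat_l]. }
  assert (T3 : Rabs eps * (4 * (E * M + 1)) <= D).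
  { apply Rle_div_r in He; [| lra]. auto. }
  assert (T4 : Rabs (a1 - a0) * D <= Rabs (a1 - a0) * (2 * (E * M) * Rabs eps)) by lra.
  apply Rmult_le_reg_l in T4; auto. nra.
Qed.

(** By the equation of the conic the inequality means [cos g > 0], and [p = 0] means [sin g = 0].
    For small [eps] the phase has speed at least [ws / 4], so inside the interval it stays strictly
    between [0] and [2 PI]. *)
Lemma family_apsis : exists e, 0 < e /\ forall eps Z, is_family eps Z -> C * Rabs eps <= box_size ->
  Rabs eps <= e -> forall th, kap * fr Z th 0 < fL Z th 0 ^ 2 - 2 * lam /\
  forall s, 0 <= s <= P -> fp Z th s = 0 -> kap * fr Z th s < fL Z th s ^ 2 - 2 * lam -> s = 0 \/ s = P.
Proof.
  assert (B1 := BL_drift_V kap lam D ws P U D_bounds ws_bounds P_ge_0 U_C2).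
  assert (B2 := BL_drift_Q kap lam D ws P U lam_pos D_bounds ws_bounds P_ge_0 U_C2).
  assert (B3 := BL_cA_inv kap D D_bounds).
  assert (B4 := BL_sin pt dist_pt _ (Lips_cg ws P P_ge_0)).
  assert (B5 := BL_cos pt dist_pt _ (Lips_cg ws P P_ge_0)).
  assert (B6 := BL_mult pt dist_pt dist_pt_ge_0 _ _ (BL_plus pt dist_pt _ _ (BL_mult pt dist_pt dist_pt_ge_0 _ _ B1 B4)
    (BL_mult pt dist_pt dist_pt_ge_0 _ _ B2 B5)) B3).
  destruct (BL_common _ B6) as [M [PM HM]]. specialize (HM M (Rle_refl M)). destruct HM as [HM _].
  cbv beta in HM. clear B1 B2 B3 B4 B5 B6.
  exists (ws / (4 * (M + 1))). split; [apply Rdiv_lt_0_compat; lra |].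
  intros eps Z HZ Hb He th.
  assert (He' : Rabs eps * M <= ws / 4).
  { apply Rle_div_r in He; [| lra]. generalize (Rabs_pos eps); lra. }
  split.
  - assert (H0 : 0 <= 0 <= P) by lra.
    destruct (family_ell2 Z th 0 eps HZ Hb H0) as [E1 E2].
    destruct (family_ranges eps Z HZ Hb th 0 H0) as [B1 _].
    assert (Pr := fr_pos eps Z HZ Hb th 0 H0).
    rewrite E1, (fg_0 eps Z HZ), cos_0. nra.
  - assert (Hmono : forall a b, 0 <= a -> b <= P -> a < b -> fg Z th a < fg Z th b).
    { intros a b Ha Hbb Hab. eapply (derive_pos_lt (fg Z th)); [auto | |].
      - intros t Ht. apply (fg_derive eps Z HZ Hb). lra.
      - intros t Ht. assert (Ht' : 0 <= t <= P) by lra.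
        destruct (family_clamps eps Z HZ Hb th t Ht') as [E1 [E2 [E3 [E4 [E5 E6]]]]].
        destruct (family_box eps Z HZ Hb th t Ht') as [X0 Y0].
        specialize (HM (t, th, Z th t)). rewrite E3, E4, E5, E6, E2 in HM.
        match goal with |- 0 < _ - eps * ?a / ?b => set (u := a) in *; replace (eps * u / b) with (eps * (u * / b)) by (unfold Rdiv; ring);
          set (q := u * / b) in * end.
        assert (Rabs (eps * q) <= Rabs eps * M) by (rewrite Rabs_mult; apply Rmult_le_compat_l; [apply Rabs_pos | auto]).
        assert (eps * q <= Rabs (eps * q)) by apply Rle_abs. lra. }
    intros s Hs Hp Hk.
    destruct (family_ell2 Z th s eps HZ Hb Hs) as [E1 E2].
    destruct (family_ranges eps Z HZ Hb th s Hs) as [B1 B2].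
    assert (Pr := fr_pos eps Z HZ Hb th s Hs). assert (PL := fL_pos eps Z HZ Hb th s Hs).
    assert (Hcos : 0 < cos (fg Z th s)).
    { rewrite E1 in Hk. apply Rmult_lt_reg_l with (fr Z th s * Z th s 0%nat); nra. }
    assert (Hsin : sin (fg Z th s) = 0).
    { unfold fp, radmom in Hp. fold (fL Z th s) in Hp.
      apply Rmult_integral in Hp. destruct Hp as [Hp | Hp].
      - apply Rmult_integral in Hp. lra.
      - exfalso. revert Hp. apply Rinv_neq_0_compat. nra. }
    destruct (Req_dec s 0) as [| N0]; auto. destruct (Req_dec s P) as [| N1]; auto. exfalso.
    assert (G1 := Hmono 0 s ltac:(lra) ltac:(lra) ltac:(lra)). rewrite (fg_0 eps Z HZ) in G1.
    assert (G2 := Hmono s P ltac:(lra) ltac:(lra) ltac:(lra)). rewrite (fg_end eps Z HZ) in G2.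
    destruct (Rtotal_order (fg Z th s) PI) as [T | [T | T]].
    + assert (0 < sin (fg Z th s)) by (apply sin_gt_0; auto). lra.
    + rewrite T, cos_PI in Hcos. lra.
    + assert (sin (fg Z th s) < 0) by (apply sin_lt_0; auto). lra.
Qed.

(** The first estimate will separate the winding numbers; the second, which concerns
    [dt / ds = r^2 / L], will give the period. *)
Lemma family_near_star : exists K, forall eps Z, is_family eps Z -> C * Rabs eps <= box_size ->
  forall th s, 0 <= s <= P -> Rabs (fL Z th s - angmom lam ws) <= K * Rabs eps /\
   Rabs (fr Z th s ^ 2 / fL Z th s - radius kap lam D (ws * s) ws ^ 2 / angmom lam ws) <= K * Rabs eps.
Proof.
  assert (B1 := BL_cr kap lam D ws P D_bounds ws_bounds P_ge_0).
  assert (B3 := BL_angmom lam ws lam_pos ws_bounds).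
  assert (B4 := BL_angmom_inv lam ws lam_pos ws_bounds).
  assert (B7 := BL_mult pt dist_pt dist_pt_ge_0 _ _ (BL_pow pt dist_pt dist_pt_ge_0 _ 2 B1) B4).
  destruct (BL_common _ B3) as [K3 [PK3 F3]]. specialize (F3 K3 (Rle_refl _)).
  destruct (BL_common _ B7) as [K7 [PK7 F7]]. specialize (F7 K7 (Rle_refl _)).
  exists ((K3 + K7) * (3 * C)). intros eps Z HZ Hb th s Hs.
  destruct (family_clamps eps Z HZ Hb th s Hs) as [E1 [E2 [E3 [E4 [E5 E6]]]]].
  assert (Dd := family_dist_star eps Z HZ th s Hs).
  set (x := (s, th, Z th s)) in *. set (y := (s, th, vec3 D 0 ws)) in *.
  assert (G1 : cS P y = s) by (now apply clamp_id).
  assert (G2 : cw ws y = ws) by (apply clamp_id; simpl; lra).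
  assert (G3 : cA kap D y = D) by (apply clamp_id; simpl; lra).
  assert (G4 : cr kap lam D ws P y = radius kap lam D (ws * s) ws).
  { unfold cr, cg. rewrite G1, G2, G3. f_equal. simpl. ring. }
  assert (A3 := proj2 F3 x y). assert (A7 := proj2 F7 x y). cbv beta in A3, A7.
  rewrite E4, G2 in A3. rewrite E4, E6, G2, G4 in A7. fold (fL Z th s) in A3, A7.
  assert (Q := Rabs_pos eps). assert (Dp := dist_pt_ge_0 x y).
  assert (0 <= K3 * (3 * C * Rabs eps)) by (repeat apply Rmult_le_pos; lra).
  assert (0 <= K7 * (3 * C * Rabs eps)) by (repeat apply Rmult_le_pos; lra).
  assert (K3 * dist_pt x y <= K3 * (3 * C * Rabs eps)) by (apply Rmult_le_compat_l; auto).
  assert (K7 * dist_pt x y <= K7 * (3 * C * Rabs eps)) by (apply Rmult_le_compat_l; auto).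
  split; [lra |]. unfold Rdiv. lra.
Qed.

End Family.

(** * Time parametrization *)

(** The orbit in the polar angle, stripped of the orbital elements; the last clause singles out the
    pericentre and will yield the minimal period. *)
Definition closed_orbit (kap lam eps : R) (U : R -> R -> R) (H P th0 : R) (r p L : R -> R) : Prop :=
  (forall s, 0 <= s <= P -> 0 < r s /\ 0 < L s /\
     is_derive r s (r s ^ 2 * p s / L s) /\
     is_derive p s ((L s ^ 2 / r s - 2 * lam / r s - kap + eps * r s ^ 2 * polar_r U (r s) (th0 + s)) / L s) /\
     is_derive L s (eps * r s ^ 2 * polar_t U (r s) (th0 + s) / L s) /\
     mech_energy kap lam eps U (r s) (p s) (L s) (th0 + s) = H) /\
  r P = r 0 /\ L P = L 0 /\ p 0 = 0 /\ p P = 0 /\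
  kap * r 0 < L 0 ^ 2 - 2 * lam /\
  (forall s, 0 <= s <= P -> p s = 0 -> kap * r s < L s ^ 2 - 2 * lam -> s = 0 \/ s = P).

Lemma closed_orbits (kap lam H : R) (U : R -> R -> R) (k : nat) :
  0 < kap -> 0 < lam -> H < 0 -> Ck 2 U -> (2 <= k)%nat -> 0 < kap ^ 2 + 4 * H * qstar lam k ->
  exists K e, 0 < e /\ forall eps, Rabs eps <= e ->
  exists (a b : R) (r p L : R -> R -> R),
    0 <= a < 2 * PI /\ 0 <= b < 2 * PI /\ a <> b /\
    forall th, th = a \/ th = b ->
      closed_orbit kap lam eps U H (turn k) th (r th) (p th) (L th) /\
      forall s, 0 <= s <= turn k ->
        Rabs (L th s - angmom lam (wstar k)) <= K * Rabs eps /\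
        Rabs (r th s ^ 2 / L th s -
          radius kap lam (Dstar kap lam H k) (wstar k * s) (wstar k) ^ 2 / angmom lam (wstar k)) <= K * Rabs eps.
Proof.
  intros Hk Hl HH HU Hk2 Hnc.
  destruct (orbit_family kap lam H U k Hk Hl HH HU Hk2 Hnc) as [C [e0 [PC [Pe0 Hfam]]]].
  assert (BD := Dstar_bounds kap lam H k Hk Hl HH Hk2 Hnc). assert (Bw := wstar_bounds k Hk2).
  set (D := Dstar kap lam H k) in *. set (ws := wstar k) in *.
  assert (Tp := turn_pos k Hk2).
  destruct (action_exists kap lam H D ws k U Hl BD Bw Hk2 HU C PC) as [K1 HS].
  destruct (family_closes kap lam H D ws k U Hl BD Bw Hk2 HU C) as [e1 [Pe1 Hclose]].
  destruct (family_apsis kap lam H D ws k U Hl BD Bw Hk2 HU C) as [e2 [Pe2 Haps]].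
  destruct (family_near_star kap lam H D ws k U Hl BD Bw Hk2 C PC) as [K2 Hnear].
  assert (Pb := box_size_pos kap D ws BD Bw).
  set (e := Rmin (Rmin 1 e0) (Rmin (Rmin e1 e2) (box_size kap D ws / C))).
  exists K2, e. split.
  { unfold e. repeat apply Rmin_pos; try lra. now apply Rdiv_lt_0_compat. }
  intros eps He.
  destruct (Rmin_le _ _ _ He) as [I1 I2]. destruct (Rmin_le _ _ _ I1) as [I3 I4].
  destruct (Rmin_le _ _ _ I2) as [I5 I6]. destruct (Rmin_le _ _ _ I5) as [I7 I8].
  assert (Hbox : C * Rabs eps <= box_size kap D ws).
  { apply Rle_trans with (C * (box_size kap D ws / C)); [apply Rmult_le_compat_l; lra |].
    right. field. lra. }
  destruct (Hfam eps ltac:(lra)) as [Z HZ].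
  change (is_family kap lam H D ws k U C eps Z) in HZ.
  destruct (HS eps Z HZ Hbox ltac:(lra)) as [S [Sper Svar]].
  destruct (two_critical_points S (fun th => fL lam Z th (turn k) - fL lam Z th 0) K1 (2 * PI)
    ltac:(generalize PI_RGT_0; lra) Sper Svar) as [a [b [Ha [Hb [Hab [Ga Gb]]]]]].
  exists a, b, (fr kap lam Z), (fp lam Z), (fL lam Z).
  split; [auto |]. split; [auto |]. split; [auto |].
  intros th Hth.
  assert (EL : fL lam Z th (turn k) = fL lam Z th 0).
  { destruct Hth; subst th; lra. }
  assert (Er := Hclose eps Z HZ Hbox ltac:(lra) th EL).
  destruct (Haps eps Z HZ Hbox ltac:(lra) th) as [A1 A2].
  split; [| intros s Hs; now apply Hnear].
  refine (conj _ (conj Er (conj EL (conj (fp_0 kap lam H D ws k U C eps Z HZ th)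
    (conj (fp_end kap lam H D ws k U C eps Z HZ th) (conj A1 A2)))))).
  - intros s Hs.
    assert (M1 := fr_pos kap lam H D ws k U Hl BD Bw C eps Z HZ Hbox th s Hs).
    assert (M2 := fL_pos kap lam H D ws k U Hl BD Bw C eps Z HZ Hbox th s Hs).
    assert (M3 := fr_derive kap lam H D ws k U Hl BD Bw C eps Z HZ Hbox th s Hs).
    assert (M4 := fp_derive kap lam H D ws k U Hl BD Bw C eps Z HZ Hbox th s Hs).
    assert (M5 := fL_derive kap lam H D ws k U Hl BD Bw C eps Z HZ Hbox th s Hs).
    assert (M6 := family_energy kap lam H D ws k U Hl BD Bw HU C eps Z HZ Hbox th s Hs).
    auto 10.
Qed.

Definition ang_momentum (x : R -> R * R) (t : R) : R := fst (x t) * vel2 x t - snd (x t) * vel1 x t.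
Definition radial_speed (x : R -> R * R) (t : R) : R := fst (x t) * vel1 x t + snd (x t) * vel2 x t.

(* The apsides of the kind (pericentre) at which the orbits are started. *)
Definition at_pericentre (kap lam : R) (x : R -> R * R) (t : R) : Prop :=
  radial_speed x t = 0 /\ kap * nrm (x t) < ang_momentum x t ^ 2 - 2 * lam.

Lemma chain_rule (f g : R -> R) (x df dg : R) :
  is_derive f (g x) df -> is_derive g x dg -> is_derive (fun t => f (g t)) x (dg * df).
Proof. exact (is_derive_comp f g x df dg). Qed.

Lemma Derive_shift (f : R -> R) (s t : R) : Derive (fun u => f (u + s)) t = Derive f (t + s).
Proof.
  unfold Derive. f_equal. apply Lim_ext. intro h. now replace (t + h + s) with (t + s + h) by ring.
Qed.

Lemma velocity_shift (x y : R -> R * R) (s : R) :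
  (forall t, x t = y (t + s)) -> forall t, vel1 x t = vel1 y (t + s) /\ vel2 x t = vel2 y (t + s).
Proof.
  intros E t. unfold vel1, vel2.
  rewrite <- (Derive_shift (fun u => fst (y u)) s t), <- (Derive_shift (fun u => snd (y u)) s t).
  split; apply Derive_ext; intro; now rewrite E.
Qed.

(** Both notions are built from position and velocity alone. Applied to [x] itself, the lemma bounds
    periods from below; applied to two solutions, it tells them apart. *)
Lemma invariants_shift kap lam (x y : R -> R * R) (s : R) :
  (forall t, x t = y (t + s)) -> forall t,
  ang_momentum x t = ang_momentum y (t + s) /\
  (at_pericentre kap lam x t -> at_pericentre kap lam y (t + s)).
Proof.
  intros E t. destruct (velocity_shift x y s E t) as [V1 V2].
  unfold at_pericentre, ang_momentum, radial_speed. rewrite V1, V2, E. auto.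
Qed.

Lemma trig_turn (k : nat) (n : Z) (a : R) :
  cos (a + turn k * IZR n) = cos a /\ sin (a + turn k * IZR n) = sin a.
Proof.
  assert (E : turn k * IZR n = 2 * PI * IZR (Z.of_nat k * n)).
  { unfold turn. rewrite mult_IZR, <- INR_IZR_INZ. ring. }
  rewrite E. split.
  - apply (periodic_shift cos (2 * PI)). intro x. rewrite cos_plus, cos_2PI, sin_2PI. ring.
  - apply (periodic_shift sin (2 * PI)). intro x. rewrite sin_plus, cos_2PI, sin_2PI. ring.
Qed.

Section TimeParametrization.

Variables kap lam eps H th0 : R.
Variable U : R -> R -> R.
Variable k : nat.
Variables r p L : R -> R.
Hypothesis k_ge_2 : (2 <= k)%nat.
Let P := turn k.
Hypothesis orbit : closed_orbit kap lam eps U H P th0 r p L.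

Let rp := periodized P r.
Let pp := periodized P p.
Let Lp := periodized P L.

Let Ppos : 0 < P := turn_pos k k_ge_2.

Lemma polar_r_turn r0 th n : polar_r U r0 (th + P * IZR n) = polar_r U r0 th.
Proof. unfold polar_r. destruct (trig_turn k n th) as [E1 E2]. unfold P. now rewrite E1, E2. Qed.

Lemma polar_t_turn r0 th n : polar_t U r0 (th + P * IZR n) = polar_t U r0 th.
Proof. unfold polar_t. destruct (trig_turn k n th) as [E1 E2]. unfold P. now rewrite E1, E2. Qed.

Lemma polar_turn_Z r0 th n : polar U r0 (th + P * IZR n) = polar U r0 th.
Proof. unfold polar. destruct (trig_turn k n th) as [E1 E2]. unfold P. now rewrite E1, E2. Qed.

Lemma periodized_point s : exists (n : Z) (u : R), 0 <= u < P /\ s = u + P * IZR n /\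
  rp s = r u /\ pp s = p u /\ Lp s = L u.
Proof.
  assert (B := Int_part_scaled P s Ppos). cbv zeta in B.
  exists (Int_part (s / P)), (s - P * IZR (Int_part (s / P))).
  split; [lra |]. split; [ring |]. unfold rp, pp, Lp.
  repeat split; now apply periodized_eq.
Qed.

(** At the seams the right-hand sides match, because [r], [p], [L] take the same values at both ends
    and the potential has period [2 PI] in the angle. *)
Lemma extended_motion s : 0 < rp s /\ 0 < Lp s /\
   is_derive rp s (rp s ^ 2 * pp s / Lp s) /\
   is_derive pp s ((Lp s ^ 2 / rp s - 2 * lam / rp s - kap + eps * rp s ^ 2 * polar_r U (rp s) (th0 + s)) / Lp s) /\
   is_derive Lp s (eps * rp s ^ 2 * polar_t U (rp s) (th0 + s) / Lp s) /\
   mech_energy kap lam eps U (rp s) (pp s) (Lp s) (th0 + s) = H.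
Proof.
  destruct orbit as [Hs [Er [EL [E0 [E1 _]]]]].
  destruct (periodized_point s) as [n [u [Hu [Es [Q1 [Q2 Q3]]]]]].
  destruct (Hs u ltac:(lra)) as [Pr [PL [Dr [Dp [DL En]]]]].
  assert (Hend : forall q th, polar_r U q (th + P) = polar_r U q th /\ polar_t U q (th + P) = polar_t U q th).
  { intros q th. split; [rewrite <- (polar_r_turn q th 1) | rewrite <- (polar_t_turn q th 1)]; do 2 f_equal; simpl; ring. }
  assert (Gr := is_derive_periodized P r (fun s => r s ^ 2 * p s / L s) s Ppos).
  assert (Gp := is_derive_periodized P p (fun s => (L s ^ 2 / r s - 2 * lam / r s - kap + eps * r s ^ 2 * polar_r U (r s) (th0 + s)) / L s) s Ppos).
  assert (GL := is_derive_periodized P L (fun s => eps * r s ^ 2 * polar_t U (r s) (th0 + s) / L s) s Ppos).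
  assert (Eu : s - P * IZR n = u) by lra.
  assert (Hran : P * IZR n <= s < P * IZR n + P) by lra.
  rewrite (periodized_eq P _ s n Ppos Hran), Eu in Gr.
  rewrite (periodized_eq P _ s n Ppos Hran), Eu in Gp.
  rewrite (periodized_eq P _ s n Ppos Hran), Eu in GL.
  rewrite Q1, Q2, Q3.
  replace (th0 + s) with ((th0 + u) + P * IZR n) by lra.
  unfold mech_energy. rewrite polar_r_turn, polar_t_turn, polar_turn_Z.
  split; auto. split; auto. split; [| split; [| split; [| exact En]]].
  - apply Gr; auto; [intros t Ht; apply Hs; auto | now rewrite Er, E1, E0, EL].
  - apply Gp; auto; [intros t Ht; apply Hs; auto | now rewrite E1, E0 |].
    rewrite Rplus_0_r. destruct (Hend (r P) th0) as [K1 _]. rewrite K1. now rewrite Er, EL.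
  - apply GL; auto; [intros t Ht; apply Hs; auto |].
    rewrite Rplus_0_r. destruct (Hend (r P) th0) as [_ K1]. rewrite K1. now rewrite Er, EL.
Qed.

(** Time is the primitive of [r^2 / L], a continuous positive periodic function and hence bounded
    below, so that the angle is in turn a differentiable function [sg] of time. *)
Lemma time_change : exists tm sg : R -> R,
  tm 0 = 0 /\ (forall s, is_derive tm s (rp s ^ 2 / Lp s)) /\
  (forall s, tm (s + P) = tm s + tm P) /\
  (forall s, sg (tm s) = s) /\ (forall u, tm (sg u) = u) /\
  (forall u, is_derive sg u (Lp (sg u) / rp (sg u) ^ 2)).
Proof.
  assert (Hm := extended_motion).
  set (tau := fun s => rp s ^ 2 / Lp s).
  assert (Hc : forall s, continuous tau s).
  { intro s. apply (ex_derive_continuous tau s). destruct (Hm s) as [Pr [PL [Dr [_ [DL _]]]]].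
    unfold tau. auto_derive. repeat split; try (eexists; eassumption). lra. }
  assert (Hper : forall s, tau (s + P) = tau s).
  { intro s. unfold tau, rp, Lp. now rewrite !periodized_period. }
  assert (Hmin : exists c, 0 < c /\ forall s, c <= tau s).
  { destruct (continuity_ab_min tau 0 P) as [c [Hc1 Hc2]]; [lra | |].
    - intros s _. apply continuity_pt_filterlim, Hc.
    - exists (tau c). split.
      + unfold tau. destruct (Hm c) as [Pr [PL _]]. apply Rdiv_lt_0_compat; auto. now apply pow_lt.
      + intro s. assert (B := Int_part_scaled P s Ppos). cbv zeta in B.
        rewrite <- (periodic_shift tau P (- Int_part (s / P)) s Hper). apply Hc1.
        rewrite opp_IZR. lra. }
  destruct Hmin as [c [Pc Hmin]].
  set (tm := fun s => RInt tau 0 s).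
  assert (Dt : forall s, is_derive tm s (tau s)) by (intro; apply is_derive_primitive, Hc).
  destruct (inverse_of_expanding tm tau c Pc Dt Hmin) as [sg [S1 [S2 S3]]].
  assert (T0 : tm 0 = 0) by (unfold tm; now rewrite RInt_point).
  exists tm, sg. split; [auto |]. split; [auto |]. split; [| split; [auto | split; [auto |]]].
  - assert (Hd : forall t, is_derive (fun s => tm (s + P) - tm s) t 0).
    { intro t. replace 0 with (minus (tau (t + P)) (tau t)).
      - apply (is_derive_minus (fun s => tm (s + P)) tm); auto. apply is_derive_shift, Dt.
      - rewrite Hper. unfold minus, plus, opp; simpl. ring. }
    intro s. assert (E : tm (s + P) - tm s = tm (0 + P) - tm 0).
    { destruct (Rle_dec 0 s).
      - apply (derive_zero_const (fun s => tm (s + P) - tm s) 0 s); auto.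
      - symmetry. apply (derive_zero_const (fun s => tm (s + P) - tm s) s 0); auto. lra. }
    rewrite Rplus_0_l, T0 in E. lra.
  - intro u. destruct (Hm (sg u)) as [Pr [PL _]].
    replace (Lp (sg u) / rp (sg u) ^ 2) with (/ tau (sg u)) by (unfold tau; field; lra). auto.
Qed.

(** In time, the polar angle is [th0 + sg t] and gains [P = 2 PI k] over [T = tm P], whence the
    winding number. A smaller period would carry the pericentre at time 0 to one at an elapsed angle
    strictly between 0 and [P]. *)
Lemma orbit_to_solution : exists (x : R -> R * R) (T : R) (tm : R -> R),
  is_solution 1 kap lam eps U x /\ (forall t, energy 1 kap lam eps U x t = H) /\
  minimal_period x T /\ winding_number x T (Z.of_nat k) /\
  (tm 0 = 0 /\ tm P = T /\ forall s, 0 <= s <= P -> is_derive tm s (r s ^ 2 / L s)) /\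
  (exists q, 0 < q /\ x 0 = (q * cos th0, q * sin th0)) /\
  at_pericentre kap lam x 0 /\ (forall t, at_pericentre kap lam x t -> x t = x 0) /\
  (forall t, exists s, 0 <= s <= P /\ ang_momentum x t = L s).
Proof.
  destruct time_change as [tm [sg [T0 [Dt [Tper [S1 [S2 S3]]]]]]].
  assert (Hm := extended_motion).
  set (rho := fun t => rp (sg t)). set (pi := fun t => pp (sg t)). set (l := fun t => Lp (sg t)).
  set (th := fun t => th0 + sg t).
  set (Wr := fun t => polar_r U (rho t) (th t)). set (Wt := fun t => polar_t U (rho t) (th t)).
  assert (Prho : forall t, 0 < rho t) by (intro t; apply Hm).
  assert (Pl : forall t, 0 < l t) by (intro t; apply Hm).
  assert (Dsg : forall t, is_derive sg t (l t / rho t ^ 2)) by (intro; apply S3).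
  assert (Drho : forall t, is_derive rho t (pi t)).
  { intro t. destruct (Hm (sg t)) as [Pr [PL [Dr [Dp [DL En]]]]].
    replace (pi t) with (l t / rho t ^ 2 * (rp (sg t) ^ 2 * pp (sg t) / Lp (sg t))).
    - apply (chain_rule rp sg); auto.
    - unfold pi, l, rho. field. lra. }
  assert (Dpi : forall t, is_derive pi t ((l t ^ 2 / rho t - 2 * lam / rho t - kap + eps * rho t ^ 2 * Wr t) / rho t ^ 2)).
  { intro t. destruct (Hm (sg t)) as [Pr [PL [Dr [Dp [DL En]]]]].
    replace ((l t ^ 2 / rho t - 2 * lam / rho t - kap + eps * rho t ^ 2 * Wr t) / rho t ^ 2) with
      (l t / rho t ^ 2 * ((Lp (sg t) ^ 2 / rp (sg t) - 2 * lam / rp (sg t) - kap + eps * rp (sg t) ^ 2 * polar_r U (rp (sg t)) (th0 + sg t)) / Lp (sg t))).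
    - apply (chain_rule pp sg); auto.
    - unfold Wr, th, l, rho. field. lra. }
  assert (Dl : forall t, is_derive l t (eps * Wt t)).
  { intro t. destruct (Hm (sg t)) as [Pr [PL [Dr [Dp [DL En]]]]].
    replace (eps * Wt t) with
      (l t / rho t ^ 2 * (eps * rp (sg t) ^ 2 * polar_t U (rp (sg t)) (th0 + sg t) / Lp (sg t))).
    - apply (chain_rule Lp sg); auto.
    - unfold Wt, th, l, rho. field. lra. }
  assert (Hen : forall t, mech_energy kap lam eps U (rho t) (pi t) (l t) (th t) = H) by (intro; apply Hm).
  assert (Dth : forall t, is_derive th t (l t / rho t ^ 2)).
  { intro t. unfold th. replace (l t / rho t ^ 2) with (plus 0 (l t / rho t ^ 2)).
    - apply (is_derive_plus (fun _ => th0) sg); auto. apply (@is_derive_const R_AbsRing R_NormedModule).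
    - unfold plus; simpl. ring. }
  assert (Hsc : forall t, sin (th t) ^ 2 = 1 - cos (th t) ^ 2).
  { intro t. generalize (sin2_cos2 (th t)). unfold Rsqr. intro. lra. }
  assert (Hpoint : forall t, exists (n : Z) (u : R), 0 <= u < P /\ sg t = u + P * IZR n /\
    rho t = r u /\ pi t = p u /\ l t = L u) by (intro; apply periodized_point).
  assert (Hrp0 : forall u, 0 <= u < P -> rp u = r u /\ pp u = p u /\ Lp u = L u).
  { intros u Hu. unfold rp, pp, Lp.
    rewrite !(periodized_eq P _ u 0 Ppos) by (simpl; lra). simpl.
    now replace (u - P * 0) with u by ring. }
  assert (Hmono : forall a b, a < b -> tm a < tm b).
  { intros a b Hab. apply (derive_pos_lt tm (fun s => rp s ^ 2 / Lp s)); auto.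
    intros t _. destruct (Hm t) as [Pr [PL _]]. apply Rdiv_lt_0_compat; auto. now apply pow_lt. }
  assert (Hsg0 : sg 0 = 0) by (rewrite <- T0 at 1; auto).
  assert (HsgT : forall t, sg (t + tm P) = sg t + P).
  { intro t. rewrite <- (S1 (sg t + P)), Tper, S2. auto. }
  set (x := fun t => (rho t * cos (th t), rho t * sin (th t))).
  assert (Dx1 : forall t, is_derive (fun s => fst (x s)) t (pi t * cos (th t) - l t / rho t * sin (th t))).
  { intro t. specialize (Drho t). specialize (Dth t). specialize (Prho t).
    simpl. clearbody rho th.
    auto_derive; [repeat split; eexists; eassumption |]. rewrite_derivatives. field. lra. }
  assert (Dx2 : forall t, is_derive (fun s => snd (x s)) t (pi t * sin (th t) + l t / rho t * cos (th t))).
  { intro t. specialize (Drho t). specialize (Dth t). specialize (Prho t).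
    simpl. clearbody rho th.
    auto_derive; [repeat split; eexists; eassumption |]. rewrite_derivatives. field. lra. }
  assert (V1 : forall t, vel1 x t = pi t * cos (th t) - l t / rho t * sin (th t)) by (intro; now apply derive_value).
  assert (V2 : forall t, vel2 x t = pi t * sin (th t) + l t / rho t * cos (th t)) by (intro; now apply derive_value).
  assert (Hn : forall t, nrm (x t) = rho t).
  { intro t. unfold nrm, x; simpl fst; simpl snd.
    replace ((rho t * cos (th t)) ^ 2 + (rho t * sin (th t)) ^ 2) with (rho t ^ 2).
    - apply sqrt_pow2. left. auto.
    - rewrite !Rpow_mult_distr, Hsc. ring. }
  assert (Ham : forall t, ang_momentum x t = l t).
  { intro t. unfold ang_momentum. rewrite V1, V2. simpl.
    transitivity (l t * (cos (th t) ^ 2 + sin (th t) ^ 2)); [field; specialize (Prho t); lra |].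
    rewrite Hsc. ring. }
  assert (Hrs : forall t, radial_speed x t = rho t * pi t).
  { intro t. unfold radial_speed. rewrite V1, V2. simpl.
    transitivity (rho t * pi t * (cos (th t) ^ 2 + sin (th t) ^ 2)); [field; specialize (Prho t); lra |].
    rewrite Hsc. ring. }
  destruct orbit as [_ [Er [EL [E0 [E1 [Hper0 Haps]]]]]].
  assert (Hperi : forall t, at_pericentre kap lam x t -> exists n, sg t = P * IZR n).
  { intros t [R1 R2]. rewrite Hrs in R1. rewrite Hn, Ham in R2.
    destruct (Hpoint t) as [n [u [Hu [Es [Q1 [Q2 Q3]]]]]].
    apply Rmult_integral in R1. destruct R1 as [R1 | R1]; [specialize (Prho t); lra |].
    rewrite Q2 in R1. rewrite Q1, Q3 in R2.
    destruct (Haps u ltac:(lra) R1 R2); [| lra]. exists n. lra. }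
  assert (Q0 : rho 0 = r 0 /\ pi 0 = p 0 /\ l 0 = L 0).
  { unfold rho, pi, l. rewrite Hsg0. apply Hrp0. lra. }
  destruct Q0 as [Qr [Qp Ql]].
  assert (Hp0 : at_pericentre kap lam x 0).
  { split; [rewrite Hrs, Qp, E0; ring | rewrite Hn, Ham, Qr, Ql; auto]. }
  assert (Hrper : forall t, rho (t + tm P) = rho t /\ pi (t + tm P) = pi t /\ l (t + tm P) = l t).
  { intro t. unfold rho, pi, l. rewrite HsgT. unfold rp, pp, Lp. now rewrite !periodized_period. }
  assert (Hxper : is_period x (tm P)).
  { intro t. destruct (Hrper t) as [K1 _]. unfold x. rewrite K1.
    assert (Eth : th (t + tm P) = th t + turn k * IZR 1) by (unfold th; rewrite HsgT; unfold P; simpl; ring).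
    rewrite Eth. destruct (trig_turn k 1 (th t)) as [C1 C2]. now rewrite C1, C2. }
  exists x, (tm P), tm.
  split; [| split; [| split; [| split; [| split; [| split; [| split; [auto | split]]]]]]].
  - intro t. split; [| split; [| split]].
    + intro E. assert (N := Hn t). rewrite E in N. unfold nrm in N. simpl in N.
      replace (0 * (0 * 1) + 0 * (0 * 1)) with 0 in N by ring. rewrite sqrt_0 in N. specialize (Prho t). lra.
    + rewrite V1. apply Dx1.
    + rewrite V2. apply Dx2.
    (* The Cartesian components of the acceleration with radial part
       [- 2 lam / r^3 - kap / r^2 + eps polar_r] and transverse part [eps polar_t / r]. *)
    + exists (cos (th t) * (- 2 * lam / rho t ^ 3 - kap / rho t ^ 2 + eps * Wr t) - sin (th t) * (eps * Wt t / rho t)).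
      exists (sin (th t) * (- 2 * lam / rho t ^ 3 - kap / rho t ^ 2 + eps * Wr t) + cos (th t) * (eps * Wt t / rho t)).
      rewrite Hn. simpl fst. simpl snd.
      assert (Ux : d1 U (rho t * cos (th t)) (rho t * sin (th t)) = Wr t * cos (th t) - Wt t / rho t * sin (th t)).
      { unfold Wr, Wt, polar_r, polar_t. set (u1 := d1 U _ _). set (u2 := d2 U _ _).
        transitivity (u1 * (cos (th t) ^ 2 + sin (th t) ^ 2)); [rewrite Hsc; ring | field; specialize (Prho t); lra]. }
      assert (Uy : d2 U (rho t * cos (th t)) (rho t * sin (th t)) = Wr t * sin (th t) + Wt t / rho t * cos (th t)).
      { unfold Wr, Wt, polar_r, polar_t. set (u1 := d1 U _ _). set (u2 := d2 U _ _).
        transitivity (u2 * (cos (th t) ^ 2 + sin (th t) ^ 2)); [rewrite Hsc; ring | field; specialize (Prho t); lra]. }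
      rewrite Ux, Uy.
      specialize (Drho t). specialize (Dth t). specialize (Dpi t). specialize (Dl t).
      assert (Pt := Prho t).
      split; [| split; [| split]].
      * apply (is_derive_ext (fun t => pi t * cos (th t) - l t / rho t * sin (th t))); [intro; now rewrite V1 |].
        clearbody Wr Wt. clear - Drho Dth Dpi Dl Pt. clearbody rho pi l th.
        auto_derive; [repeat split; try (eexists; eassumption); lra |]. rewrite_derivatives. field. lra.
      * apply (is_derive_ext (fun t => pi t * sin (th t) + l t / rho t * cos (th t))); [intro; now rewrite V2 |].
        clearbody Wr Wt. clear - Drho Dth Dpi Dl Pt. clearbody rho pi l th.
        auto_derive; [repeat split; try (eexists; eassumption); lra |]. rewrite_derivatives. field. lra.
      * field. lra.
      * field. lra.
  - intro t. rewrite <- (Hen t). unfold energy, mech_energy. rewrite V1, V2, Hn. simpl fst. simpl snd.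
    change (U (rho t * cos (th t)) (rho t * sin (th t))) with (polar U (rho t) (th t)).
    transitivity (1 / 2 * (pi t ^ 2 + (l t / rho t) ^ 2) * (cos (th t) ^ 2 + sin (th t) ^ 2) - kap / rho t - lam / rho t ^ 2 - eps * polar U (rho t) (th t));
     [field; specialize (Prho t); lra |].
    rewrite Hsc. field. specialize (Prho t). lra.
  - split; [rewrite <- T0; now apply Hmono | split; [auto |]].
    intros T' HT' Hp'.
    assert (Hp'' : at_pericentre kap lam x (0 + T')).
    { destruct (invariants_shift kap lam x x T' (fun t => eq_sym (Hp' t)) 0) as [_ K]. now apply K. }
    rewrite Rplus_0_l in Hp''. destruct (Hperi T' Hp'') as [n Hn'].
    assert (L1 : 0 < sg T').
    { destruct (Rlt_dec 0 (sg T')); auto. exfalso.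
      assert (tm (sg T') <= tm 0).
      { destruct (Req_dec (sg T') 0) as [Ez | Ez]; [rewrite Ez; lra | left; apply Hmono; lra]. }
      rewrite S2, T0 in H0. lra. }
    assert (L2 : sg T' < P).
    { destruct (Rlt_dec (sg T') P); auto. exfalso.
      assert (tm P <= tm (sg T')).
      { destruct (Req_dec (sg T') P) as [Ez | Ez]; [rewrite Ez; lra | left; apply Hmono; lra]. }
      rewrite S2 in H0. lra. }
    rewrite Hn' in L1, L2.
    assert (0 < n)%Z by (apply lt_IZR; nra). assert (n < 1)%Z by (apply lt_IZR; nra). lia.
  - exists th. split; [| split].
    + intro t. apply (ex_derive_continuous th t). eexists. apply Dth.
    + intro t. rewrite Hn. split; reflexivity.
    + unfold th. rewrite Hsg0, S1. unfold P, turn. rewrite <- INR_IZR_INZ. ring.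
  - split; [auto | split; [auto |]]. intros s Hs. specialize (Dt s).
    (* At [s = P] the periodic extension takes its values from [s = 0], and closedness identifies
       them with those of [r] and [L] at [P]. *)
    destruct (Req_dec s P) as [Es | Es].
    + destruct (Hrp0 0 ltac:(lra)) as [K1 [_ K3]].
      assert (K1' : rp P = rp 0) by (rewrite <- (Rplus_0_l P) at 1; now apply periodized_period).
      assert (K3' : Lp P = Lp 0) by (rewrite <- (Rplus_0_l P) at 1; now apply periodized_period).
      rewrite Es, K1', K1, K3', K3, <- Er, <- EL in Dt. now rewrite Es.
    + destruct (Hrp0 s ltac:(lra)) as [K1 [_ K3]]. rewrite K1, K3 in Dt. auto.
  - exists (rho 0). split; [auto |]. unfold x, th. rewrite Hsg0. now rewrite Rplus_0_r.
  - intros t Ht. destruct (Hperi t Ht) as [n Hn'].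
    assert (Erho : rho t = rho 0).
    { destruct (Hpoint t) as [n' [u [Hu [Es [K1 _]]]]].
      assert (u = 0).
      { rewrite Hn' in Es. assert (Eu : u = P * IZR (n - n')) by (rewrite minus_IZR; lra).
        rewrite Eu in Hu. assert (-1 < n - n')%Z by (apply lt_IZR; simpl; nra).
        assert (n - n' < 1)%Z by (apply lt_IZR; nra).
        replace (n - n')%Z with 0%Z in Eu by lia. simpl in Eu. lra. }
      rewrite K1, Qr. now f_equal. }
    unfold x. rewrite Erho. unfold th. rewrite Hn', Hsg0, Rplus_0_r.
    destruct (trig_turn k n th0) as [C1 C2]. fold P in C1, C2. now rewrite C1, C2.
  - intro t. destruct (Hpoint t) as [n [u [Hu [_ [_ [_ K3]]]]]]. exists u. split; [lra |]. now rewrite Ham.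
Qed.

End TimeParametrization.

(** * Kepler's equation and conclusion *)

(* Kepler's equation: with [b = e / (1 + sqrt (1 - e^2))], the smooth branch of the eccentric anomaly
   is [f - 2 atan (b sin f / (1 + b cos f))], and its sine is [sqrt (1 - e^2) sin f / (1 + e cos f)]. *)
Definition mean_anomaly (e f : R) : R :=
  let n := sqrt (1 - e ^ 2) in let b := e / (1 + n) in
  f - 2 * atan (b * sin f / (1 + b * cos f)) - e * n * sin f / (1 + e * cos f).

(** Write [e = sin phi]: then [n = cos phi] and [b = tan (phi / 2)], and [Ee], [En2] are the
    half-angle formulas. They make the denominator in the derivative of the arctangent factor
    through [1 + e * cos f]. *)
Lemma mean_anomaly_derive (e f : R) : 0 < e < 1 ->
  is_derive (mean_anomaly e) f (sqrt (1 - e ^ 2) ^ 3 / (1 + e * cos f) ^ 2).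
Proof.
  intro He. set (n := sqrt (1 - e ^ 2)).
  assert (Pn : 0 < n) by (apply sqrt_lt_R0; nra).
  assert (En : n ^ 2 = 1 - e ^ 2) by (apply pow2_sqrt; nra).
  set (b := e / (1 + n)).
  assert (Pb : 0 < b) by (apply Rdiv_lt_0_compat; lra).
  assert (Eb : b * (1 + n) = e) by (unfold b; field; lra).
  assert (Hb : b < 1) by nra.
  assert (Ee : e * (1 + b ^ 2) = 2 * b).
  { apply Rmult_eq_reg_r with ((1 + n) ^ 2); [| apply pow_nonzero; lra].
    transitivity (e * (1 + 2 * n + n ^ 2 + (b * (1 + n)) ^ 2)); [ring |].
    transitivity (2 * (b * (1 + n)) * (1 + n)); [| ring]. rewrite Eb, En. ring. }
  assert (En2 : n * (1 + b ^ 2) = 1 - b ^ 2).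
  { apply Rmult_eq_reg_r with ((1 + n) ^ 2); [| apply pow_nonzero; lra].
    transitivity (n * (1 + 2 * n + n ^ 2 + (b * (1 + n)) ^ 2)); [ring |].
    transitivity (1 + 2 * n + n ^ 2 - (b * (1 + n)) ^ 2); [| ring]. rewrite Eb.
    replace (e ^ 2) with (1 - n ^ 2) by lra. ring. }
  assert (HC := COS_bound f).
  assert (Hsc : sin f ^ 2 = 1 - cos f ^ 2) by (generalize (sin2_cos2 f); unfold Rsqr; intro; lra).
  assert (Q1 : 0 < 1 + b * cos f) by nra. assert (Q2 : 0 < 1 + e * cos f) by nra.
  unfold mean_anomaly. fold n. fold b.
  auto_derive; [repeat split; lra |].
  set (c := cos f) in *. set (z := sin f) in *.
  assert (Q3 : 1 + (b * z * / (1 + b * c)) ^ 2 = (1 + b ^ 2) * (1 + e * c) / (1 + b * c) ^ 2).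
  { replace ((1 + b ^ 2) * (1 + e * c)) with (1 + b ^ 2 + 2 * b * c) by (rewrite <- Ee; ring).
    rewrite !Rpow_mult_distr, Hsc. field. lra. }
  assert (P1 : 0 < 1 + b ^ 2) by nra.
  assert (Q4 : 1 + b ^ 2 + 2 * b * c = (1 + b ^ 2) * (1 + e * c)) by (rewrite <- Ee; ring).
  assert (X1 : b * (1 * c) * / (1 + b * c) + b * z * (- (b * (1 * - z)) * / ((1 + b * c) * (1 + b * c)))
     = (b * c + b ^ 2) / (1 + b * c) ^ 2).
  { transitivity ((b * c * (1 + b * c) + b ^ 2 * z ^ 2) / (1 + b * c) ^ 2); [field; lra |].
    rewrite Hsc. f_equal. ring. }
  assert (X2 : e * n * (1 * c) * / (1 + e * c) + e * n * z * (- (e * (1 * - z)) * / ((1 + e * c) * (1 + e * c)))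
     = e * n * (c + e) / (1 + e * c) ^ 2).
  { transitivity (e * n * (c * (1 + e * c) + e * z ^ 2) / (1 + e * c) ^ 2); [field; lra |].
    rewrite Hsc. f_equal. ring. }
  assert (X3 : 2 * ((b * c + b ^ 2) / (1 + b * c) ^ 2 * / ((1 + b ^ 2) * (1 + e * c) / (1 + b * c) ^ 2))
     = (e * c + 1 - n) / (1 + e * c)).
  { transitivity (2 * (b * c + b ^ 2) / ((1 + b ^ 2) * (1 + e * c))); [field; lra |].
    apply Rmult_eq_reg_r with ((1 + b ^ 2) * (1 + e * c)); [| nra].
    transitivity (2 * (b * c + b ^ 2)); [field; lra |].
    transitivity ((e * (1 + b ^ 2)) * c + (1 + b ^ 2) - n * (1 + b ^ 2)); [rewrite Ee, En2; ring | field; lra]. }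
  rewrite X1, X2. change (b * z * / (1 + b * c) * (b * z * / (1 + b * c) * 1)) with ((b * z * / (1 + b * c)) ^ 2).
  rewrite Q3, X3. replace (n ^ 3) with (n * n ^ 2) by ring. rewrite En. field. lra.
Qed.

Lemma mean_anomaly_turn (e : R) : mean_anomaly e (2 * PI) - mean_anomaly e 0 = 2 * PI.
Proof.
  unfold mean_anomaly. rewrite sin_2PI, sin_0, cos_2PI, cos_0, !Rmult_0_r.
  unfold Rdiv. rewrite !Rmult_0_l, atan_0. ring.
Qed.

Lemma angmom_decreasing lam a b : 0 < lam -> 1 < a < b -> angmom lam (/ b) < angmom lam (/ a).
Proof.
  intros Hl Hab. unfold angmom.
  assert (B1 : / b < / a) by (apply Rinv_lt_contravar; nra).
  assert (B2 : / a < 1) by (rewrite <- Rinv_1; apply Rinv_lt_contravar; lra).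
  assert (B3 : 0 < / b) by (apply Rinv_0_lt_compat; lra).
  assert (Q1 : 0 < 1 - (/ a) ^ 2) by nra. assert (Q2 : 1 - (/ a) ^ 2 < 1 - (/ b) ^ 2) by nra.
  apply sqrt_lt_1_alt. split.
  - left. apply Rdiv_lt_0_compat; lra.
  - apply Rmult_lt_compat_l; [lra |]. apply Rinv_lt_contravar; nra.
Qed.

Lemma polar_angle_unique q q' a b : 0 < q -> 0 < q' -> 0 <= a < 2 * PI -> 0 <= b < 2 * PI ->
  q * cos a = q' * cos b -> q * sin a = q' * sin b -> a = b.
Proof.
  intros Pq Pq' Ha Hb C S.
  assert (Sa := sin2_cos2 a). assert (Sb := sin2_cos2 b). unfold Rsqr in Sa, Sb.
  assert (Eq : q * q = q' * q').
  { transitivity ((q * cos a) * (q * cos a) + (q * sin a) * (q * sin a)).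
    - transitivity (q * q * (sin a * sin a + cos a * cos a)); [rewrite Sa |]; ring.
    - rewrite C, S. transitivity (q' * q' * (sin b * sin b + cos b * cos b)); [| rewrite Sb]; ring. }
  assert (q = q') by nra. subst q'.
  apply Rmult_eq_reg_l in C; [| lra]. apply Rmult_eq_reg_l in S; [| lra].
  assert (Hc : cos (a - b) = 1) by (rewrite cos_minus, C, S; lra).
  replace (a - b) with (2 * ((a - b) / 2)) in Hc by field. rewrite cos_2a_sin in Hc.
  assert (Hs : sin ((a - b) / 2) = 0) by nra.
  destruct (Rtotal_order a b) as [T | [T | T]]; auto; exfalso.
  - assert (0 < sin ((b - a) / 2)) by (apply sin_gt_0; lra).
    replace ((b - a) / 2) with (- ((a - b) / 2)) in H by field. rewrite sin_neg in H. lra.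
  - assert (0 < sin ((a - b) / 2)) by (apply sin_gt_0; lra). lra.
Qed.

(** * Period and distinctness for one winding number *)

Section Assembly.

Variables kap lam H : R.
Variable U : R -> R -> R.
Variable k : nat.
Hypothesis kap_pos : 0 < kap.
Hypothesis lam_pos : 0 < lam.
Hypothesis H_neg : H < 0.
Hypothesis U_C2 : Ck 2 U.
Hypothesis k_ge_2 : (2 <= k)%nat.
Hypothesis noncircular : 0 < kap ^ 2 + 4 * H * qstar lam k.

(** Up to the factor [kap / h ^ 3], which involves only [kap] and the energy, the integrand is the
    derivative of the mean anomaly at [w s] with eccentricity [D / kap]. As [w s] grows by [2 PI],
    so does the mean anomaly: this is Kepler's third law. *)
Lemma kepler_period : exists K : R -> R,
  (forall s, is_derive K s (radius kap lam (Dstar kap lam H k) (wstar k * s) (wstar k) ^ 2 / angmom lam (wstar k))) /\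
  K (turn k) - K 0 = 2 * PI * kap / sqrt (- 2 * H) ^ 3.
Proof.
  assert (BD := Dstar_bounds kap lam H k kap_pos lam_pos H_neg k_ge_2 noncircular).
  assert (Bw := wstar_bounds k k_ge_2). assert (ED := Dstar_sqr kap lam H k noncircular).
  assert (Tw := turn_wstar k k_ge_2). assert (Pq := qstar_pos lam k lam_pos k_ge_2).
  assert (Ell : ell2 lam (wstar k) = 2 * qstar lam k).
  { assert (K := INR_k_ge_2 k k_ge_2). unfold ell2, wstar, qstar. field. repeat split; nra. }
  destruct (angmom_sqr lam (wstar k) lam_pos Bw) as [PL _].
  assert (EL := ell2_angmom lam (wstar k) lam_pos Bw).
  set (D := Dstar kap lam H k) in *. set (w := wstar k) in *. set (L := angmom lam w) in *.
  set (q := qstar lam k) in *.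
  set (e := D / kap).
  assert (He : 0 < e < 1).
  { unfold e. split; [apply Rdiv_lt_0_compat; lra |]. apply Rmult_lt_reg_r with kap; auto.
    unfold Rdiv. rewrite Rmult_assoc, Rinv_l; lra. }
  set (h := sqrt (- 2 * H)). assert (Ph : 0 < h) by (apply sqrt_lt_R0; lra).
  assert (Eh : h ^ 2 = - 2 * H) by (apply pow2_sqrt; lra).
  (* From [kap ^ 2 - D ^ 2 = - 4 H q] and [w ^ 2 L ^ 2 = ell2 = 2 q]. *)
  assert (En : sqrt (1 - e ^ 2) = h * (w * L) / kap).
  { replace (1 - e ^ 2) with ((h * (w * L) / kap) ^ 2).
    - apply sqrt_pow2. apply Rdiv_le_0_compat; [| auto]. apply Rmult_le_pos; [lra |]. nra.
    - assert (E1 : h ^ 2 * (w ^ 2 * L ^ 2) = - 4 * H * q) by (rewrite <- EL, Ell, Eh; ring).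
      transitivity (h ^ 2 * (w ^ 2 * L ^ 2) / kap ^ 2); [field; lra |].
      rewrite E1. unfold e. transitivity ((kap ^ 2 - D ^ 2) / kap ^ 2); [rewrite ED; field; lra | field; lra]. }
  exists (fun s => kap / h ^ 3 * mean_anomaly e (w * s)). split.
  - intro s.
    assert (Dm := mean_anomaly_derive e (w * s) He).
    replace (radius kap lam D (w * s) w ^ 2 / L) with
      (kap / h ^ 3 * (w * (sqrt (1 - e ^ 2) ^ 3 / (1 + e * cos (w * s)) ^ 2))).
    + apply (is_derive_scal (fun s => mean_anomaly e (w * s)) s (kap / h ^ 3)).
      apply (chain_rule (mean_anomaly e) (fun s => w * s)); auto. auto_derive; auto; ring.
    + unfold radius. rewrite EL, En. unfold e.
      assert (HC := COS_bound (w * s)). assert (0 < kap + D * cos (w * s)) by nra.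
      field. repeat split; try lra.
  - rewrite (Rmult_comm w (turn k)), Tw, Rmult_0_r, <- Rmult_minus_distr_l, mean_anomaly_turn. field. lra.
Qed.

(** The last clause confines the angular momentum between its unperturbed values at the fictitious
    winding numbers [k - 1 / 2] and [k + 1 / 2]; these open intervals are disjoint for different
    [k], which separates solutions with different winding. *)
Definition good_orbit (eps vs : R) (x : R -> R * R) : Prop :=
  is_solution 1 kap lam eps U x /\ (forall t, energy 1 kap lam eps U x t = H) /\
  (exists T, minimal_period x T /\ Rabs (T - 2 * PI * kap / sqrt (- 2 * H) ^ 3) < vs /\
     winding_number x T (Z.of_nat k)) /\
  (forall t, angmom lam (/ (INR k + 1 / 2)) < ang_momentum x t < angmom lam (/ (INR k - 1 / 2))).

Lemma two_solutions (vs : R) : 0 < vs -> exists e, 0 < e /\ forall eps, Rabs eps <= e ->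
  exists x1 x2, good_orbit eps vs x1 /\ good_orbit eps vs x2 /\ geom_distinct x1 x2 /\ geom_distinct x2 x1.
Proof.
  intro Pvs.
  destruct (closed_orbits kap lam H U k kap_pos lam_pos H_neg U_C2 k_ge_2 noncircular) as [K [e [Pe Horb]]].
  destruct kepler_period as [Kt [DK EK]].
  assert (Tp := turn_pos k k_ge_2). assert (K2 := INR_k_ge_2 k k_ge_2).
  set (L := angmom lam (wstar k)) in *.
  set (Llo := angmom lam (/ (INR k + 1 / 2))). set (Lhi := angmom lam (/ (INR k - 1 / 2))).
  assert (Hlo : Llo < L) by (apply angmom_decreasing; lra).
  assert (Hhi : L < Lhi) by (apply angmom_decreasing; lra).
  (* The first two entries keep the angular momentum in its interval; [vs / turn k] is the error in
     [dt / ds] allowed over an angle [turn k]. *)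
  set (m := Rmin (Rmin (L - Llo) (Lhi - L)) (vs / turn k)).
  assert (Pm : 0 < m) by (unfold m; repeat apply Rmin_pos; try lra; now apply Rdiv_lt_0_compat).
  assert (M1 : m <= L - Llo) by (eapply Rle_trans; [apply Rmin_l | apply Rmin_l]).
  assert (M2 : m <= Lhi - L) by (eapply Rle_trans; [apply Rmin_l | apply Rmin_r]).
  assert (M3 : m <= vs / turn k) by apply Rmin_r.
  assert (PK : 0 < Rabs K + 1) by (generalize (Rabs_pos K); lra).
  exists (Rmin e (m / (2 * (Rabs K + 1)))). split.
  { apply Rmin_pos; auto. apply Rdiv_lt_0_compat; lra. }
  intros eps He.
  assert (He1 : Rabs eps <= e) by (eapply Rle_trans; [apply He | apply Rmin_l]).
  assert (He2 : Rabs eps <= m / (2 * (Rabs K + 1))) by (eapply Rle_trans; [apply He | apply Rmin_r]).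
  assert (He3 : K * Rabs eps < m).
  { apply Rle_div_r in He2; [| lra].
    assert (Q := Rabs_pos eps). assert (Q2 := Rle_abs K).
    assert (K * Rabs eps <= Rabs K * Rabs eps) by (apply Rmult_le_compat_r; auto). lra. }
  destruct (Horb eps He1) as [a [b [r [p [l [Ha [Hb [Hab Hc]]]]]]]].
  assert (Hsol : forall th, th = a \/ th = b -> exists x, good_orbit eps vs x /\
    (exists q, 0 < q /\ x 0 = (q * cos th, q * sin th)) /\
    at_pericentre kap lam x 0 /\ (forall t, at_pericentre kap lam x t -> x t = x 0)).
  { intros th Hth. destruct (Hc th Hth) as [Hclosed Hnear].
    destruct (orbit_to_solution kap lam eps H th U k (r th) (p th) (l th) k_ge_2 Hclosed)
      as [x [T [tm [X1 [X2 [X3 [X4 [[X5 [X6 X7]] [X8 [X9 [X10 X11]]]]]]]]]]].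
    exists x. split; [| auto]. split; [auto |]. split; [auto |]. split.
    - exists T. split; [auto |]. split; [| auto].
      rewrite <- EK, <- X6.
      assert (B := derive_bound (fun s => tm s - Kt s) _ 0 (turn k) (K * Rabs eps) ltac:(lra)
        (fun s Hs => is_derive_minus tm Kt s _ _ (X7 s Hs) (DK s))
        (fun s Hs => proj2 (Hnear s Hs))).
      cbv beta in B. rewrite X5 in B.
      replace (tm (turn k) - (Kt (turn k) - Kt 0)) with (tm (turn k) - Kt (turn k) - (0 - Kt 0)) by ring.
      eapply Rle_lt_trans; [apply B |]. rewrite Rminus_0_r.
      apply Rlt_le_trans with (m * turn k); [apply Rmult_lt_compat_r; auto |].
      apply Rle_div_r in M3; [| lra]. auto.
    - intro t. destruct (X11 t) as [s [Hs E]]. rewrite E.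
      assert (B := proj1 (Hnear s Hs)). apply Rabs_le_between in B. fold Llo. fold Lhi. lra. }
  (* A time shift would carry the pericentre of [x] at time 0 to a pericentre of [x'], hence to the
     point [x' 0], and both starting points would lie at the same angle. *)
  assert (Hdist : forall th th' x x', 0 <= th < 2 * PI -> 0 <= th' < 2 * PI -> th <> th' ->
    (exists q, 0 < q /\ x 0 = (q * cos th, q * sin th)) -> at_pericentre kap lam x 0 ->
    (exists q, 0 < q /\ x' 0 = (q * cos th', q * sin th')) ->
    (forall t, at_pericentre kap lam x' t -> x' t = x' 0) -> geom_distinct x x').
  { intros th th' x x' Hth Hth' Hne [q [Pq E]] Hp [q' [Pq' E']] Hp' [s Hs].
    apply Hne. apply (invariants_shift kap lam x x' s Hs 0) in Hp.
    assert (E2 := Hp' _ Hp). rewrite <- Hs, E, E' in E2. injection E2 as C1 C2.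
    apply (polar_angle_unique q q' th th'); auto. }
  destruct (Hsol a (or_introl eq_refl)) as [x1 [G1 [S1 [A1 B1]]]].
  destruct (Hsol b (or_intror eq_refl)) as [x2 [G2 [S2 [A2 B2]]]].
  exists x1, x2. split; [auto |]. split; [auto |]. split.
  - apply (Hdist a b); auto.
  - apply (Hdist b a); auto.
Qed.

End Assembly.

(** * Common threshold, reduction to unit mass and conclusion *)

Lemma finitely_many_thresholds (Q : nat -> R -> Prop) (N : nat) :
  (forall j, (1 <= j <= N)%nat -> exists e, 0 < e /\ forall eps, Rabs eps <= e -> Q j eps) ->
  exists e, 0 < e /\ forall eps, Rabs eps <= e -> forall j, (1 <= j <= N)%nat -> Q j eps.
Proof.
  induction N as [| N IH]; intro H.
  - exists 1. split; [lra |]. intros; lia.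
  - destruct IH as [e1 [P1 K1]]; [intros j Hj; apply H; lia |].
    destruct (H (S N)) as [e2 [P2 K2]]; [lia |].
    exists (Rmin e1 e2). split; [now apply Rmin_pos |]. intros eps He j Hj.
    destruct (Nat.eq_dec j (S N)) as [-> | Hj'].
    + apply K2. eapply Rle_trans; [apply He | apply Rmin_r].
    + apply K1; [| lia]. eapply Rle_trans; [apply He | apply Rmin_l].
Qed.

Lemma is_solution_unit_mass m kap lam eps U x : 0 < m ->
  is_solution 1 (kap / m) (lam / m) (eps / m) U x -> is_solution m kap lam eps U x.
Proof.
  intros Hm Hs t. destruct (Hs t) as [N [D1 [D2 [a1 [a2 [D3 [D4 [E1 E2]]]]]]]].
  split; auto. split; auto. split; auto. exists a1, a2. split; auto. split; auto.
  rewrite Rmult_1_l in E1, E2. rewrite E1, E2. unfold Rdiv.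
  generalize (/ nrm (x t) ^ 3) (/ nrm (x t) ^ 4). intros i3 i4. split; field; lra.
Qed.

Lemma energy_unit_mass m kap lam eps U x t : 0 < m ->
  energy m kap lam eps U x t = m * energy 1 (kap / m) (lam / m) (eps / m) U x t.
Proof.
  intro Hm. unfold energy, Rdiv. generalize (/ nrm (x t)) (/ nrm (x t) ^ 2). intros i1 i2. field. lra.
Qed.

Lemma period_unit_mass m kap H : 0 < m -> 0 < kap -> H < 0 ->
  2 * PI * (kap / m) / sqrt (- 2 * (H / m)) ^ 3 = PI * kap * sqrt m / (sqrt 2 * Rpower (- H) (3 / 2)).
Proof.
  intros Hm Hk HH.
  replace (- 2 * (H / m)) with (2 * (- H) / m) by (field; lra).
  rewrite sqrt_div_alt, sqrt_mult_alt by lra.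
  replace (3 / 2) with (1 + / 2) by field. rewrite Rpower_plus, Rpower_1, Rpower_sqrt by lra.
  assert (S1 : 0 < sqrt m) by (apply sqrt_lt_R0; lra). assert (S2 : 0 < sqrt 2) by (apply sqrt_lt_R0; lra).
  assert (S3 : 0 < sqrt (- H)) by (apply sqrt_lt_R0; lra).
  assert (E1 : sqrt m ^ 2 = m) by (apply pow2_sqrt; lra). assert (E2 : sqrt 2 ^ 2 = 2) by (apply pow2_sqrt; lra).
  assert (E3 : sqrt (- H) ^ 2 = - H) by (apply pow2_sqrt; lra).
  rewrite <- E3 at 2. rewrite <- E1 at 1. rewrite <- E2 at 1. field. repeat split; lra.
Qed.

(** As [rr ^ 2 = 1 - 4 H lam / kap ^ 2], for [k >= 2] the number [kap ^ 2 + 4 H lam / (k ^ 2 - 1)]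
    is positive exactly when [k] exceeds [rr]. Adding [j >= 1] to the integer part passes [rr], and
    [rr > 1] gives [k >= 2]. *)
Lemma winding_floor kap lam H j : 0 < kap -> 0 < lam -> H < 0 -> (1 <= j)%nat ->
  exists k : nat, (floorR (sqrt (-2 * H) / kap * sqrt (2 * lam + kap ^ 2 / (-2 * H))) + Z.of_nat j)%Z = Z.of_nat k /\
    (2 <= k)%nat /\ 0 < kap ^ 2 + 4 * H * qstar lam k.
Proof.
  intros Hk Hl HH Hj.
  assert (Pb : 0 < kap ^ 2 / (-2 * H)) by (apply Rdiv_lt_0_compat; nra).
  set (rr := sqrt (-2 * H) / kap * sqrt (2 * lam + kap ^ 2 / (-2 * H))).
  assert (Er : rr ^ 2 = 1 + -4 * H * lam / kap ^ 2).
  { unfold rr, Rdiv at 1. rewrite !Rpow_mult_distr, !pow2_sqrt by lra. field. lra. }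
  assert (Pr : 0 <= rr).
  { unfold rr. apply Rmult_le_pos; [apply Rdiv_le_0_compat; [apply sqrt_pos | lra] | apply sqrt_pos]. }
  assert (Pc : 0 < -4 * H * lam / kap ^ 2) by (apply Rdiv_lt_0_compat; nra).
  assert (Gr : 1 < rr) by nra.
  unfold floorR. destruct (base_Int_part rr) as [F1 F2].
  assert (0 < Int_part rr)%Z by (apply lt_IZR; lra).
  exists (Z.to_nat (Int_part rr) + j)%nat. split; [lia |]. split; [lia |].
  assert (Hkk : rr < INR (Z.to_nat (Int_part rr) + j)).
  { rewrite INR_IZR_INZ. apply Rlt_le_trans with (IZR (Int_part rr + 1)); [rewrite plus_IZR; lra |].
    apply IZR_le. lia. }
  set (q := INR (Z.to_nat (Int_part rr) + j)) in *. unfold qstar. fold q.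
  assert (Hq : rr ^ 2 < q ^ 2) by nra. rewrite Er in Hq.
  assert (Hq' : -4 * H * lam < kap ^ 2 * (q ^ 2 - 1)).
  { replace (-4 * H * lam) with (kap ^ 2 * (-4 * H * lam / kap ^ 2)) by (field; lra).
    apply Rmult_lt_compat_l; [nra | lra]. }
  replace (kap ^ 2 + 4 * H * (lam / (q ^ 2 - 1))) with ((kap ^ 2 * (q ^ 2 - 1) - -4 * H * lam) / (q ^ 2 - 1)) by (field; lra).
  apply Rdiv_lt_0_compat; lra.
Qed.

Theorem theorem3p1 (m kappa lambda : R) (U : R -> R -> R) (Hstar : R) (N : nat) :
  0 < m -> 0 < kappa -> 0 < lambda -> smooth2 U -> Hstar < 0 ->
  forall vs : R, 0 < vs ->
  exists epsstar : R, 0 < epsstar /\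
  forall eps : R, Rabs eps <= epsstar ->
  exists X : nat -> nat -> (R -> R * R),
    (forall i j, (1 <= i <= 2)%nat -> (1 <= j <= N)%nat ->
       is_solution m kappa lambda eps U (X i j) /\
       (forall t, energy m kappa lambda eps U (X i j) t = Hstar) /\
       exists T : R,
         minimal_period (X i j) T /\
         Rabs (T - PI * kappa * sqrt m / (sqrt 2 * Rpower (- Hstar) (3 / 2))) < vs /\
         winding_number (X i j) T
           (floorR (sqrt (-2 * Hstar) / kappa
                    * sqrt (2 * lambda + kappa ^ 2 / (-2 * Hstar)))
            + Z.of_nat j)%Z) /\
    (forall i j i' j', (1 <= i <= 2)%nat -> (1 <= j <= N)%nat ->
       (1 <= i' <= 2)%nat -> (1 <= j' <= N)%nat -> (i, j) <> (i', j') ->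
       geom_distinct (X i j) (X i' j')).
Proof.
  intros Hm Hk Hl HU HH vs Hvs.
  (* The condition on [j] sits inside the existential so that the choice function is defined on all
     of [nat]; at [j = 0] its value is arbitrary. *)
  assert (Hkey : forall j, exists k : nat, (1 <= j)%nat ->
    (floorR (sqrt (-2 * Hstar) / kappa * sqrt (2 * lambda + kappa ^ 2 / (-2 * Hstar))) + Z.of_nat j)%Z = Z.of_nat k /\
    (2 <= k)%nat /\ 0 < kappa ^ 2 + 4 * Hstar * qstar lambda k).
  { intro j. destruct (le_lt_dec 1 j) as [Hj | Hj].
    - destruct (winding_floor kappa lambda Hstar j Hk Hl HH Hj) as [k Hkk]. now exists k.
    - exists 0%nat. lia. }
  destruct (functional_choice _ Hkey) as [kk Hkk].
  set (Q := fun j eps => exists x1 x2,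
    good_orbit (kappa / m) (lambda / m) (Hstar / m) U (kk j) eps vs x1 /\
    good_orbit (kappa / m) (lambda / m) (Hstar / m) U (kk j) eps vs x2 /\
    geom_distinct x1 x2 /\ geom_distinct x2 x1).
  destruct (finitely_many_thresholds Q N) as [e [Pe He]].
  { intros j Hj. destruct (Hkk j (proj1 Hj)) as [_ [K1 K2]].
    apply two_solutions; auto; try (now apply Rdiv_lt_0_compat).
    - apply Rmult_lt_reg_r with m; auto. unfold Rdiv. rewrite Rmult_assoc, Rinv_l; lra.
    - replace ((kappa / m) ^ 2 + 4 * (Hstar / m) * qstar (lambda / m) (kk j)) with
        ((kappa ^ 2 + 4 * Hstar * qstar lambda (kk j)) * (/ m) ^ 2).
      + apply Rmult_lt_0_compat; auto. apply pow_lt, Rinv_0_lt_compat; auto.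
      + unfold qstar. assert (B := INR_k_ge_2 (kk j) K1). field. split; nra. }
  (* Passing to unit mass divides [eps] by [m]. *)
  exists (m * e). split; [now apply Rmult_lt_0_compat |].
  intros eps Heps.
  assert (Heps' : Rabs (eps / m) <= e).
  { unfold Rdiv. rewrite Rabs_mult, Rabs_inv, (Rabs_right m) by lra.
    apply Rmult_le_reg_r with m; auto. rewrite Rmult_assoc, Rinv_l by lra. lra. }
  assert (Hpair : forall j, exists x : (R -> R * R) * (R -> R * R), (1 <= j <= N)%nat ->
    good_orbit (kappa / m) (lambda / m) (Hstar / m) U (kk j) (eps / m) vs (fst x) /\
    good_orbit (kappa / m) (lambda / m) (Hstar / m) U (kk j) (eps / m) vs (snd x) /\
    geom_distinct (fst x) (snd x) /\ geom_distinct (snd x) (fst x)).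
  { intro j. destruct (le_lt_dec 1 j) as [Hj | Hj]; [destruct (le_lt_dec j N) as [Hj' | Hj'] |].
    - destruct (He _ Heps' j (conj Hj Hj')) as [x1 [x2 G]]. now exists (x1, x2).
    - exists (fun _ => (0, 0), fun _ => (0, 0)). lia.
    - exists (fun _ => (0, 0), fun _ => (0, 0)). lia. }
  destruct (functional_choice _ Hpair) as [xx Hxx].
  exists (fun i j => if Nat.eq_dec i 1 then fst (xx j) else snd (xx j)).
  assert (Hgood : forall i j, (1 <= j <= N)%nat ->
    good_orbit (kappa / m) (lambda / m) (Hstar / m) U (kk j) (eps / m) vs
      (if Nat.eq_dec i 1 then fst (xx j) else snd (xx j))).
  { intros i j Hj. destruct (Hxx j Hj) as [G1 [G2 _]]. destruct (Nat.eq_dec i 1); auto. }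
  split.
  - intros i j Hi Hj. destruct (Hgood i j Hj) as [G1 [G2 [[T [G3 [G4 G5]]] _]]].
    destruct (Hkk j (proj1 Hj)) as [EK _].
    split; [now apply is_solution_unit_mass |]. split.
    + intro t. rewrite energy_unit_mass, G2 by auto. field. lra.
    + exists T. rewrite <- period_unit_mass, EK by auto. auto.
  - intros i j i' j' Hi Hj Hi' Hj' Hne.
    destruct (Nat.eq_dec j j') as [Ej | Ej].
    + subst j'. destruct (Hxx j Hj) as [_ [_ [G3 G4]]].
      destruct (Nat.eq_dec i 1) as [E1 | E1]; destruct (Nat.eq_dec i' 1) as [E2 | E2]; auto.
      * exfalso. apply Hne. congruence.
      * exfalso. apply Hne. f_equal. lia.
    + intros [s Hs].
      assert (A1 := proj2 (proj2 (proj2 (Hgood i j Hj))) 0).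
      assert (A2 := proj2 (proj2 (proj2 (Hgood i' j' Hj'))) (0 + s)).
      (* The zeros fill in the constants of the pericentre condition; the angular momentum does not
         involve them. *)
      destruct (invariants_shift 0 0 _ _ s Hs 0) as [E _]. rewrite E in A1.
      destruct (Hkk j (proj1 Hj)) as [E1 [K1 _]]. destruct (Hkk j' (proj1 Hj')) as [E2 [K2 _]].
      assert (B1 := INR_k_ge_2 (kk j) K1). assert (B2 := INR_k_ge_2 (kk j') K2).
      assert (Plm : 0 < lambda / m) by (now apply Rdiv_lt_0_compat).
      (* The intervals of angular momentum share at most an endpoint, as
         [k1 + 1 / 2 <= k2 - 1 / 2]. *)
      assert (Hsep : forall k1 k2 : nat, 2 <= INR k1 -> (k1 < k2)%nat ->
        angmom (lambda / m) (/ (INR k2 - 1 / 2)) <= angmom (lambda / m) (/ (INR k1 + 1 / 2))).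
      { intros k1 k2 H1 H2. apply le_INR in H2. rewrite S_INR in H2.
        destruct (Req_dec (INR k2 - 1 / 2) (INR k1 + 1 / 2)) as [Eq | Nq]; [rewrite Eq; lra |].
        left. apply angmom_decreasing; lra. }
      destruct (Nat.lt_total (kk j) (kk j')) as [Lt | [Eq | Lt]].
      * assert (S := Hsep _ _ B1 Lt). lra.
      * apply Ej. apply Nat2Z.inj. lia.
      * assert (S := Hsep _ _ B2 Lt). lra.
Qed.
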